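(* Assume Conditions C1*–C4* (stated in the context), let $\Psi_0\in\boldsymbol{\Psi}_m^{(p)}$ and $\boldsymbol\Sigma_0$ a $p\times p$ positive definite matrix, and let $\boldsymbol X_1,\boldsymbol X_2,\ldots$ be i.i.d. with density $g(\boldsymbol x;\Psi_0,\boldsymbol\Sigma_0)$. Let $(\hat\Psi,\hat{\boldsymbol\Sigma})=(\hat\Psi_n,\hat{\boldsymbol\Sigma}_n)$ be a maximizer of $\ell_n(\Psi,\boldsymbol\Sigma)=\sum_{i=1}^n\log g(\boldsymbol X_i;\Psi,\boldsymbol\Sigma)$ over $\Psi\in\boldsymbol{\Psi}_m^{(p)}$ and positive definite $\boldsymbol\Sigma$. Then almost surely $D^*(\hat\Psi_n,\Psi_0)\to0$ and $\hat{\boldsymbol\Sigma}_n\to\boldsymbol\Sigma_0$ as $n\to\infty$.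
   Context: Fix positive integers $m,p$. Let $f_0:[0,\infty)\to[0,\infty)$ be a density generator, i.e. $\boldsymbol x\mapsto f_0(\boldsymbol x^\top\boldsymbol x)$ is a probability density on $\mathbb{R}^p$. For $\boldsymbol\mu\in\mathbb{R}^p$ and positive definite $p\times p$ matrix $\boldsymbol\Sigma$, set $f(\boldsymbol x;\boldsymbol\mu,\boldsymbol\Sigma)=|\boldsymbol\Sigma|^{-1/2}f_0((\boldsymbol x-\boldsymbol\mu)^\top\boldsymbol\Sigma^{-1}(\boldsymbol x-\boldsymbol\mu))$. Let $\boldsymbol{\Psi}_m^{(p)}$ be the set of distribution functions on $\mathbb{R}^p$ of the form $\Psi(\boldsymbol\mu)=\sum_{j=1}^m\alpha_j I(\boldsymbol\mu_j\le\boldsymbol\mu)$ (componentwise inequality) with $\alpha_j\ge0$, $\sum_j\alpha_j=1$, $\boldsymbol\mu_j\in\mathbb{R}^p$, and $g(\boldsymbol x;\Psi,\boldsymbol\Sigma)=\sum_{j=1}^m\alpha_j f(\boldsymbol x;\boldsymbol\mu_j,\boldsymbol\Sigma)$. Define $D^*(\Psi_1,\Psi_2)=\int_{\mathbb{R}^p}|\Psi_1(\boldsymbol\mu)-\Psi_2(\boldsymbol\mu)|\exp(-|\boldsymbol\mu|)\,d\boldsymbol\mu$ with $|\boldsymbol\mu|=\sum_{l=1}^p|\mu_l|$. Conditions: (C1* ) identifiability: if $g(\cdot;\Psi_1,\boldsymbol\Sigma_1)=g(\cdot;\Psi_2,\boldsymbol\Sigma_2)$ everywhere then $\Psi_1=\Psi_2$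 and $\boldsymbol\Sigma_1=\boldsymbol\Sigma_2$. (C2* ) $\int_{\mathbb{R}^p}|\log g(\boldsymbol x;\Psi_0,\boldsymbol\Sigma_0)|\,g(\boldsymbol x;\Psi_0,\boldsymbol\Sigma_0)\,d\boldsymbol x<\infty$. (C3* ) There exist $v_0,v_1>0$ and $\beta>p$ with $f_0(x)\le\min\{v_0,v_1x^{-\beta/2}\}$ for all $x\ge0$. (C4* ) $f_0$ is continuous on $[0,\infty)$. *)

(* Defs.v *)
From HB Require Import structures.
From mathcomp Require Import all_boot all_order all_algebra.
From mathcomp Require Import all_classical all_reals all_analysis.
Set Implicit Arguments. Unset Strict Implicit. Unset Printing Implicit Defensive.
Import Order.TTheory GRing.Theory Num.Theory.
Import numFieldNormedType.Exports.
Local Open Scope classical_set_scope.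
Local Open Scope ring_scope.

Section Defs.
Variable R : realType.

(* Lebesgue integral over R^p (p-dimensional row vectors) of a function,
   written as the iterated one-dimensional Lebesgue integral; by Tonelli this
   coincides with the Lebesgue integral on R^p for the nonnegative Borel
   integrands used below. *)
Fixpoint intRp (n : nat) : ('rV[R]_n -> \bar R) -> \bar R :=
  match n with
  | 0 => fun h => h 0
  | n'.+1 => fun h =>
      (\int[@lebesgue_measure R]_x intRp (fun v : 'rV[R]_n' => h (row_mx (\row_(k < 1) x) v)))%E
  end.

Definition borelRp (p : nat) : set (set 'rV[R]_p) := <<s @open 'rV[R]_p >>.

Definition posdef (p : nat) (S : 'M[R]_p) : Prop :=
  S^T = S /\ forall v : 'rV[R]_p, v != 0 -> 0 < (v *m S *m v^T) 0 0.

Definition density_generator (p : nat) (f0 : R -> R) : Prop :=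
  measurable_fun (`[0%R, +oo[%classic : set R) f0 /\
  (forall x, 0 <= x -> 0 <= f0 x) /\
  intRp (fun x : 'rV[R]_p => (f0 ((x *m x^T) 0 0))%:E) = 1%E.

Definition fell (p : nat) (f0 : R -> R) (x mu : 'rV[R]_p) (S : 'M[R]_p) : R :=
  (Num.sqrt (\det S))^-1 * f0 (((x - mu) *m invmx S *m (x - mu)^T) 0 0).

(* a finite mixing distribution with m support points: weights al, atoms mu *)
Definition is_mixing (m p : nat) (al : 'I_m -> R) (mu : 'I_m -> 'rV[R]_p) : Prop :=
  (forall j, 0 <= al j) /\ \sum_(j < m) al j = 1.

Definition cwle (p : nat) (a b : 'rV[R]_p) : Prop := forall k, a 0 k <= b 0 k.

Definition Psi_of (m p : nat) (al : 'I_m -> R) (mu : 'I_m -> 'rV[R]_p)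
  (u : 'rV[R]_p) : R :=
  \sum_(j < m) al j * (`[< cwle (mu j) u >])%:R.

Definition gmix (m p : nat) (f0 : R -> R) (al : 'I_m -> R) (mu : 'I_m -> 'rV[R]_p)
  (S : 'M[R]_p) (x : 'rV[R]_p) : R :=
  \sum_(j < m) al j * fell f0 x (mu j) S.

Definition norm1 (p : nat) (u : 'rV[R]_p) : R := \sum_(k < p) `|u 0 k|.

Definition Dstar (p : nat) (Psi1 Psi2 : 'rV[R]_p -> R) : \bar R :=
  intRp (fun u => (`|Psi1 u - Psi2 u| * expR (- norm1 u))%:E).

(* log with log 0 = -oo (values of g are nonnegative) *)
Definition elog (x : R) : \bar R := if 0 < x then (ln x)%:E else -oo%E.

End Defs.

Definition rvec_measurable (R : realType) (d : measure_display) (T : measurableType d)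
  (p : nat) (X : T -> 'rV[R]_p) : Prop :=
  forall A, borelRp A -> measurable (X @^-1` A).

Definition has_density (R : realType) (d : measure_display) (T : measurableType d)
  (P : probability T R) (p : nat) (X : T -> 'rV[R]_p) (g : 'rV[R]_p -> R) : Prop :=
  forall A, borelRp A -> P (X @^-1` A) = intRp (fun x => (\1_A x * g x)%:E).

Definition mutually_independent (R : realType) (d : measure_display) (T : measurableType d)
  (P : probability T R) (p : nat) (X : nat -> T -> 'rV[R]_p) : Prop :=
  forall (s : seq nat) (A : nat -> set 'rV[R]_p), uniq s ->
    (forall i, i \in s -> borelRp (A i)) ->
    P (\bigcap_(i in [set i | i \in s]) (X i @^-1` A i)) =
    (\prod_(i <- s) P (X i @^-1` A i))%E.

(* Main.v *)
(** Chernoff bounds replace the law of large numbers.  Write a parameter as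
    weights, atoms and a matrix [A] with [Sigma^-1 = A A^T].  For [0 < s < 1]
    the product of the [(H(X_i) / g0(X_i))^s] has expectation
    [(int g0^(1-s) H^s)^n], so by Borel-Cantelli a set of parameters whose
    densities are all below some [H] with [int g0^(1-s) H^s < 1] almost surely
    stops containing likelihood maximizers.  Call such sets good.

    If the parameters at distance at least [r] from the truth were not good,
    they would carry an ultrafilter none of whose members is good.  Along it
    either [A] stays bounded or [A] blows up.

    - Bounded: weights and [A] converge and each atom converges or escapes to
      infinity, so the densities are eventually below
      [g_lim + e + C 1_(|x| > N)] for a sub-mixture [g_lim], which is integrable
      against [g0^(1-s)] thanks to the tail condition C3.  Hence
      [int g0^(1-s) g_lim^s >= 1], weighted AM-GM forces [g_lim = g0], and
      identifiability contradicts the distance to the truth.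
    - Blow-up: if [tau] is the size of [A], the densities are at most
      [C tau^p] on thin slabs around [m] hyperplanes and [C tau^(p - beta)]
      elsewhere.  A Chernoff bound limits the fraction of the sample in the slabs
      and another one gives [prod g0(X_i) > L^n]. *)
Require Import Defs.
From HB Require Import structures.
From mathcomp Require Import all_boot all_order all_algebra.
From mathcomp Require Import all_classical all_reals all_analysis.
From mathcomp Require Import measurable_realfun ring lra.
Set Implicit Arguments. Unset Strict Implicit. Unset Printing Implicit Defensive.
Import Order.TTheory GRing.Theory Num.Theory.
Import numFieldNormedType.Exports.
Local Open Scope classical_set_scope.
Local Open Scope ring_scope.

(** The power [s] is there for integrability. The comparison function [H] contains a constant [e],
    which has no finite Lebesgue integral; [e^s] is harmless against the weight [g0^(1-s)], which is
    integrable once [p < beta (1 - s)]. Since [beta > p], such an [s] exists.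

    Parameters escape compactness in three ways: an atom leaves, [Sigma] grows, or [Sigma]
    degenerates. In terms of [A], growth of [Sigma] is an ordinary limit at a singular matrix, where
    the kernel is 0, so it is treated like an escaping atom, as lost mass. Only degeneration, where
    [A] is unbounded, is a case of its own. There, with a fraction [q] of the sample in the slabs,
    the likelihood is at most about [tau^(n (q beta - (beta - p)))]. It is small as soon as [q]
    stays below [(beta - p) / (2 beta)], and thin slabs achieve this because hyperplanes are null
    sets.

    [intRp] is an iterated integral, so linear changes of variables are proved for triangular
    matrices, and Cholesky factors carry them to all invertible ones. *)

Notation Rp R p := (g_sigma_algebraType (@open 'rV[R]_p)).

(** * Borel sets of row vectors, coordinate by coordinate *)

Section borel_row_vectors.
Variable R : realType.

(** Every open set is a countable union of sup-norm balls with rational centre and radius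
    [1 / (n + 1)], and the preimage of such a ball is a finite intersection of conditions on single
    coordinates. *)
Lemma measurable_fun_rV d (T : measurableType d) p (F : T -> Rp R p) :
  (forall k, measurable_fun setT (fun t => (F t : 'rV[R]_p) 0 k)) -> measurable_fun setT F.
Proof.
move=> mF; apply: (@measurability _ _ _ (Rp R p) _ _ (@open 'rV[R]_p)) => // _ [U oU <-].
rewrite setTI.
(* A ball that is not contained in [U] contributes the empty set, so the union may range over all
   pairs. *)
pose V (qn : 'rV[rat]_p * nat) : set T :=
  if `[< ball (map_mx ratr qn.1 : 'rV[R]_p) (qn.2.+1%:R^-1) `<=` U >] then
  \bigcap_(k in [set: 'I_p]) [set t | `|(F t : 'rV[R]_p) 0 k - ratr (qn.1 0 k)| < qn.2.+1%:R^-1] else set0.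
have -> : F @^-1` U = \bigcup_qn V qn.
  apply/seteqP; split => [t Ut|t [[q n] _]]; last first.
    rewrite /V/=; case: asboolP => // BU tq; apply: BU; split => //= i k.
    rewrite !ord1 mxE /ball/= distrC; exact: tq.
  have /nbhs_ballP[e/= e0 eU] : nbhs (F t : 'rV[R]_p) U by exact: open_nbhs_nbhs.
  have [n ne] : exists n, n.+1%:R^-1 < e / 2.
    have e20 : 0 < e / 2 by rewrite divr_gt0.
    have [N _ /(_ N (leqnn _)) H] := near_infty_natSinv_lt (PosNum e20).
    by exists N.
  have qP k : exists q : rat, `|(F t : 'rV[R]_p) 0 k - ratr q| < n.+1%:R^-1.
    have /rat_in_itvoo[q] : (F t : 'rV[R]_p) 0 k - n.+1%:R^-1 < (F t : 'rV[R]_p) 0 k + n.+1%:R^-1.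
      by rewrite ltrD2l gtrN// invr_gt0.
    by rewrite in_itv/= -ltr_distl => qF; exists q; rewrite distrC.
  have [q {}qP] := choice qP.
  exists (\row_k q k, n) => //; rewrite /V/=; case: asboolP => [_ k _ /=|].
    by rewrite mxE; exact: qP.
  apply: contra_notP => _ v [_ /= vq]; apply: eU; split => // i k.
  rewrite !ord1; have := vq 0 k; rewrite !mxE /ball/= => vqk; have := qP k => H.
  rewrite (le_lt_trans (ler_distD (ratr (q k)) _ _))// [ltRHS]splitr ltrD//.
    exact: lt_trans ne.
  exact: lt_trans ne.
apply: countable_bigcupT_measurable => [|[q n]]; first exact: countableP.
rewrite /V; case: asboolP => // _.
apply: fin_bigcap_measurable => [|k _]; first exact: finite_finset.
have : measurable_fun setT (fun t => `|(F t : 'rV[R]_p) 0 k - ratr (q 0 k)|).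
  by apply: measurableT_comp => //; exact: measurable_funD.
move=> /(_ measurableT `]-oo, n.+1%:R^-1[%classic (measurable_itv _)).
by rewrite setTI.
Qed.

Lemma continuous_measurable_rV p (f : 'rV[R]_p -> R) :
  continuous f -> measurable_fun setT (f : Rp R p -> R).
Proof.
move=> cf; apply: (measurability _ (RGenOpens.measurableE R)).
move=> _ [_ [a [b ->]] <-]; rewrite setTI; apply: sub_sigma_algebra.
by move/continuousP : cf; apply; exact: interval_open.
Qed.

Lemma measurable_coord p k : measurable_fun setT (fun v : Rp R p => (v : 'rV[R]_p) 0 k).
Proof.
by apply: (@continuous_measurable_rV p (fun v => v 0 k)); exact: coord_continuous.
Qed.

Definition consrV n (z : R * 'rV[R]_n) : 'rV[R]_n.+1 := row_mx (\row_(k < 1) z.1) z.2.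

Lemma consrV0 n (z : R * 'rV[R]_n) : consrV z 0 ord0 = z.1.
Proof.
have -> : ord0 = lshift n (0 : 'I_1) by apply: val_inj.
by rewrite [LHS](row_mxEl (\row_(k < 1) z.1) z.2) mxE.
Qed.

Lemma consrVS n (z : R * 'rV[R]_n) k : consrV z 0 (lift ord0 k) = z.2 0 k.
Proof.
have -> : lift ord0 k = rshift 1 k by apply: val_inj.
exact: (row_mxEr (\row_(k < 1) z.1) z.2).
Qed.

Definition unconsrV n (v : 'rV[R]_n.+1) : R * 'rV[R]_n :=
  (v 0 ord0, \row_k v 0 (lift ord0 k)).

Lemma unconsrVK n : cancel (@unconsrV n) (@consrV n).
Proof.
move=> v; apply/rowP => k; have [j ->|->] := unliftP ord0 k.
  by rewrite consrVS mxE.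
by rewrite consrV0.
Qed.

Lemma consrVK n : cancel (@consrV n) (@unconsrV n).
Proof.
move=> [x v]; congr pair; first exact: consrV0.
by apply/rowP => k; rewrite mxE consrVS.
Qed.

Lemma measurable_unconsrV n :
  measurable_fun setT (fun v : Rp R n.+1 => unconsrV v : measurableTypeR R * Rp R n).
Proof.
apply: measurable_fun_pair => /=; first exact: measurable_coord.
apply: measurable_fun_rV => k; under eq_fun do rewrite mxE.
exact: measurable_coord.
Qed.

Definition consRp n (z : measurableTypeR R * Rp R n) : Rp R n.+1 := consrV z.

Lemma measurable_consRp n : measurable_fun setT (@consRp n).
Proof.
apply: measurable_fun_rV => k; have [j ->|->] := unliftP ord0 k.
  under eq_fun do rewrite consrVS.
  by apply: (measurableT_comp (measurable_coord j)); exact: measurable_snd.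
under eq_fun do rewrite consrV0.
exact: measurable_fst.
Qed.

End borel_row_vectors.

(** * The iterated integral as an integral against a measure *)

Section measure_on_row_vectors.
Variable R : realType.
Local Open Scope ereal_scope.

(* The witness is the push-forward of the product measure along [consrV]. *)
Lemma intRp_measure n : exists mu : {sigma_finite_measure set (Rp R n) -> \bar R},
  forall h : 'rV[R]_n -> \bar R, measurable_fun setT (h : Rp R n -> _) ->
    (forall x, 0 <= h x) -> intRp h = \int[mu]_x h x.
Proof.
elim: n => [|n [mu IH]].
  exists \d_((0%R : 'rV[R]_0) : Rp R 0) => h mh h0 /=.
  by rewrite integral_dirac//= diracT mul1e.
have mc := @measurable_consRp R n.
pose nu' : {measure set (Rp R n.+1) -> \bar R} :=
  pushforward (@lebesgue_measure R \x mu) (@consRp R n).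
pose nu := nu' mc.
(* Sigma-finiteness is carried through the induction because the product measure and Tonelli's
   theorem of the next dimension rest on it. *)
have nusf : sigma_finite setT nu.
  have /sigma_finiteP[F [TF ndF Foo]] := sigma_finiteT (@lebesgue_measure R).
  have /sigma_finiteP[G [TG ndG Goo]] := sigma_finiteT mu.
  exists (fun k => (@unconsrV R n) @^-1` (F k `*` G k)).
    rewrite -preimage_bigcup; apply/seteqP; split => // v _ /=.
    have [i _ Fi] : (\bigcup_i F i) (unconsrV v).1 by rewrite -TF.
    have [j _ Gj] : (\bigcup_i G i) (unconsrV v).2 by rewrite -TG.
    exists (maxn i j) => //; split.
      by move: Fi; exact/subsetPset/ndF/leq_maxl.
    by move: Gj; exact/subsetPset/ndG/leq_maxr.
  move=> k; have [mFk Fk] := Foo k; have [mGk Gk] := Goo k.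
  split.
    rewrite -[X in measurable X]setTI; apply: measurable_unconsrV => //.
    exact: measurableX.
  rewrite /nu /nu' /= /pushforward -comp_preimage (_ : _ \o _ = id).
    by rewrite preimage_id product_measure1E// lte_mul_pinfty// ge0_fin_numE.
  by apply/funext => z; rewrite /= /consRp consrVK.
pose nuS := Measure_isSigmaFinite.Build _ _ _ nu nusf.
pose nu2 : {sigma_finite_measure set (Rp R n.+1) -> \bar R} := HB.pack (nu : set _ -> _) (Measure.class nu) nuS.
exists nu2 => h mh h0 /=.
have mhc : measurable_fun setT (fun z : measurableTypeR R * Rp R n => h (consrV z)).
  exact: (measurableT_comp mh mc).
transitivity (\int[@lebesgue_measure R \x mu]_z h (consrV z)).
  rewrite fubini_tonelli1//.
  apply: eq_integral => x _; rewrite IH//.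
  exact: (measurable_fun_pair2 x mhc).
by rewrite [RHS](ge0_integral_pushforward mc)// => y _; exact: h0.
Qed.

End measure_on_row_vectors.

Section integral_transfer.
Local Open Scope ereal_scope.
Context d1 d2 d (T1 : measurableType d1) (T2 : measurableType d2)
  (B : measurableType d) (R : realType).
Variables (mu1 : {measure set T1 -> \bar R}) (mu2 : {measure set T2 -> \bar R}).
Variables (phi1 : T1 -> B) (phi2 : T2 -> B).
Hypotheses (mphi1 : measurable_fun setT phi1) (mphi2 : measurable_fun setT phi2).
Variables (a : T1 -> R) (b : T2 -> R).
Hypotheses (ma : measurable_fun setT a) (mb : measurable_fun setT b).
Hypotheses (a0 : forall x, (0 <= a x)%R) (b0 : forall x, (0 <= b x)%R).
Hypothesis ab : forall A, measurable A ->
  \int[mu1]_x (a x * \1_A (phi1 x))%:E = \int[mu2]_x (b x * \1_A (phi2 x))%:E.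

Import HBNNSimple.

Let approx_limit d' (T : measurableType d') (mu : {measure set T -> \bar R})
    (phi : T -> B) (c : T -> R) (h : B -> R)
    (mh : measurable_fun setT (EFin \o h)) :
  measurable_fun setT phi -> measurable_fun setT c -> (forall x, 0 <= c x)%R ->
  (forall x, 0 <= h x)%R ->
  \int[mu]_x (c x * h (phi x))%:E =
  limn (fun n => \int[mu]_x (c x * nnsfun_approx measurableT mh n (phi x))%:E).
Proof.
move=> mphi mc c0 h0; rewrite -monotone_convergence//.
- apply: eq_integral => x _; apply/esym/cvg_lim => //.
  under eq_fun do rewrite EFinM.
  rewrite EFinM; apply: cvgeZl => //.
  by apply: (cvg_nnsfun_approx measurableT mh) => // y _; rewrite lee_fin.
- move=> n; apply/measurable_EFinP/measurable_funM => //.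
  by apply: measurableT_comp => //; exact: measurable_funP.
- by move=> n x _; rewrite lee_fin mulr_ge0.
- move=> x _ m n mn; rewrite lee_fin ler_wpM2l//.
  exact/lefP/nd_nnsfun_approx.
Qed.

Let simple_expand d' (T : measurableType d') (mu : {measure set T -> \bar R})
    (phi : T -> B) (c : T -> R) (h : {nnsfun B >-> R}) :
  measurable_fun setT phi -> measurable_fun setT c -> (forall x, 0 <= c x)%R ->
  \int[mu]_x (c x * h (phi x))%:E =
  \sum_(k \in range h) k%:E * \int[mu]_x (c x * \1_(h @^-1` [set k]) (phi x))%:E.
Proof.
move=> mphi mc c0.
have mI k : measurable_fun setT (fun x => c x * \1_(h @^-1` [set k]) (phi x))%R.
  by apply: measurable_funM => //; exact: measurableT_comp.
transitivity (\int[mu]_x \sum_(k \in range h)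
    (k * (c x * \1_(h @^-1` [set k]) (phi x)))%:E).
  apply: eq_integral => x _; rewrite EFinM fimfunE -fsumEFin//.
  rewrite ge0_mule_fsumr; last first.
    by move=> i; exact: nnfun_muleindic_ge0.
  by apply: eq_fsbigr => k _; rewrite -!EFinM mulrCA.
rewrite ge0_integral_fsum//.
- apply: eq_fsbigr => k; rewrite inE => -[y _ <-].
  under eq_integral do rewrite EFinM.
  rewrite ge0_integralZl//; [exact/measurable_EFinP| |by rewrite lee_fin].
  by move=> x _; rewrite lee_fin mulr_ge0.
- by move=> k; apply/measurable_EFinP/measurable_funM.
- move=> k x _; rewrite mulrCA lee_fin mulr_ge0//.
  by have := nnfun_muleindic_ge0 h k (phi x); rewrite -EFinM lee_fin.
Qed.

(** Agreement on indicators passes to simple functions and then to monotone limits. Weights and maps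
    are left general for two uses: the density formula, with [phi2] the identity, and the removal of
    one factor from a product over the sample, with [b] constant. *)
Lemma ge0_integral_transfer (h : B -> R) :
  measurable_fun setT h -> (forall x, 0 <= h x)%R ->
  \int[mu1]_x (a x * h (phi1 x))%:E = \int[mu2]_x (b x * h (phi2 x))%:E.
Proof.
move=> /measurable_EFinP mh h0.
rewrite !(approx_limit _ mh)//; congr (limn _); apply/funext => n.
rewrite !simple_expand//; apply: eq_fsbigr => k _; congr (_ * _).
by apply: ab; exact: measurable_sfunP.
Qed.

End integral_transfer.

Section lebesgue_row_vectors.
Variable R : realType.
Local Open Scope ereal_scope.

Definition lebRp n : {sigma_finite_measure set (Rp R n) -> \bar R} :=
  sval (cid (intRp_measure R n)).

Lemma intRpE n (h : 'rV[R]_n -> \bar R) : measurable_fun setT (h : Rp R n -> _) ->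
  (forall x, 0 <= h x) -> intRp h = \int[lebRp n]_x h x.
Proof. by rewrite /lebRp; case: cid => mu /= H; exact: H. Qed.

Lemma intRpS n (h : 'rV[R]_n.+1 -> \bar R) :
  intRp h = \int[lebesgue_measure]_x intRp (fun v => h (consrV (x, v))).
Proof. by []. Qed.

Lemma eq_intRp n (f g : 'rV[R]_n -> \bar R) : f =1 g -> intRp f = intRp g.
Proof. by move=> /funext ->. Qed.

Lemma intRp_ge0 n (h : 'rV[R]_n -> \bar R) : (forall x, 0 <= h x) -> 0 <= intRp h.
Proof.
elim: n h => [|n IH] h h0; first exact: h0.
by rewrite intRpS; apply: integral_ge0 => x _; exact: IH.
Qed.

Lemma measurable_prod_coord n (a : 'I_n -> R -> R) :
  (forall k, measurable_fun setT (a k)) ->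
  measurable_fun setT (fun v : Rp R n => \prod_k a k ((v : 'rV[R]_n) 0 k))%R.
Proof.
move=> ma; apply: measurable_prod => k _.
exact: (measurableT_comp (ma k) (measurable_coord k)).
Qed.

Lemma intRp_prod n (a : 'I_n -> R -> R) :
  (forall k, measurable_fun setT (a k)) -> (forall k x, 0 <= a k x)%R ->
  intRp (fun v => (\prod_k a k (v 0 k))%:E)%R =
  \prod_k \int[lebesgue_measure]_x (a k x)%:E.
Proof.
elim: n a => [|n IH] a ma a0; first by rewrite /= !big_ord0.
rewrite intRpS big_ord_recl -IH//.
under eq_integral.
  move=> x _; under eq_intRp.
    move=> v; rewrite big_ord_recl consrV0/=.
    under eq_bigr do rewrite consrVS/=.
    rewrite EFinM; over.
  over.
have m1 : measurable_fun setT (fun v : Rp R n => \prod_(i < n) a (lift ord0 i) ((v : 'rV[R]_n) 0 i))%R.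
  exact: (@measurable_prod_coord n (fun i => a (lift ord0 i))).
have g1 (v : 'rV[R]_n) : (0 <= \prod_(i < n) a (lift ord0 i) (v 0 i))%R.
  exact: prodr_ge0.
under eq_integral.
  move=> x _; rewrite intRpE; last 2 first.
  - by apply: emeasurable_funM => //; exact/measurable_EFinP.
  - by move=> v; rewrite -EFinM lee_fin mulr_ge0.
  rewrite ge0_integralZl//; [|exact/measurable_EFinP|by move=> v _; rewrite lee_fin|by rewrite lee_fin].
  rewrite -intRpE; [|exact/measurable_EFinP|by move=> v; rewrite lee_fin].
  over.
rewrite ge0_integralZr//.
- by apply/measurable_EFinP; exact: ma.
- by move=> x _; rewrite lee_fin.
- by apply: intRp_ge0 => v; rewrite lee_fin.
Qed.

End lebesgue_row_vectors.

(** * Affine change of variables and Cholesky factors *)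

Section affine_change_of_variables.
Variable R : realType.
Local Open Scope ereal_scope.
Notation mu := (@lebesgue_measure R).

(** The push-forward of Lebesgue measure, rescaled by [a], gives half-open intervals their length,
    and this characterizes Lebesgue measure. *)
Lemma ge0_integral_affine (a c : R) (h : R -> \bar R) : (0 < a)%R ->
  measurable_fun setT h -> (forall x, 0 <= h x) ->
  \int[mu]_x h (a * x + c)%R = a^-1%:E * \int[mu]_x h x.
Proof.
move=> a0 mh h0.
pose phi : measurableTypeR R -> measurableTypeR R := fun x => (a * x + c)%R.
have mphi : measurable_fun setT phi.
  by apply: measurable_funD => //; exact: measurable_funM.
pose nu' : {measure set (measurableTypeR R) -> \bar R} := pushforward mu phi.
pose nu := nu' mphi.
pose k : {nonneg R} := NngNum (ltW a0).
suff -> : \int[mu]_x h x = \int[mscale k nu]_x h x.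
  rewrite ge0_integral_mscale// muleA -EFinM mulVf ?gt_eqF// mul1e.
  by rewrite [RHS](ge0_integral_pushforward mphi).
apply: eq_measure_integral => A mA _; apply: lebesgue_measure_unique => //.
move=> _ [[x y] _ <-] /=; rewrite /mscale/= /nu /nu' /pushforward/=.
have -> : phi @^-1` `]x, y]%classic = `]((x - c) / a)%R, ((y - c) / a)%R]%classic.
  apply/seteqP; split => z /=; rewrite /phi !in_itv/= ltr_pdivrMr// ler_pdivlMr//.
    by rewrite ltrBlDr lerBrDr (mulrC z).
  by rewrite ltrBlDr lerBrDr (mulrC z).
rewrite !lebesgue_measure_itv/= !lte_fin ltr_pM2r ?invr_gt0// ltrD2r.
case: ifPn => // _; last by rewrite mule0.
rewrite -?EFinB -?EFinM -?EFinB -?EFinM; congr EFin => /=; field; by rewrite gt_eqF.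
Qed.

Lemma measurable_intRp_consrV n (h : 'rV[R]_n.+1 -> \bar R) :
  measurable_fun setT (h : Rp R n.+1 -> _) -> (forall x, 0 <= h x) ->
  measurable_fun setT (fun x : R => intRp (fun v => h (consrV (x, v)))).
Proof.
move=> mh h0.
have mhc : measurable_fun setT (fun z : measurableTypeR R * Rp R n => h (consrV z)).
  exact: (measurableT_comp mh (@measurable_consRp R n)).
rewrite (_ : (fun x => _) = fubini_F (lebRp R n) (fun z : measurableTypeR R * Rp R n => h (consrV z))).
  exact: measurable_fun_fubini_tonelli_F.
by apply/funext => x; rewrite /fubini_F intRpE//; exact: (measurable_fun_pair2 x mhc).
Qed.

Definition uptri n (A : 'M[R]_n) : Prop :=
  (forall i j : 'I_n, (j < i)%N -> A i j = 0%R) /\ (forall i, 0 < A i i)%R.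

Lemma measurable_affine_rV n (A : 'M[R]_n) (c : 'rV[R]_n) :
  measurable_fun setT (fun x : Rp R n => ((x : 'rV[R]_n) *m A + c)%R : Rp R n).
Proof.
apply: measurable_fun_rV => k; under eq_fun do rewrite !mxE.
apply: measurable_funD => //; apply: measurable_sum => i.
by apply: measurable_funM => //; exact: measurable_coord.
Qed.

(** For upper triangular [A] the first coordinate of [x A + c] depends on the first coordinate of
    [x] alone. The inner integral is then an affine image under the smaller block [A'], with a
    translation [c'] that depends on the outer variable. *)
Lemma intRp_affine n (A : 'M[R]_n) (c : 'rV[R]_n) (h : 'rV[R]_n -> \bar R) :
  uptri A -> measurable_fun setT (h : Rp R n -> _) -> (forall x, 0 <= h x) ->
  intRp (fun x => h (x *m A + c)%R) = ((\prod_i A i i)^-1)%:E * intRp h.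
Proof.
elim: n A c h => [|n IH] A c h [A0 Ad] mh h0.
  by rewrite /= big_ord0 invr1 mul1e; congr h; apply/rowP => -[].
pose A' : 'M[R]_n := \matrix_(i, j) A (lift ord0 i) (lift ord0 j).
have tA' : uptri A' by split=> [i j ij|i]; rewrite mxE// A0.
pose c' (x : R) : 'rV[R]_n := (\row_j (x * A ord0 (lift ord0 j) + c 0 (lift ord0 j)))%R.
have stepE x (v : 'rV[R]_n) : (consrV (x, v) *m A + c)%R =
    consrV ((A ord0 ord0 * x + c 0 ord0)%R, (v *m A' + c' x)%R).
  apply/rowP => k; have [j ->|->] := unliftP ord0 k.
    rewrite consrVS !mxE big_ord_recl consrV0/=.
    rewrite [X in (_ + X + _)%R](_ : _ = \sum_i v 0 i * A' i j)%R; first by ring.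
    by apply: eq_bigr => i _; rewrite consrVS/= mxE.
  rewrite consrV0 !mxE big_ord_recl consrV0/= big1 ?addr0 1?mulrC// => i _.
  by rewrite A0// mulr0.
pose H y := intRp (fun v => h (consrV (y, v))).
have mH : measurable_fun setT H by exact: measurable_intRp_consrV.
have H0 y : 0 <= H y by apply: intRp_ge0.
have prodA' : (\prod_i A' i i = \prod_i A (lift ord0 i) (lift ord0 i))%R.
  by apply: eq_bigr => i _; rewrite mxE.
have A'0 : (0 < \prod_i A' i i)%R by apply: prodr_gt0 => i _; case: tA'.
have maff : measurable_fun setT (fun x : R => A ord0 ord0 * x + c 0 ord0)%R.
  by apply: measurable_funD => //; exact: measurable_funM.
rewrite !intRpS; under eq_integral.
  move=> x _; under eq_intRp do rewrite stepE.
  rewrite (@IH A' (c' x) (fun v => h (consrV ((A ord0 ord0 * x + c 0 ord0)%R, v)))) //; last first.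
    exact: (measurable_fun_pair2 _ (measurableT_comp mh (@measurable_consRp R n))).
  rewrite -/(H _); over.
rewrite ge0_integralZl//; last 2 first.
- exact: (measurableT_comp mH maff).
- by rewrite lee_fin invr_ge0 ltW.
rewrite ge0_integral_affine// muleA -EFinM; congr (_%:E * _).
by rewrite big_ord_recl invfM -prodA' mulrC.
Qed.

End affine_change_of_variables.

Section positive_definite.
Variable R : realType.

Lemma mx11_mul_trE n (v : 'rV[R]_n) : (v *m v^T) 0 0 = \sum_k v 0 k ^+ 2.
Proof. by rewrite mxE; apply: eq_bigr => k _; rewrite mxE expr2. Qed.

Lemma posdef_unitmx n (S : 'M[R]_n) : posdef S -> S \in unitmx.
Proof.
move=> [_ Spos]; rewrite -row_free_unit; apply: inj_row_free => v vS.
apply/eqP; apply: contraT => /Spos.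
by rewrite vS mul0mx mxE ltxx.
Qed.

Lemma posdef_inv n (S : 'M[R]_n) : posdef S -> posdef (invmx S).
Proof.
move=> Spd; have Su := posdef_unitmx Spd; case: Spd => St Spos; split.
  by rewrite trmx_inv St.
move=> v v0; have := Spos (v *m invmx S).
rewrite mulmxKV// trmx_mul trmx_inv St mulmxA; apply.
apply: contra v0 => /eqP vS; apply/eqP.
by rewrite -(mulmxKV Su v) vS mul0mx.
Qed.

Lemma uptri_det n (A : 'M[R]_n) : uptri A -> \det A = \prod_i A i i.
Proof.
move=> [A0 _]; rewrite -det_tr det_trig.
  by apply: eq_bigr => i _; rewrite mxE.
by apply/is_trig_mxP => i j ij; rewrite mxE A0.
Qed.

Lemma uptri_det_gt0 n (A : 'M[R]_n) : uptri A -> 0 < \det A.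
Proof. by move=> Au; rewrite uptri_det//; apply: prodr_gt0 => i _; case: Au. Qed.

(** Induction splits off the first row and column. If [A] factors the lower right block, the new row
    [c] solves [c A^T = b], and the new diagonal entry is the root of the Schur complement [s]. *)
Lemma cholesky n (Q : 'M[R]_n) : posdef Q -> exists2 A, uptri A & Q = A *m A^T.
Proof.
elim: n Q => [|n IH] Q [Qt Qpos].
  by exists 0; [split; case | apply/matrixP; case].
move: Q Qt Qpos; rewrite -[n.+1]/(1 + n)%N => Q Qt Qpos.
pose a := ulsubmx Q; pose b := ursubmx Q; pose D := drsubmx Q.
have Qb : Q = block_mx a b b^T D.
  by rewrite -{1}(submxK Q); congr block_mx; rewrite /b trmx_ursub Qt.
have Dt : D^T = D by rewrite /D trmx_drsub Qt.
have Dpos : posdef D.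
  split=> // v v0; have := Qpos (row_mx 0 v).
  rewrite Qb mul_row_block tr_row_mx mul_row_col trmx0 !mul0mx !add0r mulmx0 add0r.
  apply; apply: contra v0 => /eqP v0.
  by have := row_mxKr (0 : 'rV_1) v; rewrite v0 => <-; rewrite linear0.
have [A Au DA] := IH _ Dpos.
have Aun : A \in unitmx by rewrite unitmxE unitfE gt_eqF// uptri_det_gt0.
pose c := b *m invmx A^T.
have cA : c *m A^T = b by rewrite mulmxKV// unitmx_tr.
pose e := - c *m invmx A.
have eA : e *m A = - c by rewrite mulmxKV.
pose s := a 0 0 - (c *m c^T) 0 0.
(* [s] is the value of the form [Q] at [(1, e)], where [e] minimizes the form among vectors with
   first entry 1. *)
have s0 : 0 < s.
  have := Qpos (row_mx 1%:M e).
  have -> : row_mx 1%:M e *m Q *m (row_mx 1%:M e)^T = a - c *m c^T.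
    have be : b *m e^T = - (c *m c^T).
      by rewrite -cA -mulmxA -trmx_mul eA linearN mulmxN.
    have eb : e *m b^T = - (c *m c^T).
      by rewrite -[LHS]trmxK trmx_mul trmxK be linearN/= trmx_mul trmxK.
    have eDe : e *m D *m e^T = c *m c^T.
      by rewrite DA mulmxA -mulmxA -trmx_mul eA linearN/= mulNmx mulmxN opprK.
    rewrite Qb mul_row_block tr_row_mx mul_row_col trmx1 mulmx1 mul1mx mul1mx.
    by rewrite mulmxDl eDe be eb addrA addrNK.
  rewrite mxE [X in _ + X]mxE -/s; apply.
  apply/eqP => /(congr1 lsubmx); rewrite row_mxKl linear0 => /matrixP/(_ 0 0).
  by rewrite !mxE eqxx => /eqP; rewrite oner_eq0.
pose B : 'M[R]_(1 + n) := block_mx (Num.sqrt s)%:M c 0 A.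
exists B.
  split.
    move=> i j; case: (split_ordP i) => [i' ->|i' ->]; case: (split_ordP j) => [j' ->|j' ->].
    - by rewrite !ord1.
    - by rewrite ord1/=; rewrite ltnNge.
    - by rewrite block_mxEdl mxE.
    - by rewrite block_mxEdr/= ltn_add2l; case: Au => + _; apply.
  move=> i; case: (split_ordP i) => [i' ->|i' ->].
    by rewrite block_mxEul !ord1 mxE eqxx mulr1n sqrtr_gt0.
  by rewrite block_mxEdr; case: Au.
rewrite Qb tr_block_mx mulmx_block trmx0 !mul0mx !mulmx0 !add0r DA cA.
congr block_mx.
  apply/matrixP => i j; rewrite !ord1 tr_scalar_mx -scalar_mxM -expr2 sqr_sqrtr 1?ltW//.
  by rewrite [RHS]mxE [X in X + _]mxE eqxx mulr1n /s subrK.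
by rewrite -cA trmx_mul trmxK.
Qed.

(** With [A] as parameter the factor [|Sigma|^(-1/2)] becomes a determinant, hence a polynomial in
    the entries. *)
Lemma posdef_factor n (S : 'M[R]_n) : posdef S -> exists A : 'M[R]_n,
  [/\ uptri A, invmx S = A *m A^T & (Num.sqrt (\det S))^-1 = \det A].
Proof.
move=> Spd; have [A Au SA] := cholesky (posdef_inv Spd).
exists A; split => //.
have d0 := uptri_det_gt0 Au.
have : \det (invmx S) = \det A ^+ 2 by rewrite SA det_mulmx det_tr expr2.
rewrite det_inv => /(congr1 GRing.inv); rewrite invrK => ->.
by rewrite -exprVn sqrtr_sqr ger0_norm ?invr_ge0 1?ltW// invrK.
Qed.

End positive_definite.

(** * Products over an independent sample and Borel-Cantelli *)

Section sample.
Context (R : realType) (d : measure_display) (T : measurableType d).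
Variables (P : probability T R) (p : nat).
Local Open Scope ereal_scope.

Lemma rvec_measurable_fun (X : T -> 'rV[R]_p) :
  rvec_measurable X -> measurable_fun setT (X : T -> Rp R p).
Proof. by move=> mX _ A mA; rewrite setTI; exact: mX. Qed.

Lemma integral_has_density (X : T -> 'rV[R]_p) (g h : 'rV[R]_p -> R) :
  rvec_measurable X -> has_density P X g ->
  measurable_fun setT (g : Rp R p -> R) -> (forall x, 0 <= g x)%R ->
  measurable_fun setT (h : Rp R p -> R) -> (forall x, 0 <= h x)%R ->
  \int[P]_w (h (X w))%:E = \int[lebRp R p]_x (g x * h x)%:E.
Proof.
move=> /rvec_measurable_fun mX Xg mg g0 mh h0.
transitivity (\int[P]_w (1 * h (X w))%:E); first by apply: eq_integral => w _; rewrite mul1r.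
apply: (@ge0_integral_transfer _ _ _ T (Rp R p) (Rp R p) R P (lebRp R p) X id _ _ (cst 1%R) g) => //.
move=> A mA.
under eq_integral do rewrite mul1r.
rewrite (_ : (fun w => _) = fun w => (\1_(X @^-1` A) w)%:E)//.
have mXA : measurable (X @^-1` A) by rewrite -[X in measurable X]setTI; exact: mX.
transitivity (P (X @^-1` A)); first by rewrite integral_indic// setIT.
rewrite (Xg A mA) intRpE; last 2 first.
- by apply/measurable_EFinP; apply: measurable_funM => //; exact: measurable_indic.
- by move=> x; rewrite lee_fin mulr_ge0.
by apply: eq_integral => x _; rewrite mulrC.
Qed.

Variable X : nat -> T -> 'rV[R]_p.
Hypothesis Xmeas : forall i, rvec_measurable (X i).
Hypothesis Xindep : mutually_independent P X.
Variables (h : 'rV[R]_p -> R) (rho : R).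
Hypothesis mh : measurable_fun setT (h : Rp R p -> R).
Hypothesis h0 : forall x, (0 <= h x)%R.
Hypothesis hrho : forall i, \int[P]_w (h (X i w))%:E = rho%:E.

Let mhX i : measurable_fun setT (fun w => h (X i w)).
Proof. exact: (measurableT_comp mh (rvec_measurable_fun (Xmeas i))). Qed.

Let mXA i A : borelRp A -> measurable (X i @^-1` A).
Proof. exact: Xmeas. Qed.

Let mIX i (A : set (Rp R p)) : measurable A -> measurable_fun setT (fun w => \1_A (X i w) : R).
Proof.
move=> mA; have mI : measurable_fun setT (\1_A : Rp R p -> R) by exact: measurable_indic.
exact: (measurableT_comp mI (rvec_measurable_fun (Xmeas i))).
Qed.

(* Indicators are traded for copies of [h] one index at a time. *)
Lemma integral_prod_mixed n k (A : nat -> set 'rV[R]_p) :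
  (forall i, borelRp (A i)) ->
  \int[P]_w (\prod_(i < n) h (X i w) * \prod_(n <= i < n + k) \1_(A i) (X i w))%:E =
  (rho ^+ n * \prod_(n <= i < n + k) fine (P (X i @^-1` A i)))%:E.
Proof.
elim: n k A => [|n IH] k A mA.
  under eq_integral do rewrite big_ord0 mul1r add0n.
  rewrite expr0 mul1r add0n.
  have := Xindep (iota_uniq 0 k) (fun i _ => mA i).
  rewrite (big_morph EFin EFinM (erefl 1)) /index_iota subn0.
  move=> PB; rewrite [RHS](eq_bigr (fun i => P (X i @^-1` A i))); last first.
    by move=> i _; rewrite fineK// fin_num_measure//; exact: mXA.
  rewrite -PB.
  set B := \bigcap_(_ in _) _.
  have mB : measurable B by apply: bigcap_measurableType => i _; exact: mXA.
  transitivity (\int[P]_w (\1_B w)%:E); last by rewrite integral_indic// setIT.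
  apply: eq_integral => w _; congr EFin; rewrite indicE.
  case: (boolP (w \in B)) => [|/negP]; rewrite inE => Bw /=.
    by rewrite big1_seq// => i /= ik; rewrite indicE mem_set//; exact: Bw.
  have [i ik iA] : exists2 i, i \in iota 0 k & ~ A i (X i w).
    apply: contrapT => H; apply: Bw => i /= ik; apply: contrapT => iA; apply: H.
    by exists i.
  by rewrite (big_rem i)//= indicE memNset// mul0r.
under eq_integral.
  move=> w _; rewrite big_ord_recr/= mulrAC; over.
have mI m1 m2 : measurable_fun setT (fun w => \prod_(m1 <= i < m2) \1_(A i) (X i w) : R)%R.
  apply: measurable_prod => i _.
  exact: (mIX i (mA i)).
have mH n' : measurable_fun setT (fun w => \prod_(i < n') h (X i w))%R.
  by apply: measurable_prod => i _; exact: mhX.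
have I0 m1 m2 w : (0 <= \prod_(m1 <= i < m2) \1_(A i) (X i w) :> R)%R.
  by apply: prodr_ge0.
have c0 : (0 <= rho ^+ n * \prod_(n.+1 <= i < n.+1 + k) fine (P (X i @^-1` A i)))%R.
  rewrite mulr_ge0 ?exprn_ge0 ?prodr_ge0// => *; last exact: fine_ge0.
  by rewrite -lee_fin -(hrho 0); apply: integral_ge0 => w _; rewrite lee_fin.
(* The weight collects all factors except the one of index [n]. It may be replaced by the constant
   that it integrates to, once this is checked against indicators of [X n]. *)
rewrite (@ge0_integral_transfer _ _ _ T T (Rp R p) R P P (X n) (X n) _ _
  (fun w => \prod_(i < n) h (X i w) * \prod_(n.+1 <= i < n.+1 + k) \1_(A i) (X i w))%R
  (cst (rho ^+ n * \prod_(n.+1 <= i < n.+1 + k) fine (P (X i @^-1` A i)))%R)).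
- under eq_integral do rewrite EFinM/=.
  rewrite ge0_integralZl//; [|exact/measurable_EFinP|by move=> *; rewrite lee_fin].
  by rewrite hrho -EFinM exprSr mulrAC.
- exact: rvec_measurable_fun.
- exact: rvec_measurable_fun.
- exact: measurable_funM.
- exact: measurable_cst.
- by move=> w; rewrite mulr_ge0// prodr_ge0.
- by [].
- move=> B mB.
  (* [A'] puts the test set [B] at index [n], which turns the check into the induction hypothesis
     with one more indicator. *)
  pose A' i := if i == n then B else A i.
  have mA' i : borelRp (A' i) by rewrite /A'; case: ifP.
  transitivity (\int[P]_w (\prod_(i < n) h (X i w) * \prod_(n <= i < n + k.+1) \1_(A' i) (X i w))%:E).
    apply: eq_integral => w _; congr EFin; rewrite addnS [in RHS]big_ltn ?ltnS ?leq_addr// {1}/A' eqxx.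
    rewrite [X in _ = (_ * (_ * X))%R](@eq_big_nat _ _ _ _ _ _ (fun i => \1_(A i) (X i w))%R); last first.
      by move=> i /andP[ni _]; rewrite /A' gtn_eqF.
    by rewrite mulrA mulrAC addSn.
  rewrite IH// addnS.
  rewrite big_ltn ?ltnS ?leq_addr// {1}/A' eqxx.
  rewrite [X in (_ * (_ * X))%R](@eq_big_nat _ _ _ _ _ _ (fun i => fine (P (X i @^-1` A i)))); last first.
    by move=> i /andP[ni _]; rewrite /A' gtn_eqF.
  under eq_integral do rewrite EFinM/=.
  rewrite ge0_integralZl//; last by apply/measurable_EFinP; exact: (mIX n mB).
  rewrite (_ : (fun w => _) = fun w => (\1_(X n @^-1` B) w)%:E)//.
  rewrite integral_indic ?setIT//; last exact: mXA.
  rewrite mulrCA EFinM muleC fineK// ?fin_num_measure//.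
  exact: mXA.
- by [].
- by [].
Qed.

Lemma integral_prod_indep n :
  \int[P]_w (\prod_(i < n) h (X i w))%:E = (rho ^+ n)%:E.
Proof.
have := @integral_prod_mixed n 0 (fun=> setT) (fun _ => @measurableT _ (Rp R p)).
rewrite addn0 big_geq// mulr1.
by under eq_integral do rewrite big_geq// mulr1.
Qed.

(** Markov's inequality at level 1 bounds the probability of [E n] by [rho ^ n], which is
    summable. *)
Lemma chernoff_ae : (rho < 1)%R ->
  {ae P, forall w, \forall n \near \oo, (\prod_(i < n) h (X i w) < 1)%R}.
Proof.
move=> rho1.
have rho0 : (0 <= rho)%R.
  by rewrite -lee_fin -(hrho 0); apply: integral_ge0 => w _; rewrite lee_fin.
pose E n := [set w | (1 <= \prod_(i < n) h (X i w))%R].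
have mH n : measurable_fun setT (fun w => \prod_(i < n) h (X i w))%R.
  by apply: measurable_prod => i _; exact: mhX.
have mE n : measurable (E n).
  have := mH n measurableT `[1%R, +oo[%classic (measurable_itv _).
  by rewrite setTI; congr measurable; apply/seteqP; split => w /=; rewrite /E/= in_itv/= andbT.
have PE n : P (E n) <= (rho ^+ n)%:E.
  rewrite -integral_prod_indep -[E n]setIT -integral_indic//.
  apply: ge0_le_integral => //.
  - by apply/measurable_EFinP; exact: measurable_indic.
  - exact/measurable_EFinP.
  - move=> w _; rewrite lee_fin indicE; case: (boolP (w \in E n)); first by rewrite inE.
    by move=> _; exact: prodr_ge0.
exists (lim_sup_set E); split.
- apply: bigcap_measurableType => k _; apply: bigcup_measurable => i _; exact: mE.
- apply: lim_sup_set_cvg0 => //.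
  apply: (@le_lt_trans _ _ ((1 - rho)^-1)%:E); last exact: ltry.
  apply: lime_le; first exact: is_cvg_nneseries.
  apply: nearW => n; apply: (@le_trans _ _ (\sum_(0 <= i < n) (rho ^+ i)%:E)).
    by apply: lee_sum => i _; exact: PE.
  rewrite sumEFin lee_fin.
  have := geometric_seriesE 1%R (negbT (lt_eqF rho1)).
  move=> /(congr1 (fun f => f n)); rewrite /series/=.
  under eq_bigr do rewrite mul1r.
  move=> ->; rewrite mul1r ler_pdivrMr ?subr_gt0// mulVf ?gt_eqF ?subr_gt0//.
  by rewrite gerBl exprn_ge0.
move=> w /= Hw n _; apply: contrapT => nE; apply: Hw; exists n => // k /= nk.
rewrite ltNge; apply/negP => kE; apply: nE; exists k => //.
Qed.

End sample.

(** * Polynomial decay, null sets and the equality case of AM-GM *)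

Section integrability.
Variable R : realType.
Notation mu := (@lebesgue_measure R).

Lemma add1_norm_gt0 (x : R) : 0 < 1 + `|x|.
Proof. by rewrite ltr_pwDl. Qed.

Lemma continuous_powR_add1_norm (a : R) : continuous (fun x : R => (1 + `|x|) `^ a).
Proof.
move=> x.
have -> : (fun x : R => (1 + `|x|) `^ a) = (fun x => expR (a * ln (1 + `|x|))).
  by apply/funext => y; rewrite /powR gt_eqF ?add1_norm_gt0.
apply: continuous_comp; last exact: continuous_expR.
apply: cvgM; first exact: cvg_cst.
apply: continuous_cvg.
  apply: continuous_ln; exact: add1_norm_gt0.
apply: cvgD; first exact: cvg_cst.
exact: norm_continuous.
Qed.

Lemma measurable_powR_add1_norm (a : R) :
  measurable_fun setT (fun x : R => (1 + `|x|) `^ a).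
Proof. by apply: continuous_measurable_fun; exact: continuous_powR_add1_norm. Qed.

Lemma integral_powR_add1_norm_lty (a : R) : 1 < a ->
  (\int[mu]_x ((1 + `|x|) `^ (- a))%:E < +oo)%E.
Proof.
move=> a1; rewrite ge0_symfun_integralT; last 3 first.
- by move=> x; exact: powR_ge0.
- exact: continuous_powR_add1_norm.
- by move=> x /=; rewrite normrN.
rewrite -set_itvcy.
(* An antiderivative of [(1 + x)^(-a)] on the half line; it tends to 0 at infinity because
   [a > 1]. *)
pose F (x : R) := - (a - 1)^-1 * (1 + x) `^ (1 - a).
have a10 : 0 < a - 1 by rewrite subr_gt0.
have dF (x : R) : 0 < x -> is_derive x 1 F ((1 + x) `^ (- a)).
  move=> x0; have x10 : 0 < 1 + x by rewrite addr_gt0.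
  have D1 : is_derive x 1 (fun y : R => 1 + y) (0 + 1) by exact: is_deriveD.
  have D2 := is_derive1_comp (is_derive1_powR (1 - a) x10) D1.
  have D3 := is_deriveZ (- (a - 1)^-1) D2.
  apply: is_derive_eq; rewrite /GRing.scale/= (_ : 1 - a - 1 = - a); last by ring.
  by field; rewrite gt_eqF.
rewrite (@ge0_continuous_FTC2y _ _ F _ 0).
- by rewrite -EFinB -EFinM ltry.
- by move=> x _; exact: powR_ge0.
- by apply: continuous_subspaceT; exact: continuous_powR_add1_norm.
- rewrite -[X in _ --> X](mulr0 (- (a - 1)^-1)); apply: cvgMr.
  apply/cvgr0Pnorm_lt => e e0; near=> x.
  have x0 : 0 < x by near: x; exact: nbhs_pinfty_gt.
  have x10 : 0 < 1 + x by rewrite addr_gt0.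
  rewrite ger0_norm ?powR_ge0// -opprB powRN -[ltRHS]invrK ltf_pV2 ?posrE ?invr_gt0 ?powR_gt0//.
  have xM : (e^-1) `^ ((a - 1)^-1) < x by near: x; apply: nbhs_pinfty_gt; rewrite num_real.
  have -> : e^-1 = ((e^-1) `^ ((a - 1)^-1)) `^ (a - 1).
    by rewrite -powRrM mulVf ?gt_eqF// powRr1// invr_ge0 ltW.
  by rewrite gt0_ltr_powR ?nnegrE ?powR_ge0 ?(ltW x10)// (lt_trans xM)// ltrDr.
- by move=> x x0; have [] := dF _ x0.
- apply: cvg_at_right_filter; apply: cvgMr.
  have D1 : is_derive (0 : R) 1 (fun y : R => 1 + y) (0 + 1) by exact: is_deriveD.
  have [D _] := is_derive1_comp (is_derive1_powR (1 - a) (ltr_pwDl ltr01 (lexx 0))) D1.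
  by move/derivable1_diffP : D => /differentiable_continuous.
- move=> x; rewrite in_itv/= andbT => x0; rewrite derive1E; have [_ ->] := dF _ x0.
  by rewrite ger0_norm// ltW.
Unshelve. all: by end_near. Qed.

Local Open Scope ereal_scope.

Lemma le_intRp n (f g : 'rV[R]_n -> \bar R) :
  measurable_fun setT (f : Rp R n -> _) -> measurable_fun setT (g : Rp R n -> _) ->
  (forall x, 0 <= f x) -> (forall x, f x <= g x) -> intRp f <= intRp g.
Proof.
move=> mf mg f0 fg; rewrite !intRpE//; last by move=> x; exact: le_trans (fg x).
exact: ge0_le_integral.
Qed.

Lemma prod_lty n (x : 'I_n -> \bar R) : (forall k, 0 <= x k) -> (forall k, x k < +oo) ->
  \prod_k x k < +oo.
Proof.
move=> x0 xy; rewrite ltey_eq; apply/orP; left.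
apply: (big_ind (fun y => y \is a fin_num)) => // [y z|k _]; first exact: fin_numM.
by rewrite ge0_fin_numE.
Qed.

(** The decay is assumed in each coordinate separately. Splitting [g^r] into [n] equal factors
    [g^(r / n)] and bounding factor [k] through coordinate [k] gives a product of one-dimensional
    functions with exponent [be r / n > 1]. *)
Lemma powR_decay_integrable n (g : 'rV[R]_n -> R) (C be r : R) :
  (0 < n)%N -> (0 < r)%R -> (n%:R < be * r)%R -> measurable_fun setT (g : Rp R n -> R) ->
  (forall x, 0 <= g x)%R -> (forall x k, g x <= C * (1 + `|x 0 k|) `^ (- be))%R ->
  \int[lebRp R n]_x (g x `^ r)%:E < +oo.
Proof.
move=> n0 r0 ber mg g0 gC.
have nR : (0 < n%:R :> R)%R by rewrite ltr0n.
have C0 : (0 <= C)%R.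
  have := le_trans (g0 0%R) (gC 0%R (Ordinal n0)).
  by rewrite pmulr_lge0// powR_gt0// add1_norm_gt0.
have mgr : measurable_fun setT ((fun x => g x `^ r)%R : Rp R n -> R).
  exact: (measurableT_comp (measurable_powR r) mg).
pose a (k : 'I_n) (x : R) := (C `^ (r / n%:R) * (1 + `|x|) `^ (- (be * r / n%:R)))%R.
have ma k : measurable_fun setT (a k).
  by apply: measurable_funM => //; exact: measurable_powR_add1_norm.
have a0 k x : (0 <= a k x)%R by rewrite mulr_ge0// powR_ge0.
rewrite -intRpE; [|exact/measurable_EFinP|by move=> x; rewrite lee_fin powR_ge0].
apply: (@le_lt_trans _ _ (intRp (fun v : 'rV[R]_n => (\prod_k a k (v 0 k))%:E)%R)).
  apply: le_intRp.
  - exact/measurable_EFinP.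
  - by apply/measurable_EFinP; exact: measurable_prod_coord.
  - by move=> x; rewrite lee_fin powR_ge0.
  move=> x; rewrite lee_fin.
  have -> : (g x `^ r = \prod_(k < n) g x `^ (r / n%:R))%R.
    rewrite prodr_const card_ord -powR_mulrn ?powR_ge0// -powRrM.
    by rewrite divfK// gt_eqF.
  apply: ler_prod => k _; rewrite powR_ge0/= /a.
  have -> : (- (be * r / n%:R) = - be * (r / n%:R))%R by rewrite mulNr mulrA.
  rewrite [X in (_ <= _ * X)%R]powRrM -powRM ?powR_ge0//.
  by apply: ge0_ler_powR; rewrite ?nnegrE ?mulr_ge0 ?powR_ge0 ?divr_ge0 ?(ltW r0) ?(ltW nR).
rewrite intRp_prod//; apply: prod_lty => k.
  by apply: integral_ge0 => x _; rewrite lee_fin.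
rewrite /a; under eq_integral do rewrite EFinM.
rewrite ge0_integralZl//.
- rewrite lte_mul_pinfty ?lee_fin ?powR_ge0//.
  by rewrite integral_powR_add1_norm_lty// ltr_pdivlMr// mul1r.
- by apply/measurable_EFinP; exact: measurable_powR_add1_norm.
- by rewrite lee_fin powR_ge0.
Qed.

End integrability.

Section null_sets.
Variable R : realType.
Local Open Scope ereal_scope.

Lemma lebRp_ball_gt0 n (x : 'rV[R]_n) (e : R) : (0 < e)%R ->
  0 < lebRp R n (ball x e).
Proof.
move=> e0.
have mb : measurable (ball x e : set (Rp R n)).
  by apply: sub_sigma_algebra; exact: ball_open.
pose a (k : 'I_n) (y : R) : R := \1_`](x 0 k - e)%R, (x 0 k + e)%R[%classic y.
have ma k : measurable_fun setT (a k) by exact: measurable_indic.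
have a0 k y : (0 <= a k y)%R by [].
suff <- : intRp (fun v : 'rV[R]_n => (\prod_k a k (v 0 k))%:E)%R = lebRp R n (ball x e).
  rewrite intRp_prod//.
  rewrite (eq_bigr (fun=> (2 * e)%:E)); last first.
    move=> k _; transitivity (lebesgue_measure (`](x 0 k - e)%R, (x 0 k + e)%R[%classic : set R)).
      by rewrite integral_indic// setIT.
    rewrite lebesgue_measure_itv/= lte_fin.
    rewrite ltrD2l gtrN// -EFinB; congr EFin; ring.
  rewrite -(big_morph EFin EFinM (erefl 1)) lte_fin.
  by apply: prodr_gt0 => k _; rewrite mulr_gt0.
rewrite intRpE; last 2 first.
- by apply/measurable_EFinP; exact: measurable_prod_coord.
- by move=> v; rewrite lee_fin prodr_ge0.
transitivity (\int[lebRp R n]_v (\1_(ball x e : set (Rp R n)) v)%:E); last by rewrite integral_indic// setIT.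
apply: eq_integral => v _; congr EFin; rewrite indicE.
case: (boolP (v \in _)) => [|/negP]; rewrite inE => vb.
  rewrite big1// => k _; rewrite /a indicE mem_set//= in_itv/= -ltr_distl distrC.
  exact: vb.2.
have [k vk] : exists k, ~ (`|x 0 k - v 0 k| < e)%R.
  apply: contrapT => H; apply: vb; split => // i k; rewrite !ord1.
  by apply: contrapT => xv; apply: H; exists k.
by rewrite (bigD1 k)//= /a indicE memNset ?mul0r//= in_itv/= -ltr_distl distrC.
Qed.

(** Identifiability asks for equality everywhere, whereas the AM-GM argument yields it almost
    everywhere; balls have positive measure, which closes the gap. *)
Lemma continuous_ae_eq n (f g : 'rV[R]_n -> R) :
  continuous f -> continuous g ->
  (lebRp R n).-negligible [set x | f x <> g x] -> f =1 g.
Proof.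
move=> cf cg [N [mN N0 fgN]] x; apply: contrapT => fgx.
have : nbhs x [set y | (0 < `|f y - g y|)%R].
  have cfg : {for x, continuous (fun y => `|f y - g y|)%R}.
    apply: continuous_comp; last exact: norm_continuous.
    by apply: continuousB; [exact: cf|exact: cg].
  by apply: (cvgr_gt _ cfg); rewrite normr_gt0 subr_eq0; apply/eqP.
move=> /nbhs_ballP[e /= e0 eU].
have : lebRp R n (ball x e) <= lebRp R n N.
  apply: le_measure; rewrite ?inE//.
    by apply: sub_sigma_algebra; exact: ball_open.
  move=> y /eU/= ; rewrite normr_gt0 subr_eq0 => /eqP fgy; exact: fgN.
by rewrite N0 leNgt lebRp_ball_gt0.
Qed.

(** If [u] has a nonzero entry after the first, each inner slice is again a hyperplane. Otherwise
    the first coordinate is pinned to one point, and the outer integral runs over a singleton. *)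
Lemma intRp_hyperplane n (u : 'rV[R]_n) (c : R) (g : 'rV[R]_n -> R) : u != 0%R ->
  intRp (fun x => (\1_[set x : 'rV[R]_n | \sum_k u 0 k * x 0 k = c]%R x * g x)%:E) = 0.
Proof.
elim: n u c g => [|n IH] u c g u0.
  by case/eqP: u0; apply/rowP => -[].
have sumE x (v : 'rV[R]_n) : (\sum_k u 0 k * consrV (x, v) 0 k =
    u 0 ord0 * x + \sum_k (unconsrV u).2 0 k * v 0 k)%R.
  by rewrite big_ord_recl consrV0; congr (_ + _)%R; apply: eq_bigr => k _; rewrite consrVS mxE.
rewrite intRpS; have [u'0|u'0] := eqVneq (unconsrV u).2 0%R; last first.
  apply: integral0_eq => x _.
  rewrite -(IH _ (c - u 0 ord0 * x)%R (fun v => g (consrV (x, v))) u'0).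
  apply: eq_intRp => v; congr (_ * _)%:E; rewrite !indicE; congr (nat_of_bool _)%:R.
  rewrite /in_mem/=; apply/asboolP/asboolP; rewrite /= sumE.
    by move=> <-; rewrite addrAC subrr add0r.
  by move=> ->; rewrite addrC subrK.
have u00 : (u 0 ord0 != 0)%R.
  apply: contra u0 => /eqP u00; rewrite -[u]unconsrVK.
  apply/eqP/rowP => k; have [j ->|->] := unliftP ord0 k.
    by rewrite consrVS u'0 !mxE.
  by rewrite consrV0/= u00 mxE.
rewrite -(integral_set1 (fun x => intRp (fun v => (\1_[set x0 : 'rV[R]_n.+1 | (\sum_k u 0 k * x0 0 k)%R = c]
          (consrV (x, v)) * g (consrV (x, v)))%:E)) (c / u 0 ord0)%R).
rewrite [RHS]integral_mkcond; apply: eq_integral => x _; rewrite patchE.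
case: ifPn => // /negP; rewrite inE/= => xc.
have H : forall k, intRp (fun _ : 'rV[R]_k => 0) = 0.
  by elim=> [|k IHk]//; rewrite intRpS; apply: integral0_eq => y _.
rewrite -[RHS](H n); apply: eq_intRp => v; rewrite indicE memNset ?mul0r//= sumE u'0.
rewrite big1 ?addr0 => [uxc|k _]; last by rewrite mxE mul0r.
by apply: xc; rewrite -uxc mulrC mulKf.
Qed.

End null_sets.

Section hellinger.
Variable R : realType.

(** Away from the weighted mean [c] of the logarithms, [expR] lies strictly above its tangent at
    [c]; in the average of the two tangent inequalities the linear terms cancel. The equality case
    is what identifies two densities. *)
Lemma weighted_AMGM (a b s : R) : 0 <= a -> 0 <= b -> 0 < s -> s < 1 ->
  a `^ (1 - s) * b `^ s <= (1 - s) * a + s * b ?= iff (a == b).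
Proof.
move=> a0 b0 s0 s1.
have s10 : 0 < 1 - s by rewrite subr_gt0.
suff H : a != b -> a `^ (1 - s) * b `^ s < (1 - s) * a + s * b.
  have [->|/[dup] ab /H ltab] := eqVneq a b; last first.
    by split; [exact: ltW|rewrite lt_eqF].
  have -> : b `^ (1 - s) * b `^ s = (1 - s) * b + s * b.
    rewrite -powRD subrK ?oner_eq0// powRr1//; ring.
  exact: leif_refl.
have [->|a_neq0] := eqVneq a 0.
  rewrite eq_sym => b_neq0; rewrite powR0 ?gt_eqF// mul0r mulr0 add0r mulr_gt0//.
  by rewrite lt_def b_neq0.
have [->|b_neq0] := eqVneq b 0.
  by move=> _; rewrite powR0 ?gt_eqF// !mulr0 addr0 mulr_gt0// lt_def a_neq0.
have {}a0 : 0 < a by rewrite lt_def a_neq0.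
have {}b0 : 0 < b by rewrite lt_def b_neq0.
move=> ab.
pose A := ln a; pose B := ln b; pose c := (1 - s) * A + s * B.
have AB : A - B != 0 by rewrite subr_eq0; apply: contra ab => /eqP/ln_inj; rewrite !posrE => ->.
have -> : a `^ (1 - s) * b `^ s = expR c.
  by rewrite /powR (negbTE a_neq0) (negbTE b_neq0) -expRD.
have tangent x : x != c -> expR c * (1 + (x - c)) < expR x.
  move=> xc; have -> : expR x = expR c * expR (x - c) by rewrite -expRD addrC subrK.
  by rewrite ltr_pM2l ?expR_gt0// expR_gt1Dx// subr_eq0.
have Ac : A != c.
  rewrite -subr_eq0 (_ : A - c = s * (A - B)); last by rewrite /c; ring.
  by rewrite mulf_neq0// gt_eqF.
have Bc : B != c.
  rewrite -subr_eq0 (_ : B - c = - (1 - s) * (A - B)); last by rewrite /c; ring.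
  by rewrite mulf_neq0// oppr_eq0 gt_eqF.
have := tangent _ Ac; have := tangent _ Bc; rewrite !lnK// => tB tA.
have -> : expR c = (1 - s) * (expR c * (1 + (A - c))) + s * (expR c * (1 + (B - c))).
  by rewrite /c; ring.
by rewrite ltrD// ltr_pM2l.
Qed.

Local Open Scope ereal_scope.

(** The AM-GM deficit [D] is nonnegative, and its integral plus the affinity is at most 1, so an
    affinity of at least 1 leaves a deficit of integral 0. The bound [<= 1] for [g] admits limits
    that have lost mass. *)
Lemma hellinger_ae_eq d (T : measurableType d) (mu : {measure set T -> \bar R})
    (g0 g : T -> R) (s : R) : (0 < s)%R -> (s < 1)%R ->
  measurable_fun setT g0 -> measurable_fun setT g ->
  (forall x, 0 <= g0 x)%R -> (forall x, 0 <= g x)%R ->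
  \int[mu]_x (g0 x)%:E <= 1 -> \int[mu]_x (g x)%:E <= 1 ->
  1 <= \int[mu]_x (g0 x `^ (1 - s) * g x `^ s)%:E ->
  mu.-negligible [set x | g0 x <> g x].
Proof.
move=> s0 s1 mg0 mg g00 gge0 i0 i1 ige.
have s10 : (0 < 1 - s)%R by rewrite subr_gt0.
pose phi x := (g0 x `^ (1 - s) * g x `^ s)%R.
pose D x := ((1 - s) * g0 x + s * g x - phi x)%R.
have mphi : measurable_fun setT phi.
  apply: measurable_funM.
    exact: (measurableT_comp (measurable_powR _) mg0).
  exact: (measurableT_comp (measurable_powR _) mg).
have mlin : measurable_fun setT (fun x => (1 - s) * g0 x + s * g x)%R.
  by apply: measurable_funD; exact: measurable_funM.
have mD : measurable_fun setT D by exact: measurable_funB.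
have phi0 x : (0 <= phi x)%R by rewrite mulr_ge0// powR_ge0.
have D0 x : (0 <= D x)%R by rewrite subr_ge0 weighted_AMGM.
have intD : \int[mu]_x (D x)%:E + \int[mu]_x (phi x)%:E <= 1.
  rewrite -ge0_integralD//; [|by move=> x _; rewrite lee_fin|exact/measurable_EFinP
    |by move=> x _; rewrite lee_fin|exact/measurable_EFinP].
  under eq_integral do rewrite -EFinD /D subrK EFinD !EFinM.
  rewrite ge0_integralD//; last 4 first.
  - by move=> x _; rewrite -EFinM lee_fin mulr_ge0// ltW.
  - by apply/measurable_EFinP; exact: measurable_funM.
  - by move=> x _; rewrite -EFinM lee_fin mulr_ge0// ltW.
  - by apply/measurable_EFinP; exact: measurable_funM.
  rewrite !ge0_integralZl ?lee_fin ?(ltW s0) ?(ltW s10)//;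
    try (exact/measurable_EFinP); try (by move=> x _; rewrite lee_fin).
  rewrite (_ : 1 = (1 - s)%:E * 1 + s%:E * 1); last by rewrite !mule1 -EFinD subrK.
  by rewrite leeD// lee_wpmul2l// lee_fin ltW.
have phifin : \int[mu]_x (phi x)%:E \is a fin_num.
  rewrite ge0_fin_numE; last by apply: integral_ge0 => x _; rewrite lee_fin.
  apply: le_lt_trans (ltry 1); apply: le_trans intD.
  by rewrite leeDr// integral_ge0// => x _; rewrite lee_fin.
have Dle : \int[mu]_x (D x)%:E <= 0.
  have := le_trans intD ige; rewrite -{2}(add0e (\int[mu]_x (phi x)%:E)).
  by rewrite leeD2rE.
have : ae_eq mu setT (EFin \o D) (cst 0).
  apply/ae_eq_integral_abs => //; first exact/measurable_EFinP.
  under eq_integral do rewrite gee0_abs ?lee_fin//.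
  apply/eqP; rewrite eq_le Dle integral_ge0// => x _; by rewrite lee_fin.
apply: negligibleS => x /= gg HD; apply: gg.
have /eqP : D x = 0%R by have /= [] := HD I.
by rewrite subr_eq0 eq_sym weighted_AMGM// => /eqP.
Qed.

End hellinger.

(** * Limits of matrices and kernels along filters and ultrafilters *)

Section filter_convergence.
Variables (R : realType) (J : Type) (F : set_system J).
Context {FF : ProperFilter F}.

Lemma cvg_bigsum (I : Type) (r : seq I) (Pr : pred I) (g : I -> J -> R) (l : I -> R) :
  (forall i, Pr i -> g i x @[x --> F] --> l i) ->
  \sum_(i <- r | Pr i) g i x @[x --> F] --> \sum_(i <- r | Pr i) l i.
Proof.
move=> gl; elim: r => [|i r IH].
  under eq_fun do rewrite big_nil.
  by rewrite big_nil; exact: cvg_cst.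
under eq_fun do rewrite big_cons.
rewrite big_cons; case: ifP => // Pi.
by apply: cvgD => //; exact: gl.
Qed.

Lemma cvg_bigprod (I : Type) (r : seq I) (Pr : pred I) (g : I -> J -> R) (l : I -> R) :
  (forall i, Pr i -> g i x @[x --> F] --> l i) ->
  \prod_(i <- r | Pr i) g i x @[x --> F] --> \prod_(i <- r | Pr i) l i.
Proof.
move=> gl; elim: r => [|i r IH].
  under eq_fun do rewrite big_nil.
  by rewrite big_nil; exact: cvg_cst.
under eq_fun do rewrite big_cons.
rewrite big_cons; case: ifP => // Pi.
by apply: cvgM => //; exact: gl.
Qed.

(** Entrywise convergence, so that limits along an arbitrary filter reduce to sums and products of
    real limits. *)
Definition mxcvg m n (M : J -> 'M[R]_(m, n)) (L : 'M[R]_(m, n)) : Prop :=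
  forall i j, M x i j @[x --> F] --> L i j.

Lemma mxcvg_cst m n (L : 'M[R]_(m, n)) : mxcvg (fun=> L) L.
Proof. by move=> i j; exact: cvg_cst. Qed.

Lemma mxcvgM m n q (M : J -> 'M[R]_(m, n)) (N : J -> 'M[R]_(n, q)) L K :
  mxcvg M L -> mxcvg N K -> mxcvg (fun x => M x *m N x) (L *m K).
Proof.
move=> ML NK i j; under eq_fun do rewrite mxE.
rewrite mxE; apply: cvg_bigsum => k _; exact: cvgM.
Qed.

Lemma mxcvgB m n (M N : J -> 'M[R]_(m, n)) L K :
  mxcvg M L -> mxcvg N K -> mxcvg (fun x => M x - N x) (L - K).
Proof.
move=> ML NK i j; under eq_fun do rewrite !mxE.
rewrite !mxE; exact: cvgB.
Qed.

Lemma mxcvg_tr m n (M : J -> 'M[R]_(m, n)) L : mxcvg M L -> mxcvg (fun x => (M x)^T) L^T.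
Proof. by move=> ML i j; under eq_fun do rewrite mxE; rewrite mxE; exact: ML. Qed.

Lemma cvg_det n (M : J -> 'M[R]_n) L : mxcvg M L -> \det (M x) @[x --> F] --> \det L.
Proof.
move=> ML; apply: cvg_bigsum => s _; apply: cvgMr.
by apply: cvg_bigprod => i _.
Qed.

(** Cramer's formula gives the entries as cofactors over the determinant, which is nonzero along the
    filter from some point on. *)
Lemma mxcvg_inv n (M : J -> 'M[R]_n) L : mxcvg M L -> \det L != 0 ->
  mxcvg (fun x => invmx (M x)) (invmx L).
Proof.
move=> ML L0 i j.
have Lu : L \in unitmx by rewrite unitmxE unitfE.
have -> : invmx L i j = (\det L)^-1 * cofactor L j i.
  by rewrite /invmx Lu !mxE.
have dML := cvg_det ML.
have adjc : cofactor (M x) j i @[x --> F] --> cofactor L j i.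
  apply: cvgMr; case: n M L ML i j {L0 Lu dML} => [|n] M L ML i j; first by case: i.
  by apply: cvg_det => k l; under eq_fun do rewrite !mxE; rewrite !mxE; exact: ML.
apply: cvg_trans (cvgM (cvgV L0 dML) adjc); apply: near_eq_cvg; near=> x.
have dx : \det (M x) != 0.
  have : `|\det L - \det (M x)| < `|\det L|.
    by near: x; move/cvgrPdist_lt: dML; apply; rewrite normr_gt0.
  by apply: contraTneq => ->; rewrite subr0 ltxx.
by rewrite /invmx unitmxE unitfE dx !mxE.
Unshelve. all: by end_near. Qed.

End filter_convergence.

Section mx_topology.
Variable R : realType.

Lemma nbhs_mxcvg m n (L : 'M[R]_(m, n)) : mxcvg (nbhs L) id L.
Proof. by move=> i j; exact: coord_continuous. Qed.

Lemma mxcvg_cvg (J : Type) (F : set_system J) (FF : Filter F) m n (M : J -> 'M[R]_(m, n)) (L : 'M[R]_(m, n)) :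
  (forall e, 0 < e -> \forall x \near F, forall i j, `|L i j - M x i j| < e) ->
  M x @[x --> F] --> L.
Proof.
move=> H; apply/cvgrPdist_lt => e e0; apply: filterS (H e e0) => x Hx.
have : ball L e (M x) by split.
by rewrite mx_norm_ball.
Qed.

End mx_topology.

Section kernel.
Variables (R : realType) (p : nat) (f : R -> R).

(** The elliptical density at displacement [z] from its centre, in terms of a square root [A] of the
    inverse scale matrix. It also makes sense at singular [A], the limits in which the scale blows
    up, and vanishes there. *)
Definition kern (A : 'M[R]_p) (z : 'rV[R]_p) : R :=
  `|\det A| * f ((z *m A *m (z *m A)^T) 0 0).

Lemma fell_kern (S A : 'M[R]_p) x mu :
  invmx S = A *m A^T -> (Num.sqrt (\det S))^-1 = `|\det A| -> fell f x mu S = kern A (x - mu).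
Proof. by move=> SA dS; rewrite /fell /kern SA dS trmx_mul !mulmxA. Qed.

Lemma sqnorm_ge0 n (y : 'rV[R]_n) : 0 <= (y *m y^T) 0 0.
Proof. by rewrite mx11_mul_trE sumr_ge0// => k _; exact: sqr_ge0. Qed.

Lemma sqnorm_eq0 n (y : 'rV[R]_n) : (y *m y^T) 0 0 = 0 -> y = 0.
Proof.
rewrite mx11_mul_trE => /eqP; rewrite psumr_eq0 => [|k _]; last exact: sqr_ge0.
by move=> /allP H; apply/rowP => k; rewrite mxE; have := H k; rewrite mem_index_enum sqrf_eq0 => /(_ isT)/eqP.
Qed.

Lemma coord_le_sqnorm n (y : 'rV[R]_n) k : `|y 0 k| <= Num.sqrt ((y *m y^T) 0 0).
Proof.
rewrite -sqrtr_sqr ler_wsqrtr// mx11_mul_trE (bigD1 k)//= lerDl sumr_ge0// => i _.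
exact: sqr_ge0.
Qed.

Lemma gram_posdef (A : 'M[R]_p) : A \in unitmx -> posdef (A *m A^T).
Proof.
move=> Au; split; first by rewrite trmx_mul trmxK.
move=> v v0; rewrite mulmxA -mulmxA -trmx_mul lt_def sqnorm_ge0 andbT.
apply: contra v0 => /eqP/sqnorm_eq0 vA.
by rewrite -(mulmxK Au v) vA mul0mx.
Qed.

Lemma fell_gram (A : 'M[R]_p) x mu : A \in unitmx ->
  fell f x mu (invmx (A *m A^T)) = kern A (x - mu).
Proof.
move=> Au; apply: fell_kern; first by rewrite invmxK.
by rewrite det_inv det_mulmx det_tr -expr2 -exprVn sqrtr_sqr normfV invrK.
Qed.

Hypothesis cf : continuous f.

Lemma cvg_kern (J : Type) (F : set_system J) (FF : ProperFilter F)
    (A : J -> 'M[R]_p) (z : J -> 'rV[R]_p) A0 z0 :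
  mxcvg F A A0 -> mxcvg F z z0 -> kern (A x) (z x) @[x --> F] --> kern A0 z0.
Proof.
move=> cA cz; have czA : mxcvg F (fun x => z x *m A x) (z0 *m A0) by exact: mxcvgM.
apply: cvgM; first exact: cvg_norm (cvg_det cA).
apply: (@continuous_cvg _ _ _ _ _ (fun x => (z x *m A x *m (z x *m A x)^T) 0 0) f).
  exact: cf.
suff H : mxcvg F (fun x => z x *m A x *m (z x *m A x)^T) (z0 *m A0 *m (z0 *m A0)^T) by exact: (H 0 0).
by apply: mxcvgM => //; exact: mxcvg_tr.
Qed.

Lemma continuous_kern (A : 'M[R]_p) (mu : 'rV[R]_p) : continuous (fun x : 'rV[R]_p => kern A (x - mu)).
Proof.
move=> x; apply: (@cvg_kern _ (nbhs x) _ (fun=> A) (fun y => y - mu)); first exact: mxcvg_cst.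
by apply: mxcvgB; [exact: nbhs_mxcvg|exact: mxcvg_cst].
Qed.

Lemma measurable_kern (A : 'M[R]_p) (mu : 'rV[R]_p) :
  measurable_fun setT ((fun x : 'rV[R]_p => kern A (x - mu)) : Rp R p -> R).
Proof. by apply: continuous_measurable_rV; exact: continuous_kern. Qed.

Hypothesis f_ge0 : forall t, 0 <= f t.

Lemma kern_ge0 A z : 0 <= kern A z.
Proof. by rewrite mulr_ge0. Qed.

Hypothesis f_dens : intRp (fun x : 'rV[R]_p => (f ((x *m x^T) 0 0))%:E) = 1%E.

(** The kernel depends on [A] only through [A A^T], so an invertible [A] may be replaced by the
    triangular Cholesky factor [B], for which the change of variables is available. *)
Lemma intRp_kern (A : 'M[R]_p) (mu : 'rV[R]_p) :
  intRp (fun x : 'rV[R]_p => (kern A (x - mu))%:E) = (\det A != 0)%:R%:E.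
Proof.
have [dA|dA] /= := eqVneq (\det A) 0.
  rewrite intRpE; last 2 first.
  - by apply/measurable_EFinP; exact: measurable_kern.
  - by move=> x; rewrite lee_fin kern_ge0.
  by apply: integral0_eq => x _; rewrite /kern dA normr0 mul0r.
have Au : A \in unitmx by rewrite unitmxE unitfE.
have [B Bu AB] := cholesky (gram_posdef Au).
have dB := uptri_det_gt0 Bu.
have dAB : `|\det A| = \det B.
  have sqE (C : 'M[R]_p) : \det C ^+ 2 = \det (C *m C^T) by rewrite det_mulmx det_tr expr2.
  have : \det A ^+ 2 = \det B ^+ 2 by rewrite !sqE AB.
  move=> /(congr1 Num.sqrt); rewrite !sqrtr_sqr => ->; exact: gtr0_norm.
pose h (y : 'rV[R]_p) : \bar R := (f ((y *m y^T) 0 0))%:E.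
have mh : measurable_fun setT (h : Rp R p -> _).
  apply/measurable_EFinP; apply: continuous_measurable_rV => x.
  have cx := @nbhs_mxcvg _ _ _ x.
  have H : mxcvg (nbhs x) (fun y => y *m y^T) (x *m x^T).
    by apply: mxcvgM => //; exact: mxcvg_tr.
  change {for x, continuous (f \o (fun y : 'rV[R]_p => (y *m y^T) 0 0))}.
  by apply: continuous_comp; [exact: (H 0 0)|exact: cf].
have h0 y : (0 <= h y)%E by rewrite lee_fin.
have mhB : measurable_fun setT (fun x : Rp R p => h ((x : 'rV[R]_p) *m B + - mu *m B)).
  exact: (measurableT_comp mh (measurable_affine_rV B _)).
transitivity (intRp (fun x => (\det B)%:E * h (x *m B + - mu *m B)%R)%E).
  apply: eq_intRp => x; rewrite /h -EFinM /kern dAB.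
  rewrite -mulmxDl trmx_mul !mulmxA -(mulmxA _ A) AB.
  by rewrite trmx_mul !mulmxA.
rewrite intRpE; last 2 first.
- exact: emeasurable_funM.
- by move=> x; rewrite mule_ge0// lee_fin ltW.
rewrite ge0_integralZl//; last by rewrite lee_fin ltW.
rewrite -intRpE// intRp_affine// f_dens mule1 -EFinM -uptri_det//.
by rewrite mulfV// gt_eqF.
Qed.

Variables (v be : R).
Hypothesis f_decay : forall t, 0 <= t -> f t <= v * (1 + Num.sqrt t) `^ (- be).
Hypothesis be1 : 1 <= be.

Lemma decay_const_ge0 : 0 <= v.
Proof.
have := le_trans (f_ge0 0) (f_decay (lexx 0)).
by rewrite sqrtr0 addr0 powR1 mulr1.
Qed.

Lemma decay_le t : 0 <= t -> f t <= v.
Proof.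
move=> t0; apply: le_trans (f_decay t0) _; rewrite ler_piMr ?decay_const_ge0//.
rewrite -[leRHS](powRr0 (1 + Num.sqrt t)) ler_powR ?lerDl ?sqrtr_ge0//.
by rewrite oppr_le0 (le_trans ler01).
Qed.

Lemma kern_le A z : kern A z <= `|\det A| * v.
Proof. by rewrite ler_wpM2l// decay_le// sqnorm_ge0. Qed.

Definition sumabs m n (B : 'M[R]_(m, n)) : R := \sum_i \sum_j `|B i j|.

Lemma entry_le_sumabs m n (B : 'M[R]_(m, n)) i j : `|B i j| <= sumabs B.
Proof.
rewrite /sumabs (bigD1 i)//= (bigD1 j)//= -addrA lerDl addr_ge0 ?sumr_ge0// => k _.
by rewrite sumr_ge0.
Qed.

Lemma sumabs_ge0 m n (B : 'M[R]_(m, n)) : 0 <= sumabs B.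
Proof. by apply: sumr_ge0 => i _; exact: sumr_ge0. Qed.

Lemma coord_le_sqnorm_mul (A : 'M[R]_p) (z : 'rV[R]_p) k : A \in unitmx ->
  `|z 0 k| <= Num.sqrt ((z *m A *m (z *m A)^T) 0 0) * sumabs (invmx A).
Proof.
move=> Au; set y := z *m A.
have -> : z = y *m invmx A by rewrite mulmxK.
rewrite mxE; apply: le_trans (ler_norm_sum _ _ _) _.
rewrite /sumabs mulr_sumr; apply: ler_sum => j _; rewrite normrM.
apply: ler_pM => //; first exact: coord_le_sqnorm.
by rewrite (bigD1 k)//= lerDl sumr_ge0.
Qed.

(** A bound in each single coordinate is the form that [powR_decay_integrable] takes. The constant
    comes from [1 + |x_k| <= b c (1 + |(x - mu) A|)]. *)
Lemma kern_decay (A : 'M[R]_p) (mu : 'rV[R]_p) : A \in unitmx ->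
  exists C : R, forall x k, kern A (x - mu) <= C * (1 + `|x 0 k|) `^ (- be).
Proof.
move=> Au; pose c := 1 + sumabs (invmx A); pose b := 1 + sumabs mu.
have c0 : 0 < c by rewrite ltr_pwDl// sumabs_ge0.
have b0 : 0 < b by rewrite ltr_pwDl// sumabs_ge0.
have be0 : 0 <= be by exact: le_trans be1.
exists (`|\det A| * v * (b * c) `^ be) => x k.
rewrite /kern -!mulrA ler_wpM2l//.
set q := (_ *m _) 0 0; have q0 : 0 <= q by exact: sqnorm_ge0.
have sq0 := sqrtr_ge0 q.
apply: le_trans (f_decay q0) _; rewrite ler_wpM2l ?decay_const_ge0//.
have xk : 1 + `|x 0 k| <= b * c * (1 + Num.sqrt q).
  have z1 := coord_le_sqnorm_mul (x - mu) k Au; rewrite -/q in z1.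
  have m1 := entry_le_sumabs mu 0 k.
  have xz : `|x 0 k| <= `|(x - mu) 0 k| + `|mu 0 k|.
    by rewrite -{1}(subrK (mu 0 k) (x 0 k)) !mxE ler_normD.
  have s0 := sumabs_ge0 (invmx A); have t0 := sumabs_ge0 mu.
  apply: (@le_trans _ _ (b + Num.sqrt q * sumabs (invmx A))).
    by rewrite /b -addrA lerD2l (le_trans xz)// addrC lerD.
  rewrite /c /b; set B := sumabs mu in t0 *; set D := sumabs (invmx A) in s0 *.
  set r := Num.sqrt q in sq0 *.
  have : 0 <= D + r + D * B + r * B + r * B * D.
    by rewrite !addr_ge0 ?mulr_ge0.
  move=> H; rewrite -subr_ge0; apply: le_trans H _; rewrite le_eqVlt; apply/orP; left; apply/eqP.
  by ring.
have r1 : 0 < 1 + Num.sqrt q by rewrite ltr_pwDl.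
rewrite !powRN ler_pdivlMr ?powR_gt0 ?add1_norm_gt0// ler_pdivrMl ?powR_gt0//.
rewrite -powRM ?(ltW r1) ?mulr_ge0 ?(ltW b0) ?(ltW c0)// mulrC.
by apply: ge0_ler_powR => //; rewrite nnegrE ?mulr_ge0 ?(ltW r1) ?(ltW b0) ?(ltW c0) ?(ltW (add1_norm_gt0 _)).
Qed.

End kernel.

Section ultrafilters.

Lemma ultra_fmap (T U : Type) (g : T -> U) (F : set_system T) :
  UltraFilter F -> UltraFilter (g @ F).
Proof.
move=> FU; split; first exact: fmap_proper_filter.
move=> G PG FG; apply/seteqP; split => // A GA.
have [//|FA] := in_ultra_setVsetC (g @^-1` A) FU.
have : G (A `&` ~` A) by apply: filterI => //; exact: FG.
by rewrite setICr => /filter_not_empty.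
Qed.

Variables (R : realType) (J : Type) (F : set_system J).
Hypothesis FU : UltraFilter F.

(** Compactness of the segment; along an ultrafilter this replaces the extraction of
    subsequences. *)
Lemma ultra_bounded_cvg (g : J -> R) (K : R) :
  (\forall x \near F, `|g x| <= K) -> exists l : R, g x @[x --> F] --> l.
Proof.
move=> gK; have gU := ultra_fmap g FU.
have : compact `[- K, K]%classic := @segment_compact R _ _.
rewrite compact_ultra => /(_ _ gU) -[|l [_ gl]]; last by exists l.
by apply: filterS gK => x; rewrite /= in_itv/= -ler_norml.
Qed.

Lemma ultra_mxcvg (m n : nat) (M : J -> 'M[R]_(m, n)) (K : R) :
  (\forall x \near F, forall i j, `|M x i j| <= K) -> exists L, mxcvg F M L.
Proof.
move=> MK.
have H ij : exists l : R, M x ij.1 ij.2 @[x --> F] --> l.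
  by apply: (@ultra_bounded_cvg _ K); apply: filterS MK.
have [l lP] := choice H.
exists (\matrix_(i, j) l (i, j)) => i j; rewrite mxE; exact: (lP (i, j)).
Qed.

(** For each [K] the ultrafilter decides whether the entries are bounded by [K]. One positive answer
    gives a limit; only negative answers give escape. *)
Lemma ultra_mxcvg_or_escape (m n : nat) (M : J -> 'M[R]_(m, n)) :
  (exists L, mxcvg F M L) \/
  (forall K : R, \forall x \near F, exists i j, K < `|M x i j|).
Proof.
have [[K MK]|nK] := pselect (exists K : R, \forall x \near F, forall i j, `|M x i j| <= K).
  by left; exact: ultra_mxcvg MK.
right => K; have [FK|] := in_ultra_setVsetC [set x | forall i j, `|M x i j| <= K] FU.
  by case: nK; exists K.
apply: filterS => x /= H; apply: contrapT => H'; apply: H => i j.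
by rewrite leNgt; apply/negP => Kx; apply: H'; exists i, j.
Qed.

End ultrafilters.

Section kernel_limits.
Variables (R : realType) (p : nat) (f : R -> R).
Hypothesis cf : continuous f.

Lemma box_compact (n : nat) (K : R) :
  compact [set x : 'rV[R]_n | forall k, `|x 0 k| <= K].
Proof.
have -> : [set x : 'rV[R]_n | forall k, `|x 0 k| <= K] =
    [set x : 'rV[R]_n | forall k, `[- K, K]%classic (x ord0 k)].
  by apply/seteqP; split => x H k; have := H k; rewrite /= in_itv/= -ler_norml.
by apply: (@rV_compact _ _ (fun=> `[- K, K]%classic)) => k; exact: segment_compact.
Qed.

Variables (J : Type) (F : set_system J).
Context {FF : ProperFilter F}.
Variables (A : J -> 'M[R]_p) (A0 : 'M[R]_p).
Hypothesis AA0 : mxcvg F A A0.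

(** The kernel is jointly continuous in the point and the parameters, so near each [x] the estimate
    holds on a neighbourhood times a member of [F]. Compactness of the box makes it uniform. *)
Lemma kern_cvg_box (mu : J -> 'rV[R]_p) (mu0 : 'rV[R]_p) (K e : R) :
  mxcvg F mu mu0 -> 0 < e ->
  \forall j \near F, forall x : 'rV[R]_p, (forall k, `|x 0 k| <= K) ->
    `|kern f A0 (x - mu0) - kern f (A j) (x - mu j)| < e.
Proof.
move=> mumu0 e0.
have /compact_near_coveringP cK := @box_compact p K.
apply: (cK _ F (fun j x => `|kern f A0 (x - mu0) - kern f (A j) (x - mu j)| < e)).
move=> x _.
have cx : mxcvg (filter_prod (nbhs x) F) (fun yj => yj.1) x.
  move=> i k; apply: cvg_comp (@nbhs_mxcvg _ _ _ x i k); exact: cvg_fst.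
have sndF m n (M : J -> 'M[R]_(m, n)) L : mxcvg F M L ->
    mxcvg (filter_prod (nbhs x) F) (fun yj => M yj.2) L.
  by move=> ML i k; apply: cvg_comp (ML i k); exact: cvg_snd.
have c1 : kern f A0 (yj.1 - mu0) @[yj --> filter_prod (nbhs x) F] --> kern f A0 (x - mu0).
  apply: (@cvg_kern _ _ f cf _ _ _ (fun=> A0) (fun yj => yj.1 - mu0)); first exact: mxcvg_cst.
  by apply: mxcvgB => //; exact: mxcvg_cst.
have c2 : kern f (A yj.2) (yj.1 - mu yj.2) @[yj --> filter_prod (nbhs x) F] --> kern f A0 (x - mu0).
  apply: (@cvg_kern _ _ f cf _ _ _ (fun yj => A yj.2) (fun yj => yj.1 - mu yj.2)).
    exact: sndF.
  by apply: mxcvgB => //; exact: sndF.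
have c3 : kern f A0 (yj.1 - mu0) - kern f (A yj.2) (yj.1 - mu yj.2)
    @[yj --> filter_prod (nbhs x) F] --> 0.
  by rewrite -(subrr (kern f A0 (x - mu0))); exact: cvgB.
by move/cvgr0Pnorm_lt : c3; apply.
Qed.

Hypothesis f_ge0 : forall t, 0 <= f t.
Variables (v be : R).
Hypothesis f_decay : forall t, 0 <= t -> f t <= v * (1 + Num.sqrt t) `^ (- be).
Hypothesis be1 : 1 <= be.

(** The reason depends on the limit [A0]. If it is singular, the factor [|det A|] tends to 0. If it
    is invertible, the inverses stay bounded and a distant atom makes the quadratic form large. *)
Lemma kern_escape_box (mu : J -> 'rV[R]_p) (K e : R) :
  (forall K : R, \forall j \near F, exists i k, K < `|mu j i k|) -> 0 < e ->
  \forall j \near F, forall x : 'rV[R]_p, (forall k, `|x 0 k| <= K) ->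
    kern f (A j) (x - mu j) < e.
Proof.
move=> esc e0; have v0 := decay_const_ge0 f_ge0 f_decay.
have kle B z : @kern R p f B z <= `|\det B| * v by exact: (@kern_le _ _ _ f_ge0 _ be).
have cdet : `|\det (A j)| @[j --> F] --> `|\det A0| by exact: cvg_norm (cvg_det AA0).
have [dA0|dA0] := eqVneq (\det A0) 0.
  have : `|\det (A j)| * v @[j --> F] --> 0.
    by rewrite -(mul0r v) -{1}(normr0 R) -dA0; apply: cvgM => //; exact: cvg_cst.
  move=> /cvgr0Pnorm_lt H; apply: filterS (H e e0) => j jv x _.
  by apply: le_lt_trans (kle _ _) _; rewrite -[ltLHS]ger0_norm// mulr_ge0.
have cinv : mxcvg F (fun j => invmx (A j)) (invmx A0) by exact: mxcvg_inv.
have csum : sumabs (invmx (A j)) @[j --> F] --> sumabs (invmx A0).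
  by apply: cvg_bigsum => i _; apply: cvg_bigsum => k _; exact: cvg_norm (cinv i k).
pose M := sumabs (invmx A0) + 1; pose D := `|\det A0| + 1.
have M0 : 0 < M by rewrite ltr_wpDl ?sumabs_ge0.
have D0 : 0 < D by rewrite ltr_wpDl.
near=> j => x xK.
have dj : \det (A j) != 0.
  rewrite -normr_gt0; near: j; apply: (cvgr_gt _ cdet); by rewrite normr_gt0.
have Aju : A j \in unitmx by rewrite unitmxE unitfE.
have jM : sumabs (invmx (A j)) <= M.
  by near: j; apply: (cvgr_le _ csum); rewrite ltrDl.
have jD : `|\det (A j)| <= D by near: j; apply: (cvgr_le _ cdet); rewrite ltrDl.
(* At this distance the norm [r] of [(x - mu j) A] satisfies [1 + r > D v / e], and decay of order
   at least 1 brings the kernel below [e]. *)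
have [i [k muk]] : exists i k, K + D * v * M / e < `|mu j i k|.
  by near: j; exact: esc.
rewrite ord1 in muk.
have zk : D * v * M / e < `|(x - mu j) 0 k|.
  rewrite !mxE distrC; apply: lt_le_trans (lerB_dist _ _).
  by rewrite ltrBrDl; apply: le_lt_trans muk; rewrite lerD2r.
have := coord_le_sqnorm_mul (x - mu j) k Aju; rewrite /kern.
set q := (_ *m _) 0 0 => zq; have q0 : 0 <= q by exact: sqnorm_ge0.
have r0 := sqrtr_ge0 q; set r := Num.sqrt q in zq r0.
have r1 : 0 < 1 + r by rewrite ltr_pwDl.
have rM : D * v / e < 1 + r.
  have : D * v * M / e < r * M.
    by apply: lt_le_trans zk _; apply: le_trans zq _; rewrite ler_wpM2l.
  rewrite mulrAC ltr_pM2r// => /lt_le_trans; apply.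
  by rewrite lerDr.
have fq : f q <= v / (1 + r).
  apply: le_trans (f_decay q0) _; rewrite -/r ler_wpM2l// -[leRHS](powR_inv1 (ltW r1)).
  by rewrite ler_powR ?lerDl// lerN2.
apply: le_lt_trans (ler_pM _ _ jD fq) _ => //.
by rewrite mulrA ltr_pdivrMr// -ltr_pdivrMl// [ltLHS]mulrC.
Unshelve. all: by end_near. Qed.

End kernel_limits.

Section shrinking_sets.
Context (R : realType) d (T : measurableType d).
Variable mu : {measure set T -> \bar R}.
Local Open Scope ereal_scope.

(** Dominated convergence with majorant [w]: the indicators converge pointwise to that of the
    intersection. *)
Lemma integral_shrink (w : T -> R) (E : nat -> set T) (eta : R) :
  measurable_fun setT w -> (forall x, 0 <= w x)%R -> \int[mu]_x (w x)%:E < +oo ->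
  (forall n, measurable (E n)) -> (forall n, E n.+1 `<=` E n) ->
  \int[mu]_x (w x * \1_(\bigcap_n E n) x)%:E = 0 -> (0 < eta)%R ->
  exists n, \int[mu]_x (w x * \1_(E n) x)%:E < eta%:E.
Proof.
move=> mw w0 wy mE ndE E0 eta0.
have ndE' : forall n k, (n <= k)%N -> E k `<=` E n.
  move=> n k /subnK <-; elim: (k - n)%N => // i IH.
  by rewrite addSn; apply: subset_trans IH; exact: ndE.
have mEI : measurable (\bigcap_n E n) by exact: bigcap_measurableType.
have mwE (A : set T) : measurable A -> measurable_fun setT (fun x => w x * \1_A x)%R.
  by move=> mA; apply: measurable_funM => //; exact: measurable_indic.
have cE : \int[mu]_x (w x * \1_(E n) x)%:E @[n --> \oo] --> 0.
  rewrite -E0; apply: (@dominated_cvg _ T R mu setT measurableT _ _ (fun x => (w x)%:E)) => //.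
  - by move=> n; apply/measurable_EFinP; exact: mwE.
  - move=> x _; apply: cvg_near_cst.
    have [xE|xE] := pselect ((\bigcap_n E n) x).
      by apply: nearW => n; rewrite !indicE !mem_set//; exact: xE.
    have [k kx] : exists k, ~ E k x.
      by apply: contrapT => H; apply: xE => n _; apply: contrapT => nx; apply: H; exists n.
    exists k => // n /= kn; rewrite !indicE !memNset//.
    by move=> /(ndE' _ _ kn).
  - apply/integrableP; split; first exact/measurable_EFinP.
    by under eq_integral do rewrite gee0_abs ?lee_fin//.
  - by move=> n x _; rewrite gee0_abs ?lee_fin ?mulr_ge0// ler_piMr.
apply: contrapT => H.
have : eta%:E <= limn (fun n => \int[mu]_x (w x * \1_(E n) x)%:E).
  apply: lime_ge; first by apply/cvg_ex; exists 0.
  by apply: nearW => n; rewrite leNgt; apply/negP => En; apply: H; exists n.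
by rewrite (cvg_lim _ cE)// lee_fin leNgt eta0.
Qed.

End shrinking_sets.

(** * Good sets of parameters and Chernoff comparison *)

Section good_sets.
Context (R : realType) (d : measure_display) (T : measurableType d).
Variables (P : probability T R) (p : nat) (X : nat -> T -> 'rV[R]_p) (g0 : 'rV[R]_p -> R).
Hypothesis Xmeas : forall i, rvec_measurable (X i).
Hypothesis Xindep : mutually_independent P X.
Hypothesis Xdens : forall i, has_density P (X i) g0.
Hypothesis mg0 : measurable_fun setT (g0 : Rp R p -> R).
Hypothesis g0_ge0 : forall x, 0 <= g0 x.
Variables (J : Type) (g : J -> 'rV[R]_p -> R).

(** For almost every [w] one threshold for [n] serves all [t] in [G]. No measurability in [t]
    arises, since [{ae P, ...}] only asks that the exceptional set lie in a measurable null set.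
    Products avoid a convention for the logarithm of 0. *)
Definition good (G : set J) : Prop := {ae P, forall w, \forall n \near \oo,
  forall t, G t -> \prod_(i < n) g t (X i w) < \prod_(i < n) g0 (X i w)}.

Lemma goodS (G H : set J) : G `<=` H -> good H -> good G.
Proof.
move=> GH; rewrite /good => gH; apply: filterS gH => w; apply: filterS => n Hn t Gt.
exact/Hn/GH.
Qed.

Lemma good_set0 : good set0.
Proof. by rewrite /good; apply: filterE => w; apply: filterE. Qed.

Lemma goodU (G H : set J) : good G -> good H -> good (G `|` H).
Proof.
rewrite /good => gG gH; apply: filterS2 gG gH => w; apply: filterS2 => n Gn Hn t [/Gn|/Hn] //.
Qed.

(** Good sets form an ideal. The sets [H] for which [G] minus [H] is good therefore form a filter,
    proper because [G] is not good, and it contains the complement of every good set. *)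
Lemma ultra_not_good (G : set J) : ~ good G ->
  exists F : set_system J, [/\ UltraFilter F, F G & forall H, F H -> ~ good H].
Proof.
move=> nG; pose F0 : set_system J := [set H | good (G `\` H)].
have F0P : ProperFilter F0.
  apply: Build_ProperFilter; first by rewrite /F0/= setD0.
  split.
  - by rewrite /F0/= setDT; exact: good_set0.
  - by move=> A B; rewrite /F0/= setDIr; exact: goodU.
  - by move=> A B AB; apply: goodS; exact: setDS.
have [F [FU F0F]] := ultraFilterLemma F0P.
exists F; split => // [|H FH gH].
  by apply: F0F; rewrite /F0/= setDv; exact: good_set0.
have : F (H `&` ~` H).
  apply: filterI => //; apply: F0F; apply: goodS gH => x [_] /= /contrapT; exact.
by rewrite setICr => /filter_not_empty.
Qed.

Local Open Scope ereal_scope.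

Lemma expectation_g0 i (h : 'rV[R]_p -> R) : measurable_fun setT (h : Rp R p -> R) ->
  (forall x, 0 <= h x)%R -> \int[P]_w (h (X i w))%:E = \int[lebRp R p]_x (g0 x * h x)%:E.
Proof. by move=> mh h0; exact: integral_has_density. Qed.

Lemma integral_g0 : \int[lebRp R p]_x (g0 x)%:E = 1.
Proof.
transitivity (\int[P]_w (cst 1%R (X 0 w))%:E).
  by rewrite (@expectation_g0 0 (cst 1%R))//; apply: eq_integral => x _; rewrite mulr1.
transitivity (\int[P]_w (cst 1 w)); first exact: eq_integral.
by rewrite integral_cst// mul1e; exact: probability_setT.
Qed.

Lemma ae_g0_gt0 : {ae P, forall w, forall i, (0 < g0 (X i w))%R}.
Proof.
have H i : {ae P, forall w, (0 < g0 (X i w))%R}.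
  pose N : set (Rp R p) := [set x | g0 x = 0%R].
  have mN : measurable N.
    have -> : N = setT `&` (g0 @^-1` [set 0%R]) by rewrite setTI.
    exact: mg0.
  exists (X i @^-1` N); split.
  - exact: Xmeas.
  - have mI : measurable_fun setT (\1_N : Rp R p -> R) by exact: measurable_indic.
    have := @expectation_g0 i (\1_N) mI (fun=> ler0n _ _).
    rewrite (_ : (fun w => _) = fun w => (\1_(X i @^-1` N) w)%:E)//.
    rewrite integral_indic// ?setIT; last exact: Xmeas.
    move=> ->; apply: integral0_eq => x _; rewrite indicE.
    by case: (boolP (x \in N)) => [|_]; rewrite ?mulr0// inE => ->; rewrite mul0r.
  - by move=> w /= /negP; rewrite lt_def g0_ge0 andbT negbK => /eqP.
by apply/ae_foralln.
Qed.

Variable s : R.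
Hypotheses (s0 : (0 < s)%R) (s1 : (s < 1)%R).

Lemma good_dominated (H : 'rV[R]_p -> R) :
  measurable_fun setT (H : Rp R p -> R) -> (forall x, 0 <= H x)%R ->
  \int[lebRp R p]_x (g0 x `^ (1 - s) * H x `^ s)%:E < 1 ->
  good [set t | forall x, 0 <= g t x <= H x]%R.
Proof.
move=> mH H0 H1.
pose h x := ((H x / g0 x) `^ s)%R.
have mh : measurable_fun setT (h : Rp R p -> R).
  apply: (measurableT_comp (measurable_powR s)); apply: measurable_funM => //.
  have -> : (fun x => (g0 x)^-1)%R = (fun x => g0 x `^ (-1))%R.
    by apply/funext => x; rewrite powR_inv1.
  exact: (measurableT_comp (measurable_powR _) mg0).
have h0 x : (0 <= h x)%R by exact: powR_ge0.
(* Where [g0] vanishes both sides are 0; on the right this uses that the exponent [1 - s] is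
   nonzero. *)
have hE x : (g0 x * h x = g0 x `^ (1 - s) * H x `^ s)%R.
  rewrite /h powRM ?invr_ge0//.
  have [->|gx] := eqVneq (g0 x) 0%R.
    by rewrite mul0r powR0 ?mul0r// subr_eq0 gt_eqF.
  have gx0 : (0 < g0 x)%R by rewrite lt_def gx g0_ge0.
  rewrite powRB; last by rewrite gx implybT.
  rewrite powRr1// -powR_inv1// -powRrM mulN1r powRN; ring.
set I := \int[lebRp R p]_x _ in H1.
have Ifin : I \is a fin_num.
  rewrite ge0_fin_numE; first exact: lt_trans H1 (ltry _).
  by apply: integral_ge0 => x _; rewrite lee_fin mulr_ge0 ?powR_ge0.
have hI i : \int[P]_w (h (X i w))%:E = (fine I)%:E.
  by rewrite expectation_g0// fineK//; apply: eq_integral => x _; rewrite hE.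
have I1 : (fine I < 1)%R by rewrite -lte_fin fineK.
apply: filterS2 (chernoff_ae Xmeas Xindep mh h0 hI I1) ae_g0_gt0 => w Hw gw.
apply: filterS Hw => n Hn t tH.
apply: (@le_lt_trans _ _ (\prod_(i < n) H (X i w))%R); first exact: ler_prod.
have G0 : (0 < \prod_(i < n) g0 (X i w))%R by exact: prodr_gt0.
rewrite -[ltRHS]mul1r -ltr_pdivrMr// -prodf_div.
have prod_powR k : (\prod_(i < k) h (X i w) = (\prod_(i < k) (H (X i w) / g0 (X i w))) `^ s)%R.
  elim: k => [|k IH]; first by rewrite !big_ord0 powR1.
  by rewrite !big_ord_recr/= IH powRM// ?prodr_ge0// => *; rewrite divr_ge0.
rewrite ltNge; apply/negP => ge1; move: Hn; rewrite ltNge => /negP; apply.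
rewrite prod_powR -[leLHS](powRr0 (\prod_(i < n) (H (X i w) / g0 (X i w)))%R).
by rewrite ler_powR// ltW.
Qed.

End good_sets.

Section strips.
Context (R : realType) (d : measure_display) (T : measurableType d).
Variables (P : probability T R) (p : nat) (X : nat -> T -> 'rV[R]_p) (g0 : 'rV[R]_p -> R).
Hypothesis Xmeas : forall i, rvec_measurable (X i).
Hypothesis Xindep : mutually_independent P X.
Hypothesis Xdens : forall i, has_density P (X i) g0.
Hypothesis mg0 : measurable_fun setT (g0 : Rp R p -> R).
Hypothesis g0_ge0 : forall x, 0 <= g0 x.
Variable s : R.
Hypotheses (s0 : 0 < s) (s1 : s < 1).
Hypothesis g0_s : (\int[lebRp R p]_x (g0 x `^ (1 - s))%:E < +oo)%E.

(** The constant [L] is treated as a one-element family of competitors of [g0]. Its affinity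
    integral is [L^s] times the integral [I] of [g0^(1-s)], and the choice of [L] makes it
    [I / (I + 1)]. *)
Lemma likelihood_lower_bound : exists2 L : R, 0 < L &
  {ae P, forall w, \forall n \near \oo, L ^+ n < \prod_(i < n) g0 (X i w)}.
Proof.
pose I := (\int[lebRp R p]_x (g0 x `^ (1 - s))%:E)%E.
have Iy : (I < +oo)%E by exact: g0_s.
have I0 : (0 <= I)%E by apply: integral_ge0 => x _; rewrite lee_fin powR_ge0.
have Ifin : I \is a fin_num by rewrite ge0_fin_numE.
have I10 : 0 < fine I + 1 by rewrite ltr_wpDl// fine_ge0.
pose L := ((fine I + 1)^-1) `^ s^-1.
have L0 : 0 < L by rewrite powR_gt0// invr_gt0.
exists L => //.
have LS : L `^ s = (fine I + 1)^-1.
  by rewrite /L -powRrM mulVf ?gt_eqF// powRr1// invr_ge0 ltW.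
have good_L : good P X g0 (fun (_ : unit) _ => L) [set t | forall x : 'rV[R]_p, 0 <= L <= L].
  apply: (@good_dominated _ _ _ P p X g0 Xmeas Xindep Xdens mg0 g0_ge0 unit _ s s0 s1 (fun=> L)) => //.
    by move=> _; exact: ltW.
  under eq_integral do rewrite EFinM.
  rewrite ge0_integralZr//; last 3 first.
  - by apply/measurable_EFinP; exact: (measurableT_comp (measurable_powR _) mg0).
  - by move=> x _; rewrite lee_fin powR_ge0.
  - by rewrite lee_fin powR_ge0.
  rewrite -/I -(fineK Ifin) -EFinM lte_fin LS ltr_pdivrMr// mul1r ltrDl.
  exact: ltr01.
rewrite /good in good_L; apply: filterS good_L => w; apply: filterS => n /(_ tt).
rewrite prodr_const card_ord; apply => x.
by rewrite lexx ltW.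
Qed.

(** In the application [l] is the logarithm of the size of the matrix and [A] the set to be avoided.
    One random event handles all [l] at once: if less than a fraction [gam / be] of the sample lies
    in [A], the exponents add up to at most [- l gam n], and this beats [(L / C)^n] once [l] is
    large. *)
Lemma good_strip (J : Type) (g : J -> 'rV[R]_p -> R) (A : set (Rp R p)) (C be gam : R) :
  measurable A -> 0 < C -> 0 < gam -> 0 < be ->
  ((expR (be / gam))%:E * \int[lebRp R p]_x (g0 x * \1_A x)%:E < 1)%E ->
  exists l0 : R, good P X g0 g [set t | exists2 l, l0 <= l &
    forall x, 0 <= g t x <= C * expR (l * (be * \1_A x - gam *+ 2))].
Proof.
move=> mA C0 gam0 be0 PA.
have [L L0 Lae] := likelihood_lower_bound.
pose l0 := Num.max 0 (ln (C / L) / gam).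
exists l0.
(* The sum of [D] over the sample is negative exactly when the fraction lying in [A] is below
   [gam / be]. *)
pose D (x : 'rV[R]_p) : R := be / gam * \1_A x - 1.
pose h x := expR (D x).
have mI : measurable_fun setT (\1_A : Rp R p -> R) by exact: measurable_indic.
have mh : measurable_fun setT (h : Rp R p -> R).
  apply: measurableT_comp; first exact: measurable_expR.
  by apply: measurable_funB => //; exact: measurable_funM.
have h0 x : 0 <= h x by exact: expR_ge0.
pose I := (\int[lebRp R p]_x (g0 x * h x)%:E)%E.
have I0 : (0 <= I)%E by apply: integral_ge0 => x _; rewrite lee_fin mulr_ge0.
have I1 : (I < 1)%E.
  pose K := expR (be / gam).
  apply: (@le_lt_trans _ _ (\int[lebRp R p]_x ((expR (- 1))%:E * ((g0 x)%:E + K%:E * (g0 x * \1_A x)%:E)))%E).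
    apply: ge0_le_integral => //.
    - by move=> x _; rewrite lee_fin mulr_ge0.
    - by apply/measurable_EFinP; exact: measurable_funM.
    - apply: emeasurable_funM => //; apply: emeasurable_funD.
        exact/measurable_EFinP.
      apply: emeasurable_funM => //.
      by apply/measurable_EFinP; exact: measurable_funM.
    move=> x _; rewrite -!EFinM lee_fin /h /D.
    rewrite expRD mulrA [leLHS]mulrC ler_wpM2l ?expR_ge0//.
    rewrite indicE; case: (x \in A); rewrite ?mulr1 ?mulr0 ?expR0 ?mulr1 ?addr0//.
    by rewrite mulrC lerDr.
  have mgA : measurable_fun setT (fun x : Rp R p => (g0 x * \1_A x)%:E).
    by apply/measurable_EFinP; exact: measurable_funM.
  have gA0 x : (0 <= (g0 x * \1_A x)%:E)%E by rewrite lee_fin mulr_ge0.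
  have mKA : measurable_fun setT (fun x : Rp R p => K%:E * (g0 x * \1_A x)%:E)%E.
    exact: emeasurable_funM.
  have KA0 x : (0 <= K%:E * (g0 x * \1_A x)%:E)%E by rewrite mule_ge0// lee_fin expR_ge0.
  have mEg0 : measurable_fun setT (fun x : Rp R p => (g0 x)%:E) by exact/measurable_EFinP.
  have mS : measurable_fun setT (fun x : Rp R p => (g0 x)%:E + K%:E * (g0 x * \1_A x)%:E)%E.
    exact: emeasurable_funD.
  have S0 x : (0 <= (g0 x)%:E + K%:E * (g0 x * \1_A x)%:E)%E by apply: adde_ge0 (KA0 x); rewrite lee_fin.
  rewrite ge0_integralZl ?lee_fin ?expR_ge0//.
  rewrite ge0_integralD//; last by move=> x _; rewrite lee_fin.
  rewrite ge0_integralZl ?lee_fin ?expR_ge0//.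
  rewrite (integral_g0 Xmeas Xdens mg0 g0_ge0).
  set Q := (\int[lebRp R p]_x _)%E.
  have Q0 : (0 <= Q)%E by apply: integral_ge0.
  have KQ : (0 <= K%:E * Q)%E by rewrite mule_ge0// lee_fin expR_ge0.
  have KQfin : (K%:E * Q)%E \is a fin_num by rewrite ge0_fin_numE// (lt_trans PA) ?ltry.
  rewrite -(fineK KQfin) -EFinD -EFinM lte_fin expRN.
  rewrite mulrC ltr_pdivrMr ?expR_gt0// mul1r.
  (* The integral is less than [2 / e], and [2 < e] is the inequality [1 + x < expR x] at
     [x = 1]. *)
  apply: lt_trans (expR_gt1Dx (oner_neq0 R)); by rewrite ltrD2l -lte_fin fineK.
have Ifin : I \is a fin_num by rewrite ge0_fin_numE// (lt_trans I1) ?ltry.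
have hI i : (\int[P]_w (h (X i w))%:E = (fine I)%:E)%E.
  by rewrite (expectation_g0 Xmeas Xdens mg0 g0_ge0)// fineK.
have I1' : fine I < 1 by rewrite -lte_fin fineK.
apply: filterS2 (chernoff_ae Xmeas Xindep mh h0 hI I1') Lae => w.
apply: filterS2 => n hn Ln t [l l0l tl].
apply: le_lt_trans Ln.
have l_ge0 : 0 <= l by apply: le_trans l0l; rewrite le_max lexx.
have CL : C * expR (- (gam * l)) <= L.
  have : ln (C / L) / gam <= l by apply: le_trans l0l; rewrite le_max lexx orbT.
  rewrite ler_pdivrMr// => H.
  rewrite expRN ler_pdivrMr ?expR_gt0// -ler_pdivrMl// [leLHS]mulrC.
  by rewrite -[leLHS]lnK ?posrE ?divr_gt0// ler_expR [leRHS]mulrC.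
apply: (@le_trans _ _ (\prod_(i < n) (L * expR (gam * l * D (X i w))))).
  apply: ler_prod => i _; have /andP[-> /= H] := tl (X i w).
  apply: le_trans H _.
  have -> : l * (be * \1_A (X i w) - gam *+ 2) = - (gam * l) + gam * l * D (X i w).
    by rewrite /D mulr2n; field; rewrite gt_eqF.
  by rewrite expRD mulrA ler_wpM2r ?expR_ge0.
rewrite big_split/= prodr_const card_ord ler_piMr ?exprn_ge0 ?(ltW L0)//.
have prodE (c : R) : \prod_(i < n) expR (c * D (X i w)) = expR (c * \sum_(i < n) D (X i w)).
  by rewrite mulr_sumr expR_sum.
rewrite prodE -expR0 ler_expR.
rewrite mulr_ge0_le0 ?mulr_ge0 ?(ltW gam0)// ltW// -expR_lt1.
have := prodE 1; rewrite mul1r => <-.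
by under eq_bigr do rewrite mul1r.
Qed.

End strips.

(** * Mixtures and their limits along an ultrafilter *)

Section mixture.
Variables (R : realType) (m p : nat) (f : R -> R).
Hypothesis cf : continuous f.
Hypothesis f_ge0 : forall t, 0 <= f t.
Hypothesis f_dens : intRp (fun x : 'rV[R]_p => (f ((x *m x^T) 0 0))%:E) = 1%E.

(* Weights, atoms and a square root [A] of the inverse scale matrix. *)
Definition param : Type := (('I_m -> R) * ('I_m -> 'rV[R]_p) * 'M[R]_p)%type.

Definition gth (t : param) (x : 'rV[R]_p) : R :=
  \sum_(j < m) t.1.1 j * kern f t.2 (x - t.1.2 j).

Lemma gth_ge0 t x : (forall j, 0 <= t.1.1 j) -> 0 <= gth t x.
Proof. by move=> al0; apply: sumr_ge0 => j _; rewrite mulr_ge0// kern_ge0. Qed.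

Lemma continuous_gth t : continuous (gth t).
Proof.
move=> x; apply: (@cvg_bigsum _ _ (nbhs x) _ _ _ _
  (fun j y => t.1.1 j * kern f t.2 (y - t.1.2 j))) => j _; apply: cvgMr.
exact: (@continuous_kern _ _ _ cf t.2 (t.1.2 j)).
Qed.

Lemma measurable_gth t : measurable_fun setT (gth t : Rp R p -> R).
Proof. by apply: continuous_measurable_rV; exact: continuous_gth. Qed.

(** The formula shows the two ways in which a limit can lose mass: weights that sum to less than 1
    and a singular matrix. *)
Lemma integral_gth (t : param) : (forall j, 0 <= t.1.1 j) ->
  (\int[lebRp R p]_x (gth t x)%:E = ((\sum_j t.1.1 j) * (\det t.2 != 0)%:R)%:E)%E.
Proof.
move=> al0.
transitivity (\int[lebRp R p]_x (\sum_(j < m) (t.1.1 j)%:E * (kern f t.2 (x - t.1.2 j))%:E))%E.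
  by apply: eq_integral => x _; rewrite /gth -sumEFin.
have mk j : measurable_fun setT (fun x : Rp R p => (kern f t.2 ((x : 'rV[R]_p) - t.1.2 j))%:E).
  by apply/measurable_EFinP; exact: (measurable_kern cf).
have k0 j (x : 'rV[R]_p) : (0 <= (kern f t.2 (x - t.1.2 j))%:E)%E by rewrite lee_fin kern_ge0.
rewrite ge0_integral_sum//; last 2 first.
- by move=> j; apply: emeasurable_funM.
- by move=> j x _; apply: mule_ge0 (k0 j x); rewrite lee_fin.
rewrite mulr_suml -sumEFin; apply: eq_bigr => j _.
rewrite ge0_integralZl ?lee_fin//.
by rewrite -intRpE// intRp_kern.
Qed.

Variables (v be : R).
Hypothesis f_decay : forall t, 0 <= t -> f t <= v * (1 + Num.sqrt t) `^ (- be).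
Hypothesis be1 : 1 <= be.

Lemma gth_decay (t : param) : t.2 \in unitmx -> (forall j, 0 <= t.1.1 j) ->
  exists C : R, forall x k, gth t x <= C * (1 + `|x 0 k|) `^ (- be).
Proof.
move=> Au al0.
have [C HC] := choice (fun j => kern_decay f_ge0 f_decay be1 (t.1.2 j) Au).
exists (\sum_j t.1.1 j * C j) => x k; rewrite mulr_suml; apply: ler_sum => j _.
by rewrite -mulrA ler_wpM2l.
Qed.

Lemma gth_le (t : param) (x : 'rV[R]_p) K : is_mixing t.1.1 t.1.2 ->
  (forall j, kern f t.2 (x - t.1.2 j) <= K) -> gth t x <= K.
Proof.
move=> [al0 al1] HK; rewrite -[leRHS]mul1r -al1 mulr_suml; apply: ler_sum => j _.
by rewrite ler_wpM2l.
Qed.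

Section ultra.
Variable F : set_system param.
Hypothesis FU : UltraFilter F.
Hypothesis Fmix : \forall t \near F, is_mixing t.1.1 t.1.2.

Definition escapes (j : 'I_m) : Prop :=
  forall K : R, \forall t \near F, exists i k, K < `|(t.1.2 j : 'rV[R]_p) i k|.

Lemma ultra_weights : exists al : 'I_m -> R,
  [/\ forall j, t.1.1 j @[t --> F] --> al j, forall j, 0 <= al j & \sum_j al j = 1].
Proof.
have FP : ProperFilter F by exact: ultra_proper.
have al_le t j : is_mixing t.1.1 t.1.2 -> t.1.1 j <= 1.
  by move=> [al0 <-]; rewrite (bigD1 j)//= lerDl sumr_ge0.
have H j : exists l : R, t.1.1 j @[t --> F] --> l.
  apply: (ultra_bounded_cvg FU (K := 1)); apply: filterS Fmix => t mt.
  by rewrite ger0_norm ?al_le//; case: mt.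
have [al alP] := choice H; exists al; split => //.
  by move=> j; apply: (cvgr_to_ge (alP j)); apply: filterS Fmix => t [].
have c1 : \sum_j t.1.1 j @[t --> F] --> \sum_j al j by apply: cvg_bigsum.
have c2 : \sum_j t.1.1 j @[t --> F] --> (1 : R).
  by apply: cvg_near_cst; apply: filterS Fmix => t [].
exact: (cvg_unique (@Rhausdorff R) c1 c2).
Qed.

Lemma ultra_atoms : exists (mu : 'I_m -> 'rV[R]_p) (fin : 'I_m -> bool),
  forall j, if fin j then mxcvg F (fun t => t.1.2 j) (mu j) else escapes j.
Proof.
have H j : exists mf : 'rV[R]_p * bool,
    if mf.2 then mxcvg F (fun t => t.1.2 j) mf.1 else escapes j.
  have [[L FL]|esc] := ultra_mxcvg_or_escape FU (fun t : param => t.1.2 j).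
    by exists (L, true).
  by exists (0, false).
have [mf mfP] := choice H.
by exists (fun j => (mf j).1), (fun j => (mf j).2).
Qed.

Variables (A : 'M[R]_p) (al : 'I_m -> R) (mu : 'I_m -> 'rV[R]_p) (fin : 'I_m -> bool).
Hypothesis FA : mxcvg F (fun t => t.2) A.
Hypothesis Fal : forall j, t.1.1 j @[t --> F] --> al j.
Hypothesis al_ge0 : forall j, 0 <= al j.
Hypothesis al_sum : \sum_j al j = 1.
Hypothesis Fmu : forall j, if fin j then mxcvg F (fun t => t.1.2 j) (mu j) else escapes j.

(** Escaped atoms get weight 0 and a location without meaning, so the limit keeps the type [param]
    while its weights may sum to less than 1. *)
Definition limit_param : param := (fun j => if fin j then al j else 0, mu, A).

Lemma limit_weight_ge0 j : 0 <= limit_param.1.1 j.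
Proof. by rewrite /=; case: ifP. Qed.

Lemma limit_weight_le j : limit_param.1.1 j <= al j.
Proof. by rewrite /=; case: ifP. Qed.

Lemma limit_weights : \sum_j limit_param.1.1 j <= 1.
Proof. by rewrite -al_sum; apply: ler_sum => j _; exact: limit_weight_le. Qed.

Lemma gth_le_limit_box (K e : R) : 0 < e -> \forall t \near F,
  forall x : 'rV[R]_p, (forall k, `|x 0 k| <= K) -> gth t x <= gth limit_param x + e.
Proof.
have FP : ProperFilter F by exact: ultra_proper.
move=> e0; pose D := `|\det A| * v.
have D0 : 0 <= D by rewrite mulr_ge0// (decay_const_ge0 f_ge0 f_decay).
(* Each of the [m] components errs by at most [2 e1], one [e1] for the kernel and one for the
   weight. Using [m + 1] keeps the quotient meaningful for [m = 0]. *)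
pose e1 := e / (m.+1%:R *+ 2).
have e10 : 0 < e1 by rewrite divr_gt0// pmulrn_lgt0// ltr0n.
have H j : \forall t \near F, forall x : 'rV[R]_p, (forall k, `|x 0 k| <= K) ->
    t.1.1 j * kern f t.2 (x - t.1.2 j) <= limit_param.1.1 j * kern f A (x - mu j) + e1 *+ 2.
  have := Fmu j; rewrite /=; case: (fin j) => Fj; near=> t.
    have kt : forall x : 'rV[R]_p, (forall k, `|x 0 k| <= K) ->
        `|kern f A (x - mu j) - kern f t.2 (x - t.1.2 j)| < e1.
      by near: t; exact: kern_cvg_box.
    move=> x xK.
    have /andP[t0 t1] : 0 <= t.1.1 j <= 1.
      have [al0' al1'] : is_mixing t.1.1 t.1.2 by near: t; exact: Fmix.
      by rewrite al0'/= -al1' (bigD1 j)//= lerDl sumr_ge0.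
    have k1 : kern f t.2 (x - t.1.2 j) <= kern f A (x - mu j) + e1.
      by move: (kt x xK); rewrite ltr_distl => /andP[/ltW + _]; rewrite lerBlDr.
    have kD : kern f A (x - mu j) <= D by exact: (kern_le f_ge0 f_decay be1).
    (* This excess of the weight over its limit, against a kernel value of at most [D], costs at
       most [e1]. *)
    have a1 : t.1.1 j <= al j + e1 / (D + 1).
      near: t; apply: (cvgr_le _ (@Fal j)); rewrite ltrDl divr_gt0//.
      by rewrite ltr_wpDl.
    apply: (@le_trans _ _ (t.1.1 j * kern f A (x - mu j) + e1)).
      by apply: le_trans (ler_wpM2l t0 k1) _; rewrite mulrDr lerD2l ler_piMl// (ltW e10).
    rewrite mulr2n addrA lerD2r.
    apply: le_trans (ler_wpM2r (kern_ge0 f_ge0 _ _) a1) _; rewrite mulrDl lerD2l.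
    apply: le_trans (ler_wpM2l _ kD) _; first by rewrite divr_ge0// ?ltW// ltr_wpDl.
    by rewrite mulrAC ler_pdivrMr ?ltr_wpDl// ler_wpM2l ?lerDl// (ltW e10).
  have kt : forall x : 'rV[R]_p, (forall k, `|x 0 k| <= K) -> kern f t.2 (x - t.1.2 j) < e1.
    by near: t; exact: (kern_escape_box FA f_ge0 f_decay be1 K Fj e10).
  move=> x xK.
  have /andP[t0 t1] : 0 <= t.1.1 j <= 1.
    have [al0' al1'] : is_mixing t.1.1 t.1.2 by near: t; exact: Fmix.
    by rewrite al0'/= -al1' (bigD1 j)//= lerDl sumr_ge0.
  rewrite mul0r add0r.
  apply: (@le_trans _ _ e1); last by rewrite mulr2n lerDl ltW.
  by apply: le_trans (ltW (kt x xK)); rewrite ler_piMl// kern_ge0.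
have : \forall t \near F, forall j, forall x : 'rV[R]_p, (forall k, `|x 0 k| <= K) ->
    t.1.1 j * kern f t.2 (x - t.1.2 j) <= limit_param.1.1 j * kern f A (x - mu j) + e1 *+ 2.
  exact: filter_forall.
apply: filterS => t tH x xK.
apply: (@le_trans _ _ (\sum_j (limit_param.1.1 j * kern f A (x - mu j) + e1 *+ 2))).
  by apply: ler_sum => j _; exact: tH.
rewrite big_split/= lerD2l sumr_const card_ord /e1.
have m10 : 0 < m.+1%:R :> R by rewrite ltr0n.
have -> : (e / (m.+1%:R *+ 2)) *+ 2 *+ m = e * (m%:R / m.+1%:R).
  rewrite -[_ *+ m]mulr_natr -[_ *+ 2]mulr_natr -[m.+1%:R *+ 2]mulr_natr.
  by field; rewrite gt_eqF.
by rewrite ler_piMr ?(ltW e0)// ler_pdivrMr// mul1r ler_nat.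
Unshelve. all: by end_near. Qed.

Lemma gth_bounded : \forall t \near F, forall x, gth t x <= (`|\det A| + 1) * v.
Proof.
have FP : ProperFilter F by exact: ultra_proper.
have v0 := decay_const_ge0 f_ge0 f_decay.
near=> t => x; apply: gth_le; first by near: t; exact: Fmix.
move=> j; apply: le_trans (kern_le f_ge0 f_decay be1 _ _) _; rewrite ler_wpM2r//.
near: t; have cdet : `|\det t.2| @[t --> F] --> `|\det A| by exact: cvg_norm (cvg_det FA).
by apply: (cvgr_le _ cdet); rewrite ltrDl.
Unshelve. all: by end_near. Qed.

End ultra.
End mixture.

Section tails.
Variables (R : realType) (p : nat).

Definition tailset (n : nat) : set (Rp R p) :=
  [set x | exists k, n%:R < `|(x : 'rV[R]_p) 0 k|].

Lemma measurable_tailset n : measurable (tailset n).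
Proof.
have -> : tailset n = \bigcup_(k in [set: 'I_p])
    ((fun x : Rp R p => `|(x : 'rV[R]_p) 0 k|) @^-1` `]n%:R, +oo[%classic).
  apply/seteqP; split => x /=.
    by move=> [k kx]; exists k => //=; rewrite in_itv/= andbT.
  by move=> [k _] /=; rewrite in_itv/= andbT => kx; exists k.
apply: fin_bigcup_measurable => [|k _]; first exact: finite_finset.
rewrite -[X in measurable X]setTI.
apply: (measurableT_comp (@normr_measurable R setT) (measurable_coord k)) => //.
Qed.

Lemma tailset_decr n : tailset n.+1 `<=` tailset n.
Proof. by move=> x [k kx]; exists k; apply: lt_trans kx; rewrite ltr_nat. Qed.

Lemma bigcap_tailset : \bigcap_n tailset n = set0.
Proof.
apply/seteqP; split => // x H.
have [N xN] : exists N : nat, sumabs (x : 'rV[R]_p) < N%:R.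
  exists (Num.truncn (sumabs (x : 'rV[R]_p))).+1; exact: truncnS_gt.
have [k kx] := H N I; have := le_lt_trans (entry_le_sumabs (x : 'rV[R]_p) 0 k) xN.
by rewrite ltNge (ltW kx).
Qed.

Lemma notin_tailset n (x : 'rV[R]_p) : ~ tailset n x -> forall k, `|x 0 k| <= n%:R.
Proof. by move=> H k; rewrite leNgt; apply/negP => kx; apply: H; exists k. Qed.

(** A proportion [x] in the unit interval satisfies [x <= x^s]; this is applied to [a / (a + b)] and
    [b / (a + b)], which sum to 1. *)
Lemma powR_subadd (a b s : R) : 0 <= a -> 0 <= b -> 0 < s -> s < 1 ->
  (a + b) `^ s <= a `^ s + b `^ s.
Proof.
move=> a0 b0 s0 s1.
have [ab|ab] := eqVneq (a + b) 0; first by rewrite ab powR0 ?gt_eqF// addr_ge0 ?powR_ge0.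
have ab0 : 0 < a + b by rewrite lt_def ab addr_ge0.
have H c : 0 <= c -> c <= a + b -> (a + b) `^ s * (c / (a + b)) <= c `^ s.
  move=> c0 cab; have [->|c_neq0] := eqVneq c 0; first by rewrite mul0r mulr0 powR_ge0.
  have cp : 0 < c by rewrite lt_def c_neq0.
  have -> : c `^ s = (a + b) `^ s * (c / (a + b)) `^ s.
    by rewrite -powRM ?divr_ge0 ?(ltW ab0)// mulrC divfK.
  rewrite ler_wpM2l ?powR_ge0//; apply: ger1_powR; last exact: ltW.
  by rewrite divr_gt0//= ler_pdivrMr// mul1r.
have -> : (a + b) `^ s = (a + b) `^ s * (a / (a + b)) + (a + b) `^ s * (b / (a + b)).
  by rewrite -mulrDr -mulrDl mulfV// mulr1.
by rewrite lerD// H// ?lerDl ?lerDr.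
Qed.

(** Subadditivity of the power separates the two perturbations, so that one can be made small
    through [e] and the other through the set [E]. *)
Lemma integral_perturb d (T : measurableType d) (mu : {measure set T -> \bar R})
    (w g : T -> R) (E : set T) (s e C : R) :
  measurable_fun setT w -> (forall x, 0 <= w x) ->
  measurable_fun setT g -> (forall x, 0 <= g x) -> measurable E ->
  0 < s -> s < 1 -> 0 <= e -> 0 <= C ->
  (\int[mu]_x (w x * (g x + (e + C * \1_E x)) `^ s)%:E <=
   \int[mu]_x (w x * g x `^ s)%:E +
   ((e `^ s)%:E * \int[mu]_x (w x)%:E + (C `^ s)%:E * \int[mu]_x (w x * \1_E x)%:E))%E.
Proof.
move=> mw w0 mg g0 mE s0 s1 e0 C0.
have mI : measurable_fun setT (\1_E : T -> R) by exact: measurable_indic.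
have mEw : measurable_fun setT (EFin \o w) by exact/measurable_EFinP.
have mwg : measurable_fun setT (fun x => (w x * g x `^ s)%:E).
  apply/measurable_EFinP/measurable_funM => //.
  exact: (measurableT_comp (measurable_powR _) mg).
have mwE : measurable_fun setT (fun x => (w x * \1_E x)%:E).
  by apply/measurable_EFinP; exact: measurable_funM.
have m2 : measurable_fun setT (fun x => (e `^ s)%:E * (w x)%:E)%E by exact: emeasurable_funM.
have m3 : measurable_fun setT (fun x => (C `^ s)%:E * (w x * \1_E x)%:E)%E.
  exact: emeasurable_funM.
have m23 : measurable_fun setT
    (fun x => (e `^ s)%:E * (w x)%:E + (C `^ s)%:E * (w x * \1_E x)%:E)%E.
  exact: emeasurable_funD.
have w1 x : (0 <= (w x * g x `^ s)%:E)%E by rewrite lee_fin mulr_ge0 ?powR_ge0.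
have w2 x : (0 <= (e `^ s)%:E * (w x)%:E)%E by rewrite -EFinM lee_fin mulr_ge0 ?powR_ge0.
have w3 x : (0 <= (C `^ s)%:E * (w x * \1_E x)%:E)%E.
  by rewrite -EFinM lee_fin !mulr_ge0 ?powR_ge0.
have wE x : (0 <= (w x * \1_E x)%:E)%E by rewrite lee_fin mulr_ge0.
have Ew0 x : (0 <= (w x)%:E)%E by rewrite lee_fin.
rewrite -!ge0_integralZl ?lee_fin ?powR_ge0//.
rewrite -ge0_integralD// -ge0_integralD//; last by move=> x _; rewrite adde_ge0.
apply: ge0_le_integral => //.
- by move=> x _; rewrite lee_fin mulr_ge0 ?powR_ge0.
- apply/measurable_EFinP/measurable_funM => //.
  apply: (measurableT_comp (measurable_powR s)).
  by apply: measurable_funD => //; apply: measurable_funD => //; exact: measurable_funM.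
- exact: emeasurable_funD.
move=> x _; rewrite -!EFinM lee_fin.
rewrite [X in _ <= _ + (X + _)]mulrC [X in _ <= _ + (_ + X)]mulrCA -!mulrDr ler_wpM2l//.
have tI : 0 <= C * \1_E x by rewrite mulr_ge0.
apply: le_trans (powR_subadd _ _ s0 s1) _ => //; first by rewrite addr_ge0.
rewrite lerD2l; apply: le_trans (powR_subadd e0 tI s0 s1) _.
rewrite lerD2l powRM// indicE; case: (x \in _); first by rewrite powR1.
by rewrite powR0 ?gt_eqF.
Qed.

End tails.

(** * Bounded scale factors *)

Section bounded_case.
Context (R : realType) (d : measure_display) (T : measurableType d).
Variables (P : probability T R) (m p : nat) (X : nat -> T -> 'rV[R]_p).
Variables (f : R -> R) (v be : R) (t0 : param R m p) (s : R).
Hypothesis p_gt0 : (0 < p)%N.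
Hypothesis cf : continuous f.
Hypothesis f_ge0 : forall t, 0 <= f t.
Hypothesis f_dens : intRp (fun x : 'rV[R]_p => (f ((x *m x^T) 0 0))%:E) = 1%E.
Hypothesis f_decay : forall t, 0 <= t -> f t <= v * (1 + Num.sqrt t) `^ (- be).
Hypothesis be1 : 1 <= be.
Hypotheses (s0 : 0 < s) (s1 : s < 1) (sbe : p%:R < be * (1 - s)).
Hypothesis mix0 : is_mixing t0.1.1 t0.1.2.
Hypothesis unit0 : t0.2 \in unitmx.
Local Notation g0 := (gth f t0).
Hypothesis Xmeas : forall i, rvec_measurable (X i).
Hypothesis Xindep : mutually_independent P X.
Hypothesis Xdens : forall i, has_density P (X i) g0.

Let mg0 : measurable_fun setT (g0 : Rp R p -> R).
Proof. exact: measurable_gth. Qed.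

Let g0_ge0 x : 0 <= g0 x.
Proof. by apply: gth_ge0 => //; case: mix0. Qed.

(** This is where the choice of [s] meets the tail condition: [sbe] says that [p < be (1 - s)]. *)
Lemma g0_powR_integrable : (\int[lebRp R p]_x (g0 x `^ (1 - s))%:E < +oo)%E.
Proof.
have [C HC] : exists C : R, forall x k, g0 x <= C * (1 + `|x 0 k|) `^ (- be).
  by apply: (gth_decay f_ge0 f_decay be1 unit0); case: mix0.
by apply: (@powR_decay_integrable _ _ _ C be) => //; rewrite subr_gt0.
Qed.

Variable F : set_system (param R m p).
Hypothesis FU : UltraFilter F.
Hypothesis Fmix : \forall t \near F, is_mixing t.1.1 t.1.2.
Hypothesis Fbad : forall G, F G -> ~ good P X g0 (gth f) G.
Variables (A : 'M[R]_p) (al : 'I_m -> R) (mu : 'I_m -> 'rV[R]_p) (fin : 'I_m -> bool).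
Hypothesis FA : mxcvg F (fun t => t.2) A.
Hypothesis Fal : forall j, t.1.1 j @[t --> F] --> al j.
Hypothesis al_ge0 : forall j, 0 <= al j.
Hypothesis al_sum : \sum_j al j = 1.
Hypothesis Fmu : forall j, if fin j then mxcvg F (fun t => t.1.2 j) (mu j) else escapes F j.
Local Notation tl := (limit_param A al mu fin).

Let tl_ge0 j : 0 <= tl.1.1 j.
Proof. exact: limit_weight_ge0. Qed.

Let ml : measurable_fun setT (gth f tl : Rp R p -> R).
Proof. exact: measurable_gth. Qed.

Let gl_ge0 x : 0 <= gth f tl x.
Proof. exact: gth_ge0. Qed.

Lemma limit_affinity_ge1 :
  (1 <= \int[lebRp R p]_x (g0 x `^ (1 - s) * gth f tl x `^ s)%:E)%E.
Proof.
rewrite leNgt; apply/negP => lt1.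
set I1 := (\int[lebRp R p]_x _)%E in lt1.
have I1_ge0 : (0 <= I1)%E by apply: integral_ge0 => x _; rewrite lee_fin mulr_ge0 ?powR_ge0.
have I1fin : I1 \is a fin_num by rewrite ge0_fin_numE// (lt_trans lt1) ?ltry.
pose I0 := (\int[lebRp R p]_x (g0 x `^ (1 - s))%:E)%E.
have I0_ge0 : (0 <= I0)%E by apply: integral_ge0 => x _; rewrite lee_fin powR_ge0.
have I0fin : I0 \is a fin_num by rewrite ge0_fin_numE// g0_powR_integrable.
(* One third of the distance to 1 goes to the constant [e], one third to the tail, and the last
   keeps the inequality strict. *)
pose gap := (1 - fine I1) / 3.
have gap0 : 0 < gap by rewrite divr_gt0// subr_gt0 -lte_fin fineK.
pose Cb := (`|\det A| + 1) * v.
have Cb0 : 0 <= Cb by rewrite mulr_ge0// ?(decay_const_ge0 f_ge0 f_decay)// addr_ge0.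
(* The solution of [e^s (I0 + 1) = gap]. *)
pose e := (gap / (fine I0 + 1)) `^ s^-1.
have I01 : 0 < fine I0 + 1 by rewrite ltr_wpDl// fine_ge0.
have e0 : 0 < e by rewrite powR_gt0// divr_gt0.
have es : e `^ s = gap / (fine I0 + 1).
  by rewrite /e -powRrM mulVf ?gt_eqF// powRr1// divr_ge0// ltW.
have mw : measurable_fun setT ((fun x => g0 x `^ (1 - s)) : Rp R p -> R).
  exact: (measurableT_comp (measurable_powR _) mg0).
have [n tailn] : exists n, (\int[lebRp R p]_x (g0 x `^ (1 - s) * \1_(@tailset R p n) x)%:E
    < (gap / (Cb `^ s + 1))%:E)%E.
  apply: (integral_shrink mw) => //.
  - by move=> x; exact: powR_ge0.
  - exact: g0_powR_integrable.
  - exact: measurable_tailset.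
  - exact: tailset_decr.
  - by rewrite bigcap_tailset; apply: integral0_eq => x _; rewrite indicE in_set0 mulr0.
  - by rewrite divr_gt0// ltr_wpDl// powR_ge0.
(* Inside the box the densities are compared with the limit, up to [e]; outside only the uniform
   bound [Cb] is available. *)
pose H x := gth f tl x + (e + Cb * \1_(@tailset R p n) x).
have mI : measurable_fun setT (\1_(@tailset R p n) : Rp R p -> R).
  by apply: measurable_indic; exact: measurable_tailset.
have mH : measurable_fun setT (H : Rp R p -> R).
  by apply: measurable_funD => //; apply: measurable_funD => //; exact: measurable_funM.
have H0 x : 0 <= H x.
  by rewrite /H addr_ge0// addr_ge0 ?(ltW e0)// mulr_ge0.
have Hlt1 : (\int[lebRp R p]_x (g0 x `^ (1 - s) * H x `^ s)%:E < 1)%E.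
  apply: (le_lt_trans (integral_perturb (lebRp R p) mw (fun x => powR_ge0 _ _) ml gl_ge0
    (@measurable_tailset R p n) s0 s1 (ltW e0) Cb0)).
  rewrite -/I1 -/I0 -(fineK I1fin) -(fineK I0fin) es.
  apply: (@le_lt_trans _ _ ((fine I1)%:E + ((gap / (fine I0 + 1) * fine I0)%:E + (Cb `^ s * (gap / (Cb `^ s + 1)))%:E))%E).
    rewrite leeD2l// leeD2l// EFinM lee_wpmul2l ?lee_fin ?powR_ge0//.
    exact: ltW.
  rewrite -!EFinD lte_fin.
  have h1 : gap / (fine I0 + 1) * fine I0 <= gap.
    by rewrite -mulrA ler_piMr ?(ltW gap0)// mulrC ler_pdivrMr// mul1r lerDl.
  have h2 : Cb `^ s * (gap / (Cb `^ s + 1)) <= gap.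
    rewrite mulrCA ler_piMr ?(ltW gap0)// ler_pdivrMr ?mul1r ?lerDl//.
    by rewrite ltr_wpDl// powR_ge0.
  have h3 : fine I1 = 1 - gap * 3 by rewrite /gap divfK// opprB addrC subrK.
  by rewrite h3; move: h1 h2 gap0; lra.
(* The parameters dominated by [H] form a good set that belongs to [F], which is the
   contradiction. *)
apply: (@Fbad [set t | forall x, 0 <= gth f t x <= H x]); last first.
  exact: (@good_dominated _ _ _ P p X g0 Xmeas Xindep Xdens mg0 g0_ge0 _ (gth f) s s0 s1 H mH H0 Hlt1).
have FP : ProperFilter F by exact: ultra_proper.
near=> t.
have mt : is_mixing t.1.1 t.1.2 by near: t; exact: Fmix.
have tCb : forall x, gth f t x <= Cb.
  by near: t; exact: (gth_bounded f_ge0 f_decay be1 FU Fmix FA).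
have tbox : forall x : 'rV[R]_p, (forall k, `|x 0 k| <= n%:R) -> gth f t x <= gth f tl x + e.
  near: t; exact: (gth_le_limit_box cf f_ge0 f_decay be1 FU Fmix FA (@Fal) Fmu n%:R e0).
move=> x; apply/andP; split; first by apply: gth_ge0 => //; case: mt.
have [xn|xn] := pselect (@tailset R p n x).
  rewrite /H indicE mem_set// mulr1 addrA -[leLHS]add0r lerD//.
  by rewrite addr_ge0// ltW.
rewrite /H indicE memNset// mulr0 addr0; apply: tbox; exact: notin_tailset.
Unshelve. all: by end_near. Qed.

(** Equality with [g0] forces the limit to have integral 1, and that integral is the sum of the kept
    weights times the indicator of [det A != 0]. So no weight escaped and the scale matrix did not
    blow up. *)
Lemma limit_density : [/\ gth f tl =1 g0, \sum_j tl.1.1 j = 1 & \det A != 0].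
Proof.
have ig0 : (\int[lebRp R p]_x (g0 x)%:E = 1)%E by exact: (integral_g0 Xmeas Xdens).
have igl := integral_gth cf f_ge0 f_dens tl_ge0.
have w1 : \sum_j tl.1.1 j <= 1 by exact: limit_weights.
have w0 : 0 <= \sum_j tl.1.1 j by exact: sumr_ge0.
have gE : gth f tl =1 g0.
  move=> x; apply/esym; move: x; apply: continuous_ae_eq; [exact: continuous_gth|exact: continuous_gth|].
  apply: (@hellinger_ae_eq _ _ _ _ _ _ s) => //.
  - by rewrite ig0.
  - by rewrite igl lee_fin; case: (_ != 0); rewrite ?mulr1 ?mulr0.
  - exact: limit_affinity_ge1.
have : (\int[lebRp R p]_x (gth f tl x)%:E = 1)%E.
  by rewrite -ig0; apply: eq_integral => x _; rewrite gE.
rewrite igl => /eqP; rewrite eqe [(limit_param _ _ _ _).2]/= => /eqP.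
have [dA|dA] := eqVneq (\det A) 0.
  by rewrite mulr0 => /eqP; rewrite eq_sym oner_eq0.
by rewrite mulr1 => ->; split.
Qed.

End bounded_case.

Section shrinking_unions.
Context (R : realType) d (T : measurableType d).
Variable mu : {measure set T -> \bar R}.
Local Open Scope ereal_scope.

Lemma integral_shrink_bigcup (I : finType) (w : T -> R) (E : I -> nat -> set T) (eta : R) :
  measurable_fun setT w -> (forall x, 0 <= w x)%R -> \int[mu]_x (w x)%:E < +oo ->
  (forall i n, measurable (E i n)) -> (forall i n, E i n.+1 `<=` E i n) ->
  (forall i, \int[mu]_x (w x * \1_(\bigcap_n E i n) x)%:E = 0) -> (0 < eta)%R ->
  exists N, \int[mu]_x (w x * \1_(\bigcup_(i in [set: I]) E i N) x)%:E < eta%:E.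
Proof.
move=> mw w0 wy mE ndE E0 eta0.
pose e1 := (eta / #|I|.+1%:R)%R.
have e10 : (0 < e1)%R by rewrite divr_gt0// ltr0n.
have [n nP] := choice (fun i => integral_shrink mw w0 wy (mE i) (ndE i) (E0 i) e10).
pose N := \max_i n i; exists N.
have ndE' : forall i n k, (n <= k)%N -> E i k `<=` E i n.
  move=> i k l /subnK <-; elim: (l - k)%N => // j IH.
  by rewrite addSn; apply: subset_trans IH; exact: ndE.
have mwI A : measurable A -> measurable_fun setT (fun x => (w x * \1_A x)%:E).
  move=> mA; have mI : measurable_fun setT (\1_A : T -> R) by exact: measurable_indic.
  by apply/measurable_EFinP; exact: measurable_funM.
have wI0 (A : set T) x : 0 <= (w x * \1_A x)%:E by rewrite lee_fin mulr_ge0.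
have mU : measurable (\bigcup_(i in [set: I]) E i N).
  by apply: fin_bigcup_measurable => //; exact: finite_finset.
apply: (@le_lt_trans _ _ (\sum_(i : I) \int[mu]_x (w x * \1_(E i N) x)%:E)).
  rewrite -ge0_integral_sum//; last by move=> i; exact: mwI.
  apply: ge0_le_integral => //; first exact: mwI.
    by apply: emeasurable_sum => i; exact: mwI.
  move=> x _; rewrite sumEFin lee_fin -mulr_sumr ler_wpM2l//.
  rewrite indicE; case: (boolP (x \in _)) => [|_]; last by rewrite sumr_ge0.
  rewrite inE => -[i _ xi]; rewrite (bigD1 i)//= indicE mem_set// lerDl sumr_ge0//.
apply: (@le_lt_trans _ _ (\sum_(i : I) e1%:E)).
  apply: lee_sum => i _; apply: le_trans (ltW (nP i)).
  apply: ge0_le_integral => //; [exact: mwI|exact: mwI|].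
  move=> x _; rewrite lee_fin ler_wpM2l// !indicE.
  case: (boolP (x \in E i N)) => [|_]; last by rewrite ler0n.
  by rewrite inE => xi; rewrite mem_set//; apply: ndE' xi; exact: leq_bigmax.
rewrite sumEFin lte_fin sumr_const -mulr_natr /e1 mulrAC ltr_pdivrMr ?ltr0n//.
by rewrite ltr_pM2l// ltr_nat.
Qed.

End shrinking_unions.

(** * Scale factors that blow up *)

Section unbounded_case.
Context (R : realType) (d : measure_display) (T : measurableType d).
Variables (P : probability T R) (m p : nat) (X : nat -> T -> 'rV[R]_p).
Variables (f : R -> R) (v be : R) (t0 : param R m p) (s : R).
Hypothesis p_gt0 : (0 < p)%N.
Hypothesis cf : continuous f.
Hypothesis f_ge0 : forall t, 0 <= f t.
Hypothesis f_decay : forall t, 0 <= t -> f t <= v * (1 + Num.sqrt t) `^ (- be).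
Hypothesis be1 : 1 <= be.
Hypotheses (s0 : 0 < s) (s1 : s < 1) (sbe : p%:R < be * (1 - s)).
Hypothesis mix0 : is_mixing t0.1.1 t0.1.2.
Hypothesis unit0 : t0.2 \in unitmx.
Local Notation g0 := (gth f t0).
Hypothesis Xmeas : forall i, rvec_measurable (X i).
Hypothesis Xindep : mutually_independent P X.
Hypothesis Xdens : forall i, has_density P (X i) g0.

Let mg0 : measurable_fun setT (g0 : Rp R p -> R).
Proof. exact: measurable_gth. Qed.

Let g0_ge0 x : 0 <= g0 x.
Proof. by apply: gth_ge0 => //; case: mix0. Qed.

Let v0 : 0 <= v.
Proof. exact: (decay_const_ge0 f_ge0 f_decay). Qed.

(** The determinant contributes [tau^p], and an image [z B] with a coordinate of size at least [e]
    gains the decay [tau^(- be)]. The power is written through [ln tau] to match [good_strip]. *)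
Lemma kern_scale_le (A : 'M[R]_p) (tau : R) (B : 'M[R]_p) z k (e : R) :
  0 < tau -> A = tau *: B -> 0 < e -> e <= `|(z *m B) 0 k| ->
  kern f A z <= `|\det B| * v * e `^ (- be) * expR (ln tau * (p%:R - be)).
Proof.
move=> tau0 AB e0 ez; rewrite /kern.
set q := (_ *m _) 0 0; have q0 : 0 <= q by exact: sqnorm_ge0.
have te : tau * e <= 1 + Num.sqrt q.
  apply: (@le_trans _ _ (Num.sqrt q)); last by rewrite lerDr.
  apply: le_trans (coord_le_sqnorm _ k).
  rewrite AB -scalemxAr mxE normrM (gtr0_norm tau0) ler_wpM2l//; exact: ltW.
have te0 : 0 < tau * e by rewrite mulr_gt0.
have h1 : 0 < 1 + Num.sqrt q by exact: lt_le_trans te.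
have fq : f q <= v * ((tau * e) `^ (- be)).
  apply: le_trans (f_decay q0) _; rewrite ler_wpM2l// !powRN lef_pV2 ?posrE ?powR_gt0//.
  by apply: ge0_ler_powR; rewrite ?nnegrE ?(le_trans ler01 be1) ?(ltW te0) ?(ltW h1).
apply: le_trans (ler_wpM2l (normr_ge0 _) fq) _.
rewrite AB detZ normrM normrX (gtr0_norm tau0) powRM ?(ltW tau0) ?(ltW e0)//.
have -> : expR (ln tau * (p%:R - be)) = tau ^+ p * tau `^ (- be).
  by rewrite mulrDr expRD [ln tau * p%:R]mulrC expRM_natl lnK ?posrE// /powR gt_eqF// [ln tau * _]mulrC.
rewrite le_eqVlt; apply/orP; left; apply/eqP; ring.
Qed.

Lemma kern_scale_le0 (A : 'M[R]_p) (tau : R) (B : 'M[R]_p) z :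
  0 < tau -> A = tau *: B ->
  kern f A z <= `|\det B| * v * expR (ln tau * p%:R).
Proof.
move=> tau0 AB; apply: le_trans (kern_le f_ge0 f_decay be1 _ _) _.
rewrite AB detZ normrM normrX (gtr0_norm tau0) [ln tau * _]mulrC expRM_natl lnK ?posrE//.
by rewrite le_eqVlt; apply/orP; left; apply/eqP; ring.
Qed.

Variable F : set_system (param R m p).
Hypothesis FU : UltraFilter F.
Hypothesis Fmix : \forall t \near F, is_mixing t.1.1 t.1.2.
Hypothesis Fesc : forall K : R, \forall t \near F, exists i k, K < `|(t.2 : 'M[R]_p) i k|.

(** The matrix is split into a size and a direction; the directions are bounded and so converge
    along [F]. *)
Let tau (t : param R m p) : R := sumabs t.2.
Let B (t : param R m p) : 'M[R]_p := (tau t)^-1 *: t.2.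

Let tau_large (K : R) : \forall t \near F, K < tau t.
Proof.
apply: filterS (Fesc K) => t [i [k Kt]]; exact: lt_le_trans Kt (entry_le_sumabs _ _ _).
Qed.

Let sumabsB t : 0 < tau t -> sumabs (B t) = 1.
Proof.
move=> t_gt0; rewrite /sumabs -(@mulVf _ (tau t)) ?gt_eqF// {2}/tau /sumabs mulr_sumr.
apply: eq_bigr => i _; rewrite mulr_sumr; apply: eq_bigr => k _.
by rewrite mxE normrM gtr0_norm ?invr_gt0.
Qed.

(** The limit [L] again has size 1, so it has a nonzero column. One column is enough, as it serves
    as the common normal of all slabs. *)
Let limit_direction : exists (L : 'M[R]_p) (k : 'I_p),
  mxcvg F B L /\ (\row_i L i k : 'rV[R]_p) != 0.
Proof.
have FP : ProperFilter F by exact: ultra_proper.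
have [L BL] : exists L, mxcvg F B L.
  apply: (ultra_mxcvg FU (K := 1)); apply: filterS (tau_large 0) => t tt i k.
  by apply: le_trans (entry_le_sumabs _ _ _) _; rewrite sumabsB.
have L1 : sumabs L = 1.
  have c1 : sumabs (B t) @[t --> F] --> sumabs L.
    by apply: cvg_bigsum => i _; apply: cvg_bigsum => k _; exact: cvg_norm (BL i k).
  have c2 : sumabs (B t) @[t --> F] --> (1 : R).
    by apply: cvg_near_cst; apply: filterS (tau_large 0) => t; exact: sumabsB.
  exact: (cvg_unique (@Rhausdorff R) c1 c2).
have [k Lk] : exists k, (\row_i L i k : 'rV[R]_p) != 0.
  apply: contrapT => H; have : sumabs L = 0.
    apply: big1 => i _; apply: big1 => k _; apply/eqP; rewrite normr_eq0; apply: contrapT => /negP Lik.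
    apply: H; exists k; apply: contra Lik => /eqP/rowP/(_ i); rewrite !mxE => ->.
    exact: eqxx.
  by rewrite L1 => /eqP; rewrite oner_eq0.
by exists L, k.
Qed.

Lemma ultra_real_cvg_or_escape (c : param R m p -> R) : exists lb : R * bool,
  if lb.2 then c t @[t --> F] --> lb.1 else forall K : R, \forall t \near F, K < `|c t|.
Proof.
have [[L cL]|esc] := ultra_mxcvg_or_escape FU (fun t => (c t)%:M : 'M[R]_1).
  exists (L 0 0, true) => /=; have := cL 0 0.
  by under eq_fun do rewrite mxE eqxx mulr1n.
exists (0, false) => K; apply: filterS (esc K) => t [i [k]].
by rewrite !ord1 mxE eqxx mulr1n.
Qed.

Lemma unbounded_good : exists2 G, F G & good P X g0 (gth f) G.
Proof.
have FP : ProperFilter F by exact: ultra_proper.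
have [L [k [BL Lk]]] := limit_direction.
pose u : 'rV[R]_p := \row_i L i k.
(* [c j t] is the position of atom [j] along column [k]. A limit of it is the level of the
   hyperplane at which slab [j] is placed. *)
pose c j (t : param R m p) : R := (t.1.2 j *m B t) 0 k.
have [lb lbP] := choice (fun j => ultra_real_cvg_or_escape (c j)).
pose dot (x : 'rV[R]_p) := \sum_i u 0 i * x 0 i.
pose slab (j : 'I_m) (n : nat) : set (Rp R p) :=
  if (lb j).2 then [set x | `|dot x - (lb j).1| <= n.+1%:R^-1] else set0.
(* The tail is excluded together with the slabs, because column [k] of [x B] is uniformly close to
   its limit only for [x] in a box. *)
pose E (o : option 'I_m) n := if o is Some j then slab j n else tailset n.
have mdot (j : 'I_m) : measurable_fun setT (fun x : Rp R p => `|dot x - (lb j).1|).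
  apply: measurableT_comp => //; apply: measurable_funB => //.
  apply: measurable_sum => i; apply: measurable_funM => //; exact: measurable_coord.
have mE o n : measurable (E o n).
  case: o => [j|]; last exact: measurable_tailset.
  rewrite /E /slab; case: (lb j).2 => //.
  have := mdot j measurableT `]-oo, n.+1%:R^-1]%classic (measurable_itv _).
  by rewrite setTI.
have ndE o n : E o n.+1 `<=` E o n.
  case: o => [j|]; last exact: tailset_decr.
  rewrite /E /slab; case: (lb j).2 => // x /= H; apply: le_trans H _.
  by rewrite lef_pV2 ?posrE ?ltr0n// ler_nat.
have E0 o : (\int[lebRp R p]_x (g0 x * \1_(\bigcap_n E o n) x)%:E = 0)%E.
  case: o => [j|]; last first.
    by rewrite bigcap_tailset; apply: integral0_eq => x _; rewrite indicE in_set0 mulr0.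
  have mcap : measurable (\bigcap_n E (Some j) n) by exact: bigcap_measurableType.
  move: mcap; rewrite /E /slab; case: (lb j).2 => mcap; last first.
    apply: integral0_eq => x _; rewrite indicE memNset ?mulr0// => H.
    exact: (H 0%N I).
  have capE : \bigcap_n [set x : Rp R p | `|dot x - (lb j).1| <= n.+1%:R^-1] =
      [set x : 'rV[R]_p | \sum_i u 0 i * x 0 i = (lb j).1].
    apply/seteqP; split => x /=; last by move=> xj n _ /=; rewrite /dot xj subrr normr0 invr_ge0.
    move=> H; apply/eqP; rewrite -subr_eq0 -normr_eq0; apply: contrapT => /negP.
    rewrite -/(dot x) => dx.
    have dx0 : 0 < `|dot x - (lb j).1| by rewrite lt_def dx normr_ge0.
    have [N _ /(_ N (leqnn _))] := near_infty_natSinv_lt (PosNum dx0).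
    by have := H N I => /= HN; rewrite ltNge HN.
  rewrite capE in mcap *.
  rewrite -[RHS](@intRp_hyperplane R p u (lb j).1 g0 Lk) intRpE.
  - by apply: eq_integral => x _; rewrite mulrC.
  - by apply/measurable_EFinP; apply: measurable_funM => //; exact: measurable_indic.
  - by move=> x; rewrite lee_fin mulr_ge0.
(* With this value the exponent of [good_strip] is [p] on the exceptional set and [p - be] off
   it. *)
pose gam := (be - p%:R) / 2.
have bep : p%:R < be.
  apply: lt_le_trans sbe _; rewrite ler_piMr ?(le_trans ler01 be1)// gerBl; exact: ltW.
have gam0 : 0 < gam by rewrite divr_gt0// subr_gt0.
have be0 : 0 < be by exact: lt_le_trans be1.
have ig0 : (\int[lebRp R p]_x (g0 x)%:E = 1)%E by exact: (integral_g0 Xmeas Xdens).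
have g0y : (\int[lebRp R p]_x (g0 x)%:E < +oo)%E by rewrite ig0 ltry.
have K0 : 0 < (expR (be / gam))^-1 by rewrite invr_gt0 expR_gt0.
have [N AN] := integral_shrink_bigcup mg0 g0_ge0 g0y mE ndE E0 K0.
set A := \bigcup_(i in _) _ in AN.
have mA : measurable A by apply: fin_bigcup_measurable => //; exact: finite_finset.
(* Off a slab the point is more than [2 del] away from the hyperplane. Errors of [del / 2] in the
   direction and [del / 2] in [c j] leave a distance of [del]. *)
pose del : R := N.+1%:R^-1 / 2.
have del0 : 0 < del by rewrite divr_gt0// invr_gt0.
pose Dd := `|\det L| + 1.
(* Large enough for the kernel bounds on and off the exceptional set; the last summand makes it
   positive even when [v] is 0. *)
pose C := Dd * v * (1 + del `^ (- be)) + 1.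
have DV0 : 0 <= Dd * v by rewrite mulr_ge0// addr_ge0.
have C0 : 0 < C by rewrite ltr_wpDl// mulr_ge0// addr_ge0// powR_ge0.
have PA : ((expR (be / gam))%:E * \int[lebRp R p]_x (g0 x * \1_A x)%:E < 1)%E.
  move: AN; set Q := (\int[lebRp R p]_x _)%E => AN.
  have Q0 : (0 <= Q)%E by apply: integral_ge0 => x _; rewrite lee_fin mulr_ge0.
  have Qfin : Q \is a fin_num by rewrite ge0_fin_numE// (lt_trans AN) ?ltry.
  rewrite -(fineK Qfin) -EFinM lte_fin -ltr_pdivlMl ?expR_gt0// mulr1.
  by rewrite -lte_fin fineK.
have g0s := g0_powR_integrable p_gt0 cf f_ge0 f_decay be1 s1 sbe mix0 unit0.
have [l0 l0P] := good_strip Xmeas Xindep Xdens mg0 g0_ge0 s0 s1 g0s (@gth R m p f) mA C0 gam0 be0 PA.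
eexists; last exact: l0P.
near=> t.
have mt : is_mixing t.1.1 t.1.2 by near: t; exact: Fmix.
have t_gt0 : 0 < tau t by near: t; exact: tau_large.
have tl0 : expR l0 < tau t by near: t; exact: tau_large.
have tB : t.2 = tau t *: B t by rewrite /B scalerA mulfV ?gt_eqF// scale1r.
have dB : `|\det (B t)| <= Dd.
  near: t; have cdet : `|\det (B t)| @[t --> F] --> `|\det L| by exact: cvg_norm (cvg_det BL).
  by apply: (cvgr_le _ cdet); rewrite ltrDl.
have sB : sumabs (B t) = 1 by exact: sumabsB.
have uB : N%:R * \sum_i `|B t i k - L i k| <= del / 2.
  near: t.
  have cs : N%:R * \sum_i `|B t i k - L i k| @[t --> F] --> (0 : R).
    have cs0 : \sum_i `|B t i k - L i k| @[t --> F] --> \sum_(i < p) `|0 : R|.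
      apply: cvg_bigsum => i _; apply: cvg_norm; rewrite -(subrr (L i k)).
      by apply: cvgB; [exact: BL|exact: cvg_cst].
    rewrite [\sum_(i < p) `|0|]big1 in cs0; last by move=> i _; rewrite normr0.
    by rewrite -[X in _ --> X](mulr0 N%:R); exact: cvgMr.
  by apply: (cvgr_le _ cs); rewrite divr_gt0.
have cj : forall j, if (lb j).2 then `|c j t - (lb j).1| <= del / 2 else N%:R + del < `|c j t|.
  near: t; apply: filter_forall => j; have := lbP j; case: (lb j).2 => H; last exact: H.
  have cs : `|c j t - (lb j).1| @[t --> F] --> (0 : R).
    rewrite -(normr0 R); apply: cvg_norm; rewrite -(subrr (lb j).1).
    by apply: cvgB => //; exact: cvg_cst.
  by apply: (cvgr_le _ cs); rewrite divr_gt0.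
exists (ln (tau t)).
  by rewrite -[leLHS]expRK ler_ln ?posrE ?expR_gt0// ltW.
move=> x; apply/andP; split; first by apply: gth_ge0 => //; case: mt.
apply: gth_le => // j; rewrite indicE; have [xA|xA] := pselect (A x).
  rewrite mem_set// mulr1 (_ : be - gam *+ 2 = p%:R); last first.
    by rewrite /gam -mulr_natr divfK// opprB addrC subrK.
  apply: le_trans (kern_scale_le0 _ t_gt0 tB) _; rewrite ler_wpM2r ?expR_ge0//.
  apply: le_trans (ler_wpM2r v0 dB) _; rewrite /C mulrDr mulr1 -addrA lerDl.
  by rewrite addr_ge0// mulr_ge0// powR_ge0.
rewrite memNset// mulr0 add0r (_ : - (gam *+ 2) = p%:R - be); last first.
  by rewrite /gam -mulr_natr divfK// opprB.
have xbox : forall i, `|x 0 i| <= N%:R.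
  by apply: notin_tailset => xt; apply: xA; exists None.
have dotB (z : 'rV[R]_p) : (z *m B t) 0 k = \sum_i z 0 i * B t i k by rewrite mxE.
have xmu : del <= `|((x - t.1.2 j) *m B t) 0 k|.
  rewrite mulmxBl mxE [X in _ + X]mxE -/(c j t).
  (* An escaped [c j] is out of reach of the box, where column [k] of [x B] is at most [N] in
     absolute value. A convergent one is treated by the triangle inequality. *)
  have := cj j; case E1 : (lb j).2 => cjt; last first.
    have xB : `|(x *m B t) 0 k| <= N%:R.
      rewrite dotB; apply: le_trans (ler_norm_sum _ _ _) _.
      apply: (@le_trans _ _ (N%:R * sumabs (B t))); last by rewrite sB mulr1.
      rewrite /sumabs mulr_sumr; apply: ler_sum => i _; rewrite normrM ler_pM//.
      by rewrite (bigD1 k)//= lerDl sumr_ge0.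
    rewrite distrC; apply: le_trans (lerB_dist _ _).
    by rewrite lerBrDl; apply: le_trans (ltW cjt); rewrite lerD2r.
  have xslab : del + del < `|dot x - (lb j).1|.
    rewrite ltNge; apply/negP => H; apply: xA; exists (Some j) => //.
    by rewrite /E /slab E1 /=; apply: le_trans H _; rewrite -splitr.
  have xd : `|(x *m B t) 0 k - dot x| <= del / 2.
    rewrite dotB /dot -sumrB; apply: le_trans (ler_norm_sum _ _ _) _.
    apply: le_trans uB; rewrite mulr_sumr; apply: ler_sum => i _.
    by rewrite [u 0 i]mxE [L i k * _]mulrC -mulrBr normrM ler_wpM2r.
  have tri : `|dot x - (lb j).1| <= `|(x *m B t) 0 k - c j t| + `|(x *m B t) 0 k - dot x| + `|c j t - (lb j).1|.
    rewrite -addrA addrC -addrA.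
    have -> : dot x - (lb j).1 = - ((x *m B t) 0 k - dot x) + (c j t - (lb j).1) + ((x *m B t) 0 k - c j t) by ring.
    apply: le_trans (ler_normD _ _) _; rewrite addrA lerD2r.
    by apply: le_trans (ler_normD _ _) _; rewrite normrN.
  by move: tri xd cjt xslab; lra.
apply: le_trans (kern_scale_le t_gt0 tB del0 xmu) _; rewrite ler_wpM2r ?expR_ge0//.
apply: (@le_trans _ _ (Dd * v * del `^ (- be))).
  by rewrite ler_wpM2r ?powR_ge0// ler_wpM2r.
by rewrite /C mulrDr mulr1 -addrA addrCA lerDl addr_ge0.
Unshelve. all: by end_near. Qed.

End unbounded_case.

(** * Continuity of the distance between mixing distributions *)

Section mixing_distance.
Variables (R : realType) (m p : nat).

Lemma measurable_norm1 : measurable_fun setT (@norm1 R p : Rp R p -> R).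
Proof.
apply: measurable_sum => k; apply: measurableT_comp => //; exact: measurable_coord.
Qed.

Lemma measurable_cwle (mu : 'rV[R]_p) : measurable ([set u | cwle mu u] : set (Rp R p)).
Proof.
have -> : [set u | cwle mu u] = \bigcap_(k in [set: 'I_p])
    ((fun u : Rp R p => (u : 'rV[R]_p) 0 k) @^-1` `[mu 0 k, +oo[%classic).
  apply/seteqP; split => u /= H.
    by move=> k _ /=; rewrite in_itv/= andbT; exact: H.
  by move=> k; have := H k I; rewrite /= in_itv/= andbT.
apply: fin_bigcap_measurable => [|k _]; first exact: finite_finset.
rewrite -[X in measurable X]setTI; exact: measurable_coord.
Qed.

Lemma measurable_Psi (al : 'I_m -> R) (mu : 'I_m -> 'rV[R]_p) :
  measurable_fun setT (Psi_of al mu : Rp R p -> R).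
Proof.
apply: measurable_sum => j; apply: measurable_funM => //.
have -> : (fun u : Rp R p => (`[< cwle (mu j) u >])%:R : R) =
    \1_([set u | cwle (mu j) u] : set (Rp R p)).
  by apply/funext => u; rewrite indicE; congr (nat_of_bool _)%:R; apply/asboolP/idP; rewrite inE.
by apply: measurable_indic; exact: measurable_cwle.
Qed.

Lemma measurable_expR_norm : measurable_fun setT (fun x : R => expR (- `|x|)).
Proof.
apply: (measurableT_comp (@measurable_expR R)); apply: measurable_funN.
exact: normr_measurable.
Qed.

(** Comparison with [4 (1 + |x|)^(-2)], obtained by squaring [1 + y <= 2 expR (y / 2)]. *)
Lemma integral_expR_norm_lty : (\int[lebesgue_measure]_x (expR (- `|x|) : R)%:E < +oo)%E.
Proof.
apply: (@le_lt_trans _ _ (\int[lebesgue_measure]_x (4%:E * ((1 + `|x|) `^ (- 2))%:E))%E).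
  apply: ge0_le_integral => //.
  - by apply/measurable_EFinP; exact: measurable_expR_norm.
  - apply: emeasurable_funM => //; apply/measurable_EFinP; exact: measurable_powR_add1_norm.
  move=> x _; rewrite -EFinM lee_fin powRN powR_mulrn ?(ltW (add1_norm_gt0 _))//.
  rewrite ler_pdivlMr ?exprn_gt0 ?add1_norm_gt0// expRN ler_pdivrMl ?expR_gt0//.
  set y := `|x|; have y0 : 0 <= y by exact: normr_ge0.
  have h : 1 + y <= 2 * expR (y / 2).
    by have := expR_ge1Dx (y / 2); move: y0; lra.
  have -> : expR y = expR (y / 2) ^+ 2 by rewrite expr2 -expRD -splitr.
  have -> : expR (y / 2) ^+ 2 * 4 = (2 * expR (y / 2)) ^+ 2 by ring.
  by rewrite lerXn2r// nnegrE ?mulr_ge0 ?expR_ge0// addr_ge0.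
rewrite ge0_integralZl//.
- by rewrite lte_mul_pinfty ?lee_fin// integral_powR_add1_norm_lty// ltr1n.
- by apply/measurable_EFinP; exact: measurable_powR_add1_norm.
Qed.

Lemma measurable_weight : measurable_fun setT ((fun u => expR (- norm1 u)) : Rp R p -> R).
Proof.
apply: (measurableT_comp (@measurable_expR R)); apply: measurable_funN.
exact: measurable_norm1.
Qed.

Lemma integral_weight_lty : (\int[lebRp R p]_u (expR (- norm1 u))%:E < +oo)%E.
Proof.
have mw : measurable_fun setT (fun u : Rp R p => (expR (- norm1 u))%:E).
  by apply/measurable_EFinP; exact: measurable_weight.
rewrite -intRpE; [|exact: mw|by move=> u; rewrite lee_fin expR_ge0].
have -> : (fun u : 'rV[R]_p => (expR (- norm1 u))%:E) =
    (fun u => (\prod_(k < p) expR (- `|u 0 k|))%:E).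
  by apply/funext => u; rewrite /norm1 -sumrN expR_sum.
rewrite (@intRp_prod R p (fun _ x => expR (- `|x|))).
- apply: prod_lty => k; last exact: integral_expR_norm_lty.
  by apply: integral_ge0 => x _; rewrite lee_fin expR_ge0.
- by move=> k; exact: measurable_expR_norm.
- by move=> k x; exact: expR_ge0.
Qed.

(** The step functions of two close atoms differ only at points with a coordinate close to that of
    the atom, hence near finitely many hyperplanes, and these are null sets. Atoms of limit weight 0
    may move freely. *)
Lemma Dstar_cvg (F : set_system (param R m p)) (FF : ProperFilter F)
    (al : 'I_m -> R) (mu : 'I_m -> 'rV[R]_p) (r : R) :
  (forall j, t.1.1 j @[t --> F] --> al j) -> (forall j, 0 <= al j) -> \sum_j al j = 1 ->
  (forall j, al j = 0 \/ mxcvg F (fun t => t.1.2 j) (mu j)) -> 0 < r ->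
  \forall t \near F, (Dstar (Psi_of t.1.1 t.1.2) (Psi_of al mu) < r%:E)%E.
Proof.
move=> Fal al_ge0 al_sum Fmu r0.
pose E (jk : 'I_m * 'I_p) (n : nat) : set (Rp R p) :=
  [set u | `|(u : 'rV[R]_p) 0 jk.2 - mu jk.1 0 jk.2| <= n.+1%:R^-1].
have mE jk n : measurable (E jk n).
  have md : measurable_fun setT (fun u : Rp R p => `|(u : 'rV[R]_p) 0 jk.2 - mu jk.1 0 jk.2|).
    by apply: measurableT_comp => //; apply: measurable_funB => //; exact: measurable_coord.
  have := md measurableT `]-oo, n.+1%:R^-1]%classic (measurable_itv _).
  by rewrite setTI.
have ndE jk n : E jk n.+1 `<=` E jk n.
  by move=> u /= H; apply: le_trans H _; rewrite lef_pV2 ?posrE ?ltr0n// ler_nat.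
pose w (u : Rp R p) := expR (- norm1 (u : 'rV[R]_p)).
have mw : measurable_fun setT w by exact: measurable_weight.
have w0 u : 0 <= w u by exact: expR_ge0.
have wy : (\int[lebRp R p]_u (w u)%:E < +oo)%E by exact: integral_weight_lty.
have E0 jk : (\int[lebRp R p]_u (w u * \1_(\bigcap_n E jk n) u)%:E = 0)%E.
  have mcap : measurable (\bigcap_n E jk n) by exact: bigcap_measurableType.
  pose d : 'rV[R]_p := delta_mx 0 jk.2.
  have d0 : d != 0.
    apply/eqP => /rowP/(_ jk.2)/eqP; rewrite !mxE !eqxx oner_eq0//.
  have capE : \bigcap_n E jk n = [set x : 'rV[R]_p | \sum_k d 0 k * x 0 k = mu jk.1 0 jk.2].
    have sumE (x : 'rV[R]_p) : \sum_k d 0 k * x 0 k = x 0 jk.2.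
      rewrite (bigD1 jk.2)//= mxE !eqxx mul1r big1 ?addr0// => k kj.
      by rewrite mxE eqxx/= (negbTE kj) mul0r.
    apply/seteqP; split => x /=; rewrite sumE; last first.
      by move=> xj n _; rewrite /E/= xj subrr normr0 invr_ge0.
    move=> H; apply/eqP; rewrite -subr_eq0 -normr_eq0; apply: contrapT => /negP dx.
    have dx0 : 0 < `|(x : 'rV[R]_p) 0 jk.2 - mu jk.1 0 jk.2| by rewrite lt_def dx normr_ge0.
    have [N _ /(_ N (leqnn _))] := near_infty_natSinv_lt (PosNum dx0).
    by have := H N I => /= HN; rewrite ltNge HN.
  rewrite capE in mcap *.
  rewrite -[RHS](@intRp_hyperplane R p d (mu jk.1 0 jk.2) w d0) intRpE.
  - by apply: eq_integral => x _; rewrite mulrC.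
  - by apply/measurable_EFinP; apply: measurable_funM => //; exact: measurable_indic.
  - by move=> x; rewrite lee_fin mulr_ge0.
have r20 : 0 < r / 2 by rewrite divr_gt0.
have [N AN] := integral_shrink_bigcup mw w0 wy mE ndE E0 r20.
set A := \bigcup_(i in _) _ in AN.
have mA : measurable A by apply: fin_bigcup_measurable => //; exact: finite_finset.
pose Z := (\int[lebRp R p]_u (w u)%:E)%E.
have Z0 : (0 <= Z)%E by apply: integral_ge0 => u _; rewrite lee_fin.
have Zfin : Z \is a fin_num by rewrite ge0_fin_numE.
have Z10 : 0 < fine Z + 1 by rewrite ltr_wpDl// fine_ge0.
(* Half of [r] pays for the change of the weights, integrated over the whole space; the other half
   is the integral over [A]. *)
pose e := r / 2 / (fine Z + 1).
have e0 : 0 < e by rewrite divr_gt0.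
near=> t.
have eal : \sum_j `|t.1.1 j - al j| <= e.
  near: t; have cs : \sum_j `|t.1.1 j - al j| @[t --> F] --> \sum_(j < m) `|0 : R|.
    apply: cvg_bigsum => j _; apply: cvg_norm; rewrite -(subrr (al j)).
    by apply: cvgB; [exact: Fal|exact: cvg_cst].
  rewrite [\sum_(j < m) `|0|]big1 in cs; last by move=> j _; rewrite normr0.
  exact: (cvgr_le _ cs).
have emu : forall j, al j = 0 \/ forall k, `|t.1.2 j 0 k - mu j 0 k| < N.+1%:R^-1.
  near: t; apply: filter_forall => j; have [a0|cj] := Fmu j.
    by apply: nearW => t; left.
  have : \forall t \near F, forall k, `|(t.1.2 j : 'rV[R]_p) 0 k - mu j 0 k| < N.+1%:R^-1.
    apply: filter_forall => k; have := cj 0 k => /cvgrPdist_lt H.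
    by apply: filterS (H N.+1%:R^-1 _) => [t|]; [rewrite distrC|rewrite invr_gt0].
  by apply: filterS => t; right.
pose f u := `|Psi_of t.1.1 t.1.2 u - Psi_of al mu u|.
have fle u : f u <= e + \1_A u.
  pose b1 j : R := (`[< cwle (t.1.2 j) u >])%:R; pose b2 j : R := (`[< cwle (mu j) u >])%:R.
  have b10 j : 0 <= b1 j by exact: ler0n.
  have b11 j : b1 j <= 1 by rewrite /b1; case: (`[< _ >]).
  (* The change of weights is separated from the change of atoms. The second part carries the limit
     weight [al j], so it vanishes for atoms that need not converge. *)
  have -> : f u = `|\sum_j ((t.1.1 j - al j) * b1 j + al j * (b1 j - b2 j))|.
    rewrite /f /Psi_of -sumrB; congr `| _ |; apply: eq_bigr => j _; rewrite -/(b1 j) -/(b2 j).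
    by ring.
  apply: le_trans (ler_norm_sum _ _ _) _.
  apply: (@le_trans _ _ (\sum_j (`|t.1.1 j - al j| + al j * \1_A u))); last first.
    by rewrite big_split/= -mulr_suml al_sum mul1r lerD2r.
  apply: ler_sum => j _; apply: le_trans (ler_normD _ _) _; apply: lerD.
    by rewrite normrM (ger0_norm (b10 j)) ler_piMr.
  rewrite normrM (ger0_norm (al_ge0 j)).
  have [->|tj] := emu j; first by rewrite !mul0r.
  rewrite ler_wpM2l// indicE; case: (boolP (u \in A)) => [_|/negP uA].
    by rewrite /b1 /b2; do 2 case: (`[< _ >]); rewrite ?subrr ?subr0 ?sub0r ?normrN ?normr0 ?normr1.
  (* Off [A] each coordinate of [u] is farther from that of [mu j] than the perturbed atom is, so
     both atoms compare with [u] in the same way. *)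
  have far k : N.+1%:R^-1 < `|u 0 k - mu j 0 k|.
    rewrite ltNge; apply/negP => H; apply: uA; rewrite inE; by exists (j, k).
  suff -> : b1 j = b2 j by rewrite subrr normr0.
  rewrite /b1 /b2; congr (nat_of_bool _)%:R; apply: asbool_equiv_eq; split=> H k.
    rewrite leNgt; apply/negP => uk; have := far k; rewrite ltr0_norm ?subr_lt0// => fk.
    have := H k; have := tj k; rewrite ltr_distl => /andP[h1 _] h2.
    by move: fk h1 h2; set q := N.+1%:R^-1; lra.
  rewrite leNgt; apply/negP => uk; have := far k; have := H k => h2.
  rewrite ger0_norm ?subr_ge0// => fk.
  have := tj k; rewrite ltr_distl => /andP[_ h1].
  by move: fk h1 h2 uk; set q := N.+1%:R^-1; lra.
have mf : measurable_fun setT (f : Rp R p -> R).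
  by apply: measurableT_comp => //; apply: measurable_funB; exact: measurable_Psi.
have f0 u : 0 <= f u by exact: normr_ge0.
have mI : measurable_fun setT (\1_A : Rp R p -> R) by exact: measurable_indic.
have mwE : measurable_fun setT (fun u => (w u)%:E) by exact/measurable_EFinP.
have mwA : measurable_fun setT (fun u => (w u * \1_A u)%:E).
  by apply/measurable_EFinP; exact: measurable_funM.
have meW : measurable_fun setT (fun u => e%:E * (w u)%:E)%E by exact: emeasurable_funM.
have wE0 u : (0 <= (w u)%:E)%E by rewrite lee_fin.
have wA0 u : (0 <= (w u * \1_A u)%:E)%E by rewrite lee_fin mulr_ge0.
have ew0 u : (0 <= e%:E * (w u)%:E)%E by rewrite -EFinM lee_fin mulr_ge0// ltW.
rewrite /Dstar intRpE; last 2 first.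
- by apply/measurable_EFinP; exact: measurable_funM.
- by move=> u; rewrite lee_fin mulr_ge0.
apply: (@le_lt_trans _ _ (\int[lebRp R p]_u (e%:E * (w u)%:E + (w u * \1_A u)%:E))%E).
  apply: ge0_le_integral => //.
  - by apply/measurable_EFinP; exact: measurable_funM.
  - exact: emeasurable_funD.
  move=> u _; rewrite -EFinM -EFinD lee_fin [X in _ <= _ + X]mulrC -mulrDl.
  by rewrite ler_wpM2r//; exact: fle.
rewrite ge0_integralD// ge0_integralZl ?lee_fin ?(ltW e0)// -/Z.
move: AN; set Q := (\int[lebRp R p]_x (w x * \1_A x)%:E)%E => AN.
have Q0 : (0 <= Q)%E by apply: integral_ge0.
have Qfin : Q \is a fin_num by rewrite ge0_fin_numE// (lt_trans AN) ?ltry.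
rewrite -(fineK Zfin) -(fineK Qfin) -EFinM -EFinD lte_fin.
have q1 : fine Q < r / 2 by rewrite -lte_fin fineK.
have q2 : e * fine Z <= r / 2.
  by rewrite /e -mulrA ler_piMr ?(ltW r20)// mulrC ler_pdivrMr// mul1r lerDl.
by rewrite [ltRHS]splitr ler_ltD.
Unshelve. all: by end_near. Qed.

End mixing_distance.

(** * From likelihood products to consistency *)

Section extended_log.
Variable R : realType.
Local Open Scope ereal_scope.

(** A zero factor gives [-oo] on both sides, since [elog] never takes the value [+oo]. *)
Lemma elogM (a b : R) : (0 <= a)%R -> (0 <= b)%R -> elog (a * b) = elog a + elog b.
Proof.
move=> a0 b0; rewrite /elog.
have [a_gt0|a_le0] := ltP 0%R a; have [b_gt0|b_le0] := ltP 0%R b.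
- by rewrite mulr_gt0// lnM.
- have -> : b = 0%R by apply/eqP; rewrite eq_le b_le0.
  by rewrite mulr0 ltxx.
- have -> : a = 0%R by apply/eqP; rewrite eq_le a_le0.
  by rewrite mul0r ltxx.
- have -> : a = 0%R by apply/eqP; rewrite eq_le a_le0.
  by rewrite mul0r ltxx.
Qed.

Lemma sum_elog n (a : 'I_n -> R) : (forall i, 0 <= a i)%R ->
  \sum_(i < n) elog (a i) = elog (\prod_(i < n) a i).
Proof.
elim: n a => [|n IH] a a0; first by rewrite !big_ord0 /elog ltr01 ln1.
by rewrite !big_ord_recr/= IH// elogM// prodr_ge0.
Qed.

Lemma lt_elog (a b : R) : (0 <= a)%R -> (a < b)%R -> elog a < elog b.
Proof.
move=> a0 ab; rewrite /elog (le_lt_trans a0 ab); case: ifPn => a1; last exact: ltNyr.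
by rewrite lte_fin ltr_ln ?posrE// (lt_trans a1).
Qed.

End extended_log.

Section generator.
Variables (R : realType) (p : nat) (f0 : R -> R).

(* Quadratic forms are nonnegative, so [f0] may be replaced by its even extension. *)
Definition evenext (t : R) : R := f0 `|t|.

Lemma continuous_evenext :
  {within `[0%R, +oo[%classic, continuous f0} -> continuous evenext.
Proof.
move=> /subspace_continuousP cf0 t; apply/cvgrPdist_lt => e e0.
have nt : `[0%R, +oo[%classic `|t| by rewrite /= in_itv/= andbT.
have /cvgrPdist_lt/(_ e e0) := cf0 _ nt.
rewrite near_withinE => /nbhs_ballP[del /= del0 H].
apply/nbhs_ballP; exists del => //= u tu; apply: H; last by rewrite /= in_itv/= andbT.
exact: le_lt_trans (ler_dist_dist _ _) tu.
Qed.

Lemma kern_evenext (A : 'M[R]_p) z : kern f0 A z = kern evenext A z.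
Proof. by rewrite /kern /evenext (ger0_norm (sqnorm_ge0 (z *m A))). Qed.

(** With [r] the root of [t], the sum [1 + r] is at most 2 if [r <= 1] and at most [2 r] otherwise;
    either case costs the factor [2^be]. *)
Lemma generator_decay (v0 v1 be : R) : 0 < v0 -> 0 < v1 -> 0 < be ->
  (forall x, 0 <= x -> f0 x <= v0) ->
  (forall x, 0 < x -> f0 x <= v1 * x `^ (- (be / 2))) ->
  forall t, 0 <= t -> evenext t <= 2 `^ be * (v0 + v1) * (1 + Num.sqrt t) `^ (- be).
Proof.
move=> v00 v10 be0 H0 H1 t t0; rewrite /evenext ger0_norm//.
set r := Num.sqrt t; have r0 : 0 <= r by exact: sqrtr_ge0.
have r1 : 0 < 1 + r by rewrite ltr_pwDl.
rewrite powRN ler_pdivlMr ?powR_gt0//.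
have P0 : 0 < (1 + r) `^ be by exact: powR_gt0.
have P2 : 0 < 2 `^ be :> R by exact: powR_gt0.
have [rle|rgt] := leP r 1.
  apply: le_trans (ler_wpM2r (ltW P0) (H0 _ t0)) _.
  apply: (@le_trans _ _ (v0 * 2 `^ be)); last by rewrite mulrC ler_wpM2l ?(ltW P2)// lerDl ltW.
  rewrite ler_wpM2l ?(ltW v00)//.
  by apply: ge0_ler_powR; rewrite ?nnegrE ?(ltW be0) ?(ltW r1)//; move: rle; lra.
have t_gt0 : 0 < t by rewrite -sqrtr_gt0; apply: lt_trans rgt.
have rE : t `^ (- (be / 2)) = (r `^ be)^-1.
  by rewrite powRN /r -powR12_sqrt// -powRrM [2^-1 * be]mulrC.
apply: le_trans (ler_wpM2r (ltW P0) (H1 _ t_gt0)) _; rewrite rE.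
have rp : 0 < r by exact: lt_trans rgt.
apply: (@le_trans _ _ (v1 / r `^ be * (2 `^ be * r `^ be))).
  rewrite ler_wpM2l ?divr_ge0 ?powR_ge0 ?(ltW v10)// -powRM ?(ltW rp)//.
  by apply: ge0_ler_powR; rewrite ?nnegrE ?(ltW be0) ?(ltW r1) ?mulr_ge0 ?(ltW rp)//; move: rgt; lra.
rewrite mulrCA divfK ?gt_eqF ?powR_gt0// ler_wpM2l ?(ltW P2)// lerDr; exact: ltW.
Qed.

End generator.

Section consistency.
Context (R : realType) (d : measure_display) (T : measurableType d).
Variables (P : probability T R) (m p : nat) (X : nat -> T -> 'rV[R]_p).
Variables (f : R -> R) (v be : R) (t0 : param R m p) (s : R).
Hypothesis p_gt0 : (0 < p)%N.
Hypothesis cf : continuous f.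
Hypothesis f_ge0 : forall t, 0 <= f t.
Hypothesis f_dens : intRp (fun x : 'rV[R]_p => (f ((x *m x^T) 0 0))%:E) = 1%E.
Hypothesis f_decay : forall t, 0 <= t -> f t <= v * (1 + Num.sqrt t) `^ (- be).
Hypothesis be1 : 1 <= be.
Hypotheses (s0 : 0 < s) (s1 : s < 1) (sbe : p%:R < be * (1 - s)).
Hypothesis mix0 : is_mixing t0.1.1 t0.1.2.
Hypothesis unit0 : t0.2 \in unitmx.
Local Notation g0 := (gth f t0).
Hypothesis Xmeas : forall i, rvec_measurable (X i).
Hypothesis Xindep : mutually_independent P X.
Hypothesis Xdens : forall i, has_density P (X i) g0.
Local Notation scale A := (invmx (A *m A^T)).
Hypothesis identifiable : forall t : param R m p, is_mixing t.1.1 t.1.2 -> t.2 \in unitmx ->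
  gth f t =1 g0 -> Psi_of t.1.1 t.1.2 = Psi_of t0.1.1 t0.1.2 /\ scale t.2 = scale t0.2.

(** Distances are taken between mixing distributions and scale matrices, because atoms are
    determined only up to relabelling and [A] only up to an orthogonal factor. *)
Definition far (r : R) : set (param R m p) := [set t | [/\ is_mixing t.1.1 t.1.2, t.2 \in unitmx &
  ~ ((Dstar (Psi_of t.1.1 t.1.2) (Psi_of t0.1.1 t0.1.2) < r%:E)%E /\
     forall i j, `|scale t0.2 i j - scale t.2 i j| < r)]].

Lemma far_good r : 0 < r -> good P X g0 (gth f) (far r).
Proof.
move=> r0; apply: contrapT => /ultra_not_good[F [FU Ffar Fbad]].
have FP : ProperFilter F by exact: ultra_proper.
have Fmix : \forall t \near F, is_mixing t.1.1 t.1.2 by apply: filterS Ffar => t [].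
have [[A FA]|esc] := ultra_mxcvg_or_escape FU (fun t : param R m p => t.2); last first.
  have [G FG gG] := unbounded_good p_gt0 cf f_ge0 f_decay be1 s0 s1 sbe mix0 unit0
    Xmeas Xindep Xdens FU Fmix esc.
  exact: (Fbad G).
have [al [Fal al_ge0 al_sum]] := ultra_weights FU Fmix.
have [mu [fin Fmu]] := ultra_atoms FU.
have [gE sum1 dA] := limit_density p_gt0 cf f_ge0 f_dens f_decay be1 s0 s1 sbe mix0 unit0
  Xmeas Xindep Xdens FU Fmix Fbad FA Fal al_ge0 al_sum Fmu.
have Au : A \in unitmx by rewrite unitmxE unitfE.
(* The kept weights are termwise at most [al] and have the same sum, so they coincide; an escaped
   atom therefore has limit weight 0. *)
have alE j : (limit_param A al mu fin).1.1 j = al j.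
  have sum0 : \sum_j (al j - (limit_param A al mu fin).1.1 j) = 0.
    by rewrite sumrB sum1 al_sum subrr.
  apply/esym/eqP; rewrite -subr_eq0; apply/eqP; apply: (psumr_eq0P _ sum0) => // i _.
  by rewrite subr_ge0 limit_weight_le.
have [PsiE SE] : Psi_of al mu = Psi_of t0.1.1 t0.1.2 /\ scale A = scale t0.2.
  have <- : (limit_param A al mu fin).1.1 = al by apply/funext => j; exact: alE.
  apply: (identifiable (t := limit_param A al mu fin)) => //; split => //.
  by move=> j; exact: limit_weight_ge0.
have near_D : \forall t \near F, (Dstar (Psi_of t.1.1 t.1.2) (Psi_of t0.1.1 t0.1.2) < r%:E)%E.
  rewrite -PsiE; apply: Dstar_cvg => // j.
  have := Fmu j; have := alE j; rewrite /=; case: (fin j) => [_ ?|<- _]; first by right.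
  by left.
have near_S : \forall t \near F, forall i j, `|scale t0.2 i j - scale t.2 i j| < r.
  have cS : mxcvg F (fun t => scale t.2) (scale t0.2).
    rewrite -SE; apply: mxcvg_inv.
      by apply: mxcvgM => //; exact: mxcvg_tr.
    by rewrite det_mulmx det_tr mulf_neq0.
  apply: filter_forall => i; apply: filter_forall => j.
  by have /cvgrPdist_lt := cS i j; apply.
(* Both distances fall below [r] along [F], although [far r] belongs to [F]. *)
have : F set0.
  by apply: filterS3 near_D near_S Ffar => t h1 h2 [_ _]; apply; split.
exact: filter_not_empty.
Qed.

(** The radii [1 / (k + 1)] are countably many, so one null set serves them all. Any parameter at
    least as likely as the truth is covered, so a maximizer is. *)
Lemma mle_not_far : {ae P, forall w, forall k : nat, \forall n \near \oo, forall t : param R m p,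
  is_mixing t.1.1 t.1.2 -> t.2 \in unitmx ->
  (\sum_(i < n) elog (g0 (X i w)) <= \sum_(i < n) elog (gth f t (X i w)))%E ->
  (Dstar (Psi_of t.1.1 t.1.2) (Psi_of t0.1.1 t0.1.2) < k.+1%:R^-1%:E)%E /\
  forall i j, `|scale t0.2 i j - scale t.2 i j| < k.+1%:R^-1}.
Proof.
apply/ae_foralln => k.
have k0 : 0 < k.+1%:R^-1 :> R by rewrite invr_gt0.
have := far_good k0; rewrite /good; apply: filterS => w; apply: filterS => n Hn t mt ut le_t.
apply: contrapT => tfar.
have g0_ge0 x : 0 <= g0 x by apply: gth_ge0 => //; case: mix0.
have gt_ge0 x : 0 <= gth f t x by apply: gth_ge0 => //; case: mt.
have lt_t : \prod_(i < n) gth f t (X i w) < \prod_(i < n) g0 (X i w) by apply: Hn; split.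
move: le_t; rewrite !sum_elog// leNgt => /negP; apply.
by apply: lt_elog => //; exact: prodr_ge0.
Qed.

End consistency.

Theorem theorem2 (R : realType) (m p : nat) (m_gt0 : (0 < m)%N) (p_gt0 : (0 < p)%N)
  (f0 : R -> R) (f0_gen : density_generator p f0)
  (al0 : 'I_m -> R) (mu0 : 'I_m -> 'rV[R]_p) (S0 : 'M[R]_p)
  (mix0 : is_mixing al0 mu0) (S0pd : posdef S0)
  (* condition C1-star identifiability *)
  (C1 : forall (al1 : 'I_m -> R) (mu1 : 'I_m -> 'rV[R]_p) (S1 : 'M[R]_p)
               (al2 : 'I_m -> R) (mu2 : 'I_m -> 'rV[R]_p) (S2 : 'M[R]_p),
     is_mixing al1 mu1 -> posdef S1 -> is_mixing al2 mu2 -> posdef S2 ->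
     (forall x, gmix f0 al1 mu1 S1 x = gmix f0 al2 mu2 S2 x) ->
     Psi_of al1 mu1 = Psi_of al2 mu2 /\ S1 = S2)
  (* condition C2-star *)
  (C2 : (intRp (fun x : 'rV[R]_p =>
           (`|ln (gmix f0 al0 mu0 S0 x)| * gmix f0 al0 mu0 S0 x)%:E) < +oo)%E)
  (* condition C3-star ; at x = 0 the bound min{v0, v1 x^(-beta/2)} is v0 *)
  (C3 : exists v0 v1 beta : R, [/\ 0 < v0, 0 < v1, p%:R < beta,
     (forall x, 0 <= x -> f0 x <= v0) &
     (forall x, 0 < x -> f0 x <= v1 * powR x (- (beta / 2)))])
  (* condition C4-star *)
  (C4 : {within `[0%R, +oo[%classic, continuous f0})
  (* i.i.d. sample with density g(.; Psi0, Sigma0) *)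
  (d : measure_display) (T : measurableType d) (P : probability T R)
  (X : nat -> T -> 'rV[R]_p)
  (Xmeas : forall i, rvec_measurable (X i))
  (Xdens : forall i, has_density P (X i) (gmix f0 al0 mu0 S0))
  (Xindep : mutually_independent P X)
  (* the MLE (hat al_n, hat mu_n, hat Sigma_n) based on X_1..X_n (= X 0 .. X (n-1)) *)
  (hal : nat -> T -> 'I_m -> R) (hmu : nat -> T -> 'I_m -> 'rV[R]_p)
  (hS : nat -> T -> 'M[R]_p)
  (hmle : forall w, \forall n \near \oo,
     [/\ is_mixing (hal n w) (hmu n w), posdef (hS n w) &
      forall (al : 'I_m -> R) (mu : 'I_m -> 'rV[R]_p) (S : 'M[R]_p),
        is_mixing al mu -> posdef S ->
        (\sum_(i < n) elog (gmix f0 al mu S (X i w)) <=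
         \sum_(i < n) elog (gmix f0 (hal n w) (hmu n w) (hS n w) (X i w)))%E]) :
  {ae P, forall w,
     (Dstar (Psi_of (hal n w) (hmu n w)) (Psi_of al0 mu0) @[n --> \oo] --> 0%E) /\
     (hS n w @[n --> \oo] --> S0)}.
Proof.
have [_ [f0_ge0 f0_int]] := f0_gen.
have [v0 [v1 [be [v00 v10 pbe fv0 fv1]]]] := C3.
have p1 : 1 <= p%:R :> R by rewrite ler1n.
have be1 : 1 <= be by rewrite (le_trans p1)// ltW.
have be0 : 0 < be by exact: lt_le_trans be1.
pose f := evenext f0.
have cf : continuous f by exact: continuous_evenext.
have f_ge0 t : 0 <= f t by apply: f0_ge0.
have f_dens : intRp (fun x : 'rV[R]_p => (f ((x *m x^T) 0 0))%:E) = 1%E.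
  by rewrite -f0_int; apply: eq_intRp => x; rewrite /f /evenext ger0_norm// sqnorm_ge0.
have f_decay := generator_decay v00 v10 be0 fv0 fv1.
(* This places [be (1 - s)] at the midpoint of [p] and [be]. *)
pose s := (be - p%:R) / (be * 2).
have s0 : 0 < s by rewrite divr_gt0 ?subr_gt0 ?mulr_gt0.
have s1 : s < 1 by rewrite ltr_pdivrMr ?mulr_gt0// mul1r; move: p1 be0; lra.
have sbe : p%:R < be * (1 - s).
  have -> : be * (1 - s) = (be + p%:R) / 2 by rewrite /s; field; rewrite gt_eqF.
  by rewrite ltr_pdivlMr//; move: pbe; lra.
have gmixE al mu S A : invmx S = A *m A^T -> (Num.sqrt (\det S))^-1 = `|\det A| ->
    gmix f0 al mu S =1 @gth R m p f (al, mu, A).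
  move=> SA dS x; apply: eq_bigr => j _ /=; congr (_ * _).
  by rewrite (fell_kern f0 _ _ SA dS) kern_evenext.
have factor S : posdef S -> exists A : 'M[R]_p, [/\ A \in unitmx, S = invmx (A *m A^T) &
    forall al mu, gmix f0 al mu S =1 @gth R m p f (al, mu, A)].
  move=> Spd; have [A [Atri SA dS]] := posdef_factor Spd; have dA := uptri_det_gt0 Atri.
  exists A; split => [||al mu].
  - by rewrite unitmxE unitfE gt_eqF.
  - by rewrite -SA invmxK.
  - by apply: gmixE => //; rewrite (gtr0_norm dA).
(* The passage back from [A] to a scale matrix, for every invertible [A]: the limit matrix to which
   identifiability is applied need not be a Cholesky factor. *)
have gramE (A : 'M[R]_p) al mu : A \in unitmx ->
    gmix f0 al mu (invmx (A *m A^T)) =1 @gth R m p f (al, mu, A).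
  move=> Au x; apply: eq_bigr => j _ /=; congr (_ * _).
  by rewrite fell_gram// kern_evenext.
have [A0 [A0u S0E g0E]] := factor _ S0pd.
pose t0 : param R m p := (al0, mu0, A0).
have Xdens' i : has_density P (X i) (gth f t0).
  by move=> B mB; rewrite Xdens//; apply: eq_intRp => x; rewrite g0E.
have ident (t : param R m p) : is_mixing t.1.1 t.1.2 -> t.2 \in unitmx ->
    gth f t =1 gth f t0 -> Psi_of t.1.1 t.1.2 = Psi_of al0 mu0 /\
    invmx (t.2 *m t.2^T) = invmx (A0 *m A0^T).
  case: t => [[al mu] A] /= mt ut tE; rewrite -S0E; apply: C1 => //.
    exact/posdef_inv/gram_posdef.
  by move=> x; rewrite gramE// tE g0E.
have := @mle_not_far _ _ _ P m p X f _ be t0 s p_gt0 cf f_ge0 f_dens f_decay be1 s0 s1 sbe mix0 A0u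
  Xmeas Xindep Xdens' ident.
apply: filterS => w Hw.
have near_k k : \forall n \near \oo,
    (Dstar (Psi_of (hal n w) (hmu n w)) (Psi_of al0 mu0) < k.+1%:R^-1%:E)%E /\
    forall i j, `|S0 i j - hS n w i j| < k.+1%:R^-1.
  apply: filterS2 (Hw k) (hmle w) => n Hn [mn Sn mle].
  (* The estimate enters through a factor of its scale matrix and through the maximality inequality
     taken at the true parameter. *)
  have [A [Au SE gE]] := factor _ Sn.
  have := Hn (hal n w, hmu n w, A) mn Au.
  rewrite /= -SE -S0E; apply.
  have sumE al mu S B : gmix f0 al mu S =1 @gth R m p f (al, mu, B) ->
      (\sum_(i < n) elog (gth f (al, mu, B) (X i w)) = \sum_(i < n) elog (gmix f0 al mu S (X i w)))%E.
    by move=> SB; apply: eq_bigr => i _; rewrite SB.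
  by rewrite /t0 (sumE _ _ _ _ (g0E al0 mu0)) (sumE _ _ _ _ (gE _ _)); exact: mle.
have eps (e : R) : 0 < e -> exists k : nat, k.+1%:R^-1 < e.
  move=> e0; have [N _ /(_ N (leqnn _)) H] := near_infty_natSinv_lt (PosNum e0).
  by exists N.
have D0 n : (0 <= Dstar (Psi_of (hal n w) (hmu n w)) (Psi_of al0 mu0))%E.
  by apply: intRp_ge0 => u; rewrite lee_fin mulr_ge0// expR_ge0.
split.
  (* [Dstar] is extended-real, so finiteness for large [n] comes first; the bound by 1 at [k = 0]
     gives it. *)
  apply/fine_cvgP; split.
    apply: filterS (near_k 0%N) => n [Dn _].
    by rewrite ge0_fin_numE// (lt_trans Dn) ?ltry.
  apply/cvgr0Pnorm_lt => e e0; have [k ke] := eps e e0.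
  apply: filterS (near_k k) => n [Dn _] /=.
  have Dfin : Dstar (Psi_of (hal n w) (hmu n w)) (Psi_of al0 mu0) \is a fin_num.
    by rewrite ge0_fin_numE// (lt_trans Dn) ?ltry.
  by rewrite ger0_norm ?fine_ge0//; apply: lt_trans ke; rewrite -lte_fin fineK.
apply: mxcvg_cvg => e e0; have [k ke] := eps e e0.
by apply: filterS (near_k k) => n [_ Sn] i j; exact: lt_trans (Sn i j) ke.
Qed.
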